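(* For every $\mu\in\mathbb N_0$ the higher signature operator $P_\mu$ on oriented four-dimensional Riemannian manifolds is a chiral geometric operator. That is, the $\mathrm{SO}(4)$-representation $W_\mu=W_\mu^+\oplus W_\mu^-$ extends to an $\mathrm{O}(4)$-representation such that the symbol of $P_\mu$ together with $\varepsilon(\mathbf e_1\wedge\dots\wedge\mathbf e_4)=\mathrm{id}_{W_\mu^+}\oplus(-\mathrm{id}_{W_\mu^-})$ is a chiral universal elliptic $\mathrm{SO}(4)$-symbol.
   Context: Irreducible complex $\mathrm{SO}(4)$-representations $V_{(\lambda_1,\lambda_2)}$ are indexed by dominant weights $\lambda\in\mathbb Z^2$ with $\lambda_1\ge|\lambda_2|$. For an oriented Riemannian four-manifold $M$, write $V_\lambda M$ for the bundle associated with the oriented orthonormal frame bundle. For $\mu\ge0$ let $\tilde P_\mu^-:\Gamma(V_{(\mu+1,\mu)}M)\to\Gamma(V_{(\mu,\mu)}M\oplus V_{(\mu+1,\mu+1)}M)$ and $\tilde P_\mu^+:\Gamma(V_{(\mu+1,-\mu)}M)\to\Gamma(V_{(\mu,-\mu)}M\oplus V_{(\mu+1,-(\mu+1))}M)$ be the Levi-Civita covariant derivative followed by the orthogonal projections of $T^*M\otimes V_{(\mu+1,\pm\mu)}M$ onto the indicated summands (each occurring with multiplicity one). Put $W_\mu^+=V_{(\mu,\mu)}\oplus V_{(\mu+1,-\mu)}\oplus V_{(\mu+1,\mu+1)}$, $W_\mu^-=V_{(\mu,-\mu)}\oplus V_{(\mu+1,\mu)}\oplus V_{(\mu+1,-(\mu+1))}$,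 $W_\mu=W_\mu^+\oplus W_\mu^-$. The higher signature operator acts on sections of the bundle associated with $W_\mu$ by $$P_\mu=\begin{pmatrix}0&\tilde P_\mu^-\oplus(\tilde P_\mu^+)^*\\ \tilde P_\mu^+\oplus(\tilde P_\mu^-)^*&0\end{pmatrix}$$ with respect to $W_\mu=W_\mu^+\oplus W_\mu^-$. A chiral universal elliptic $\mathrm{SO}(n)$-symbol is a pair $(\sigma,\varepsilon)$ of an $\mathrm{O}(n)$-equivariant linear map $\sigma:\mathbb R^n\to\mathrm{End}(V)$, $V$ a unitary $\mathrm{O}(n)$-representation, with $\sigma(\zeta)$ invertible for all $\zeta\neq0$, and an $\mathrm{O}(n)$-equivariant linear map $\varepsilon:\Lambda^n\mathbb R^n\to\mathrm{End}(V)$, such that $\sigma(\zeta)$ is skew-adjoint for all $\zeta$, $\varepsilon(\mathbf e_1\wedge\dots\wedge\mathbf e_n)^2=1$ and $\sigma(\zeta)$ anticommutes with $\varepsilon(\mathbf e_1\wedge\dots\wedge\mathbf e_n)$ for all $\zeta$, where $\mathbf e_1,\dots,\mathbf e_n$ is the standard basis. A chiral geometric operator is an operator $\bar\sigma\circ\nabla^{LC}$ obtained from such a symbol, $\bar\sigma$ being the induced bundle map and $\nabla^{LC}$ the connection induced by the Levi-Civita connection. *)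

(* Defs.v *)
From HB Require Import structures.
From mathcomp Require Import all_boot all_order all_algebra.
From mathcomp Require Import spectral.
From mathcomp Require Import complex mxtens.
From mathcomp Require Import all_classical all_reals all_analysis.

Set Implicit Arguments.
Unset Strict Implicit.
Unset Printing Implicit Defensive.

Import Order.TTheory GRing.Theory Num.Theory.
Import numFieldNormedType.Exports.
Local Open Scope complex_scope.
Local Open Scope ring_scope.
Local Open Scope classical_set_scope.
Local Open Scope sesquilinear_scope.

Definition Ogroup (R : realType) (n : nat) : set 'M[R]_n :=
  [set g | g *m g^T = 1%:M].
Arguments Ogroup R n : clear implicits.

Definition SOgroup (R : realType) (n : nat) : set 'M[R]_n :=
  [set g | Ogroup R n g /\ \det g = 1].
Arguments SOgroup R n : clear implicits.

(* Representations act on column vectors; a finite-dimensional unitary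
   representation is written in an orthonormal basis, so that it takes values
   in the unitary matrices.  Only the values of [rho] on [G] matter. *)
Record unitary_rep (R : realType) (n : nat) (G : set 'M[R]_n) (d : nat)
    (rho : 'M[R]_n -> 'M[R[i]]_d) : Prop := UnitaryRep {
  unitary_rep_continuous_Re : {within G, continuous (fun g => map_mx (@complex.Re R) (rho g))};
  unitary_rep_continuous_Im : {within G, continuous (fun g => map_mx (@complex.Im R) (rho g))};
  unitary_rep1 : rho 1%:M = 1%:M;
  unitary_repM : forall g h, G g -> G h -> rho (g *m h) = rho g *m rho h;
  unitary_rep_unitary : forall g, G g -> rho g \is unitarymx }.

Definition irreducible_rep (R : realType) (n : nat) (G : set 'M[R]_n) (d : nat)
    (rho : 'M[R]_n -> 'M[R[i]]_d) : Prop :=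
  (0 < d)%N /\
  forall U : {vspace 'cV[R[i]]_d},
    (forall g v, G g -> v \in U -> rho g *m v \in U) ->
    U = 0%VS \/ U = fullv.

Definition rot (R : realType) (z : R[i]) : 'M[R]_2 :=
  block_mx ((complex.Re z)%:M : 'M[R]_1) (- complex.Im z)%:M
           (complex.Im z)%:M ((complex.Re z)%:M : 'M[R]_1).

(* For |z1| = |z2| = 1 these are the elements of the standard maximal torus of
   SO(4): rotations of the planes <e_1, e_2> and <e_3, e_4>. *)
Definition torus (R : realType) (z1 z2 : R[i]) : 'M[R]_4 :=
  block_mx (rot z1) 0 0 (rot z2).

Definition is_weight (R : realType) (d : nat) (rho : 'M[R]_4 -> 'M[R[i]]_d)
    (l1 l2 : int) : Prop :=
  exists2 v : 'cV[R[i]]_d, v != 0 &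
    forall z1 z2 : R[i], `|z1| = 1 -> `|z2| = 1 ->
      rho (torus z1 z2) *m v = (z1 ^ l1 * z2 ^ l2) *: v.

(* The simple roots of SO(4) are (1, -1) and (1, 1). *)
Definition highest_weight (R : realType) (d : nat)
    (rho : 'M[R]_4 -> 'M[R[i]]_d) (l1 l2 : int) : Prop :=
  is_weight rho l1 l2 /\
  forall m1 m2 : int, is_weight rho m1 m2 ->
    exists a b : nat,
      l1 - m1 = a%:Z + b%:Z /\ l2 - m2 = b%:Z - a%:Z.

(* The realizations of the irreducible SO(4)-representation V_(l1, l2). *)
Record irrep (R : realType) (l1 l2 : int) : Type := Irrep {
  irrep_dim : nat;
  irrep_act :> 'M[R]_4 -> 'M[R[i]]_irrep_dim;
  irrep_unitary : unitary_rep (SOgroup R 4) irrep_act;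
  irrep_irreducible : irreducible_rep (SOgroup R 4) irrep_act;
  irrep_highest_weight : highest_weight irrep_act l1 l2 }.

Definition complexify (R : realType) (m n : nat) (A : 'M[R]_(m, n)) :
  'M[R[i]]_(m, n) := map_mx (real_complex R) A.

(* The orthogonal projection of C^4 (x) V onto a summand isomorphic to U,
   followed by a unitary equivariant identification of that summand with U:
   [p *m p ^t* = 1] says that [p ^t*] is an isometric embedding of U and that
   [p ^t* *m p] is the orthogonal projection onto its image. *)
Record summand_projection (R : realType) (l1 l2 k1 k2 : int)
    (V : irrep R l1 l2) (U : irrep R k1 k2) : Type := SummandProjection {
  projection_mx :> 'M[R[i]]_(irrep_dim U, 4 * irrep_dim V);
  projection_unitary : projection_mx \is unitarymx;
  projection_equivariant : forall g, SOgroup R 4 g ->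
    projection_mx *m (complexify g *t V g) = U g *m projection_mx }.

(* Symbol of [p] composed with the covariant derivative:
   zeta |-> (v |-> p (zeta (x) v)), given by its columns. *)
Definition gradient_symbol (R : realType) (n d k : nat)
    (p : 'M[R[i]]_(k, n * d)) (zeta : 'cV[R]_n) : 'M[R[i]]_(k, d) :=
  \matrix_(i, j) (p *m (complexify zeta *t (delta_mx j 0 : 'cV[R[i]]_d))) i 0.

Lemma gradient_symbolE (R : realType) (n d k : nat)
    (p : 'M[R[i]]_(k, n * d))
    (zeta : 'cV[R]_n) (v : 'cV[R[i]]_d) :
  gradient_symbol p zeta *m v = p *m (complexify zeta *t v).
Proof.
apply/matrixP=> i j; rewrite [j]ord1 !mxE.
under eq_bigr do rewrite !mxE mulr_suml.
rewrite exchange_big; apply: eq_bigr => l _.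
rewrite (bigD1 (mxtens_unindex l).2) //= big1 ?addr0.
  by rewrite !mxE !ord1 !eqxx mulr1 mulrA.
by move=> m ne; rewrite !mxE eq_sym (negbTE ne) /= !(mulr0, mul0r).
Qed.

(* In a frame that is synchronous at a point, the formal adjoint of
   sum_i A_i nabla_(e_i) is - sum_i A_i^* nabla_(e_i). *)
Definition adjoint_symbol (R : realType) (n d k : nat)
    (sigma : 'cV[R]_n -> 'M[R[i]]_(k, d)) (zeta : 'cV[R]_n) :
  'M[R[i]]_(d, k) := - (sigma zeta) ^t*.

Definition diag3_mx (K : pzRingType) (a b c : nat)
    (A : 'M[K]_a) (B : 'M[K]_b) (C : 'M[K]_c) : 'M[K]_(a + (b + c)) :=
  block_mx A 0 0 (block_mx B 0 0 C).

(* The 3 x 3 block matrix [0 A 0; B 0 C; 0 D 0]. *)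
Definition cross3_mx (K : pzRingType) (a1 a2 a3 b1 b2 b3 : nat)
    (A : 'M[K]_(a1, b2)) (B : 'M[K]_(a2, b1)) (C : 'M[K]_(a2, b3))
    (D : 'M[K]_(a3, b2)) : 'M[K]_(a1 + (a2 + a3), b1 + (b2 + b3)) :=
  block_mx 0 (row_mx A 0) (col_mx B 0) (block_mx 0 C D 0).

Section HigherSignature.
Variables (R : realType) (mu : nat).

(* Entries of W_mu^+ and of W_mu^-, in this order.  Since (0, 0) = (0, -0),
   W_0 contains two copies of V_(0, 0) and two of V_(1, 0). *)
Variables (V0p : irrep R mu%:Z mu%:Z)
          (V1m : irrep R mu.+1%:Z (- mu%:Z))
          (V2p : irrep R mu.+1%:Z mu.+1%:Z).
Variables (V0m : irrep R mu%:Z (- mu%:Z))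
          (V1p : irrep R mu.+1%:Z mu%:Z)
          (V2m : irrep R mu.+1%:Z (- mu.+1%:Z)).

Definition Wp_dim : nat := irrep_dim V0p + (irrep_dim V1m + irrep_dim V2p).
Definition Wm_dim : nat := irrep_dim V0m + (irrep_dim V1p + irrep_dim V2m).
Definition W_dim : nat := Wp_dim + Wm_dim.

Definition W_act (g : 'M[R]_4) : 'M[R[i]]_W_dim :=
  block_mx (diag3_mx (V0p g) (V1m g) (V2p g)) 0
           0 (diag3_mx (V0m g) (V1p g) (V2m g)).

(* [q0], [q2] are the components of tilde P_mu^-, and [r0], [r2] those of
   tilde P_mu^+. *)
Variables (q0 : summand_projection V1p V0p) (q2 : summand_projection V1p V2p).
Variables (r0 : summand_projection V1m V0m) (r2 : summand_projection V1m V2m).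

Definition higher_signature_symbol (zeta : 'cV[R]_4) : 'M[R[i]]_W_dim :=
  block_mx
    0
    (cross3_mx
       (gradient_symbol q0 zeta)
       (adjoint_symbol (gradient_symbol r0) zeta)
       (adjoint_symbol (gradient_symbol r2) zeta)
       (gradient_symbol q2 zeta))
    (cross3_mx
       (gradient_symbol r0 zeta)
       (adjoint_symbol (gradient_symbol q0) zeta)
       (adjoint_symbol (gradient_symbol q2) zeta)
       (gradient_symbol r2 zeta))
    0.

Definition W_grading : 'M[R[i]]_W_dim :=
  block_mx (1%:M : 'M[R[i]]_Wp_dim) 0 0 (- (1%:M : 'M[R[i]]_Wm_dim)).

End HigherSignature.

Definition real_linear (R : realType) (n d : nat)
    (sigma : 'cV[R]_n -> 'M[R[i]]_d) : Prop :=
  forall (a : R) (x y : 'cV[R]_n),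
    sigma (a *: x + y) = a%:C *: sigma x + sigma y.

(* Linear maps from the top exterior power Lambda^n R^n are encoded, through
   its universal property, as alternating multilinear maps of n vectors, the
   vectors being the columns of a matrix: eps (v_1 /\ ... /\ v_n) is the value
   of [eps] at the matrix with columns v_1, ..., v_n, so that the value at
   e_1 /\ ... /\ e_n is [eps 1%:M] and an orthogonal g acts by left
   multiplication. *)
Definition alternating_multilinear (R : realType) (n d : nat)
    (eps : 'M[R]_n -> 'M[R[i]]_d) : Prop :=
  (forall (A B C : 'M[R]_n) (j : 'I_n) (b c : R),
     col j A = b *: col j B + c *: col j C ->
     col' j B = col' j A -> col' j C = col' j A ->
     eps A = b%:C *: eps B + c%:C *: eps C) /\
  (forall (A : 'M[R]_n) (j1 j2 : 'I_n),
     j1 != j2 -> col j1 A = col j2 A -> eps A = 0).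

Record chiral_universal_elliptic_symbol (R : realType) (n d : nat)
    (rho : 'M[R]_n -> 'M[R[i]]_d)
    (sigma : 'cV[R]_n -> 'M[R[i]]_d)
    (eps : 'M[R]_n -> 'M[R[i]]_d) : Prop := ChiralUniversalEllipticSymbol {
  chiral_rep : unitary_rep (Ogroup R n) rho;
  chiral_symbol_linear : real_linear sigma;
  chiral_symbol_equivariant : forall g zeta, Ogroup R n g ->
    sigma (g *m zeta) = rho g *m sigma zeta *m invmx (rho g);
  chiral_symbol_elliptic : forall zeta : 'cV[R]_n,
    zeta != 0 -> sigma zeta \in unitmx;
  chiral_eps_linear : alternating_multilinear eps;
  chiral_eps_equivariant : forall g A, Ogroup R n g ->
    eps (g *m A) = rho g *m eps A *m invmx (rho g);
  chiral_symbol_skew : forall zeta, (sigma zeta) ^t* = - sigma zeta;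
  chiral_eps_involution : eps 1%:M *m eps 1%:M = 1%:M;
  chiral_anticommute : forall zeta,
    sigma zeta *m eps 1%:M = - (eps 1%:M *m sigma zeta) }.

(* Main.v *)
(* The irreducible representation V_(l1, l2) is the tensor product
   S^a (x) S^b of representations of the two commuting SU(2) factors of SO(4),
   with a = l1 + l2 and b = l1 - l2; these factors act on R^4, the quaternions,
   by left and right multiplication.  Conjugation by tau = diag(1, 1, 1, -1)
   exchanges the factors, hence turns V_(l1, l2) into V_(l1, -l2).  So each
   summand of W_mu^+ is equivalent, after this twist, to one of W_mu^-, and
   these equivalences define the action of tau on W_mu; since the summands of
   C^4 (x) V_(mu+1, mu) have multiplicity one, their phases can be chosen so
   that the symbol is equivariant under tau.
   For ellipticity, consider q(e_1) : V_(mu+1, mu) -> U for the two targets U: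
   the right factor acts trivially on U, so U stays irreducible under the
   stabilizer SO(3) of e_1, and by Schur's lemma q(e_1) q(e_1)^* is a scalar,
   nonzero because SO(4) is transitive on the sphere, while the product for two
   different targets vanishes.  The dimensions add up, so the two components of
   the symbol together are bijective.  The same argument gives multiplicity
   one. *)

Require Import Defs.
From HB Require Import structures.
From mathcomp Require Import all_boot all_order all_algebra.
From mathcomp Require Import spectral.
From mathcomp Require Import complex mxtens.
From mathcomp Require Import all_classical all_reals all_analysis.
From mathcomp Require Import ring lra.

Set Implicit Arguments.
Unset Strict Implicit.
Unset Printing Implicit Defensive.

Import Order.TTheory GRing.Theory Num.Theory.
Import numFieldNormedType.Exports.
Local Open Scope complex_scope.
Local Open Scope ring_scope.
Local Open Scope classical_set_scope.
Local Open Scope sesquilinear_scope.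

(** * Complex-valued functions of a real variable *)

(** An [irrep] is known only as a continuous, irreducible family of unitary matrices with a highest
    weight. Its dimension, the triviality of one factor and the equivalence of a twisted summand
    with its mirror image must all be derived from that. One operator does it: the sum of the
    suitably scaled F_L^i F_R^j v' v^t* E_R^j E_L^i, made from unit highest weight vectors v, v' and
    two commuting sl2 triples. It intertwines any two irreducibles with equal labels a, b. From V to
    itself Schur's lemma makes it the identity; its trace is then the dimension (a+1)(b+1), and for
    b = 0 it forces E_R = 0. The triples require derivatives of a merely continuous representation,
    brackets without matrix exponentials, and a return from generators to all of SO(4). The phases
    in the action of tau cannot conflict. Any isometry T between V_(mu+1, mu) and V_(mu+1, -mu) is
    allowed, with its adjoint in the other direction, so the square of tau acts as 1. Then q0 and r0
    constrain only the phase of the isometry S0 between their targets, and q2 and r2 only that of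
    S2. *)

Section ComplexDerivative.
Variable R : realType.
Implicit Types (f g : R -> R[i]) (t : R).

(** Taken componentwise because the variable is real: the mean value theorem, the fundamental
    theorem of calculus and uniqueness of derivatives then apply to each component. *)
Definition cderiv f t (l : R[i]) : Prop :=
  is_derive t 1 (fun s => complex.Re (f s)) (complex.Re l) /\
  is_derive t 1 (fun s => complex.Im (f s)) (complex.Im l).

Lemma cderiv_cst (c : R[i]) t : cderiv (fun=> c) t 0.
Proof. by split; exact: is_derive_cst. Qed.

Lemma ReD (x y : R[i]) : complex.Re (x + y) = complex.Re x + complex.Re y.
Proof. by case: x y => [a b] [c d]. Qed.
Lemma ImD (x y : R[i]) : complex.Im (x + y) = complex.Im x + complex.Im y.
Proof. by case: x y => [a b] [c d]. Qed.
Lemma ReM (x y : R[i]) : complex.Re (x * y) =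
  complex.Re x * complex.Re y - complex.Im x * complex.Im y.
Proof. by case: x y => [a b] [c d]. Qed.
Lemma ImM (x y : R[i]) : complex.Im (x * y) =
  complex.Re x * complex.Im y + complex.Im x * complex.Re y.
Proof. by case: x y => [a b] [c d]. Qed.

Lemma cderivD f g t l k :
  cderiv f t l -> cderiv g t k -> cderiv (fun s => f s + g s) t (l + k).
Proof.
move=> [f1 f2] [g1 g2]; split.
  under eq_fun do rewrite ReD; rewrite ReD; exact: is_deriveD.
under eq_fun do rewrite ImD; rewrite ImD; exact: is_deriveD.
Qed.

Lemma cderivM f g t l k : cderiv f t l -> cderiv g t k ->
  cderiv (fun s => f s * g s) t (l * g t + f t * k).
Proof.
move=> [f1 f2] [g1 g2]; split.
- under eq_fun do rewrite ReM.
  have := is_deriveB (is_deriveM f1 g1) (is_deriveM f2 g2).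
  move=> /is_derive_eq; apply; rewrite ReD !ReM /GRing.scale/=; ring.
- under eq_fun do rewrite ImM.
  have := is_deriveD (is_deriveM f1 g2) (is_deriveM f2 g1).
  move=> /is_derive_eq; apply; rewrite ImD !ImM /GRing.scale/=; ring.
Qed.

Lemma cderiv_sum (I : Type) (r : seq I) (P : pred I) (F : I -> R -> R[i])
    (l : I -> R[i]) t :
  (forall i, P i -> cderiv (F i) t (l i)) ->
  cderiv (fun s => \sum_(i <- r | P i) F i s) t (\sum_(i <- r | P i) l i).
Proof.
move=> dF; elim: r => [|i r IH].
  under eq_fun do rewrite big_nil; rewrite big_nil; exact: cderiv_cst.
under eq_fun do rewrite big_cons; rewrite big_cons; case: ifP => // Pi.
by apply: cderivD => //; exact: dF.
Qed.

Lemma cderiv_comp f (g : R -> R) t l (b : R) :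
  cderiv f (g t) l -> is_derive t 1 g b ->
  cderiv (fun s => f (g s)) t (b%:C * l).
Proof.
move=> [f1 f2] dg; split.
  apply: is_derive_eq; first exact: (is_derive1_comp f1 dg).
  by rewrite ReM /= mul0r subr0 mulrC.
apply: is_derive_eq; first exact: (is_derive1_comp f2 dg).
by rewrite ImM /= mul0r addr0 mulrC.
Qed.

Lemma cderiv_real (f : R -> R) t (l : R) :
  is_derive t 1 f l -> cderiv (fun s => (f s)%:C) t l%:C.
Proof. by move=> df; split => //=; exact: is_derive_cst. Qed.

Lemma cderiv_conj f t l :
  cderiv f t l -> cderiv (fun s => Num.conj (f s)) t (Num.conj l).
Proof.
have reJ (x : R[i]) : complex.Re (Num.conj x) = complex.Re x by case: x.
have imJ (x : R[i]) : complex.Im (Num.conj x) = - complex.Im x by case: x.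
move=> [f1 f2]; split.
  by under eq_fun do rewrite reJ; rewrite reJ.
under eq_fun do rewrite imJ; rewrite imJ; exact: is_deriveN.
Qed.

Lemma cderiv_uniq f t l k : cderiv f t l -> cderiv f t k -> l = k.
Proof.
move=> [[_ l1] [_ l2]] [[_ k1] [_ k2]].
case: l l1 l2 => a b /= l1 l2; case: k k1 k2 => c d /= k1 k2.
by rewrite -l1 -l2 k1 k2.
Qed.

Lemma cderiv_near f g t l :
  (\forall s \near t, f s = g s) -> cderiv f t l -> cderiv g t l.
Proof.
move=> fg [f1 f2]; split.
  apply: near_eq_is_derive f1.
  by near=> s; congr complex.Re; near: s.
apply: near_eq_is_derive f2.
by near=> s; congr complex.Im; near: s.
Unshelve. all: by end_near. Qed.

Lemma cderiv0_cst f : (forall t, cderiv f t 0) -> forall s t, f s = f t.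
Proof.
move=> df s t.
have := is_derive_0_is_cst s t (fun x => (df x).1).
have := is_derive_0_is_cst s t (fun x => (df x).2).
by case: (f s) (f t) => [a b] [c d] /= -> ->.
Qed.

Definition mderiv m n (F : R -> 'M[R[i]]_(m, n)) t (X : 'M[R[i]]_(m, n)) :=
  forall i j, cderiv (fun s => F s i j) t (X i j).

Lemma mderiv_cst m n (C : 'M[R[i]]_(m, n)) t : mderiv (fun=> C) t 0.
Proof. by move=> i j; rewrite mxE; exact: cderiv_cst. Qed.

Lemma mderivD m n (F G : R -> 'M[R[i]]_(m, n)) t X Y :
  mderiv F t X -> mderiv G t Y -> mderiv (fun s => F s + G s) t (X + Y).
Proof.
move=> dF dG i j; under eq_fun do rewrite mxE; rewrite mxE.
by apply: cderivD; [exact: dF | exact: dG].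
Qed.

Lemma mderivM m n p (F : R -> 'M[R[i]]_(m, n)) (G : R -> 'M[R[i]]_(n, p)) t X Y :
  mderiv F t X -> mderiv G t Y ->
  mderiv (fun s => F s *m G s) t (X *m G t + F t *m Y).
Proof.
move=> dF dG i j; under eq_fun do rewrite mxE.
rewrite !mxE -big_split /=; apply: cderiv_sum => k _.
by apply: cderivM; [exact: dF | exact: dG].
Qed.

Lemma mderivMl m n p (A : 'M[R[i]]_(m, n)) (G : R -> 'M[R[i]]_(n, p)) t Y :
  mderiv G t Y -> mderiv (fun s => A *m G s) t (A *m Y).
Proof.
by move=> /(mderivM (mderiv_cst A t)); rewrite mul0mx add0r.
Qed.

Lemma mderivMr m n p (F : R -> 'M[R[i]]_(m, n)) (B : 'M[R[i]]_(n, p)) t X :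
  mderiv F t X -> mderiv (fun s => F s *m B) t (X *m B).
Proof.
by move=> /mderivM/(_ (mderiv_cst B t)); rewrite mulmx0 addr0.
Qed.

Lemma mderivZ m n (c : R -> R[i]) (F : R -> 'M[R[i]]_(m, n)) t l X :
  cderiv c t l -> mderiv F t X ->
  mderiv (fun s => c s *: F s) t (l *: F t + c t *: X).
Proof.
move=> dc dF i j; under eq_fun do rewrite mxE; rewrite !mxE.
by apply: cderivM; [exact: dc | exact: dF].
Qed.

Lemma mderiv_comp m n (F : R -> 'M[R[i]]_(m, n)) (g : R -> R) t X (b : R) :
  mderiv F (g t) X -> is_derive t 1 g b ->
  mderiv (fun s => F (g s)) t (b%:C *: X).
Proof. by move=> dF dg i j; rewrite mxE; exact: (cderiv_comp (dF i j) dg). Qed.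

Lemma mderiv_adj m n (F : R -> 'M[R[i]]_(m, n)) t X :
  mderiv F t X -> mderiv (fun s => (F s)^t*) t (X^t*).
Proof.
move=> dF i j; rewrite !mxE; under eq_fun do rewrite !mxE.
by apply: cderiv_conj; exact: dF.
Qed.

Lemma mderiv_uniq m n (F : R -> 'M[R[i]]_(m, n)) t X Y :
  mderiv F t X -> mderiv F t Y -> X = Y.
Proof. by move=> FX FY; apply/matrixP=> i j; exact: (cderiv_uniq (FX i j) (FY i j)). Qed.

Lemma mderiv_near m n (F G : R -> 'M[R[i]]_(m, n)) t X :
  (\forall s \near t, F s = G s) -> mderiv F t X -> mderiv G t X.
Proof.
move=> FG dF i j; apply: (cderiv_near _ (dF i j)).
by near=> s; congr (fun_of_matrix _ i j); near: s.
Unshelve. all: by end_near. Qed.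

Lemma mderiv0_cst m n (F : R -> 'M[R[i]]_(m, n)) :
  (forall t, mderiv F t 0) -> forall s t, F s = F t.
Proof.
move=> dF s t; apply/matrixP=> i j; apply: (@cderiv0_cst (fun s => F s i j)) => r.
by have := dF r i j; rewrite mxE.
Qed.

End ComplexDerivative.

(** * One-parameter groups of matrices *)

Section OneParameterGroups.
Variable R : realType.

Definition ccvg (T : Type) (F : set_system T) (f : T -> R[i]) (l : R[i]) : Prop :=
  (fun x => complex.Re (f x)) @ F --> complex.Re l /\
  (fun x => complex.Im (f x)) @ F --> complex.Im l.

Section Limits.
Context (T : Type) (F : set_system T) {FF : Filter F}.

Lemma ccvg_cst (c : R[i]) : ccvg F (fun=> c) c.
Proof. by split; exact: cvg_cst. Qed.

Lemma ccvgD f g k l : ccvg F f k -> ccvg F g l -> ccvg F (fun x => f x + g x) (k + l).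
Proof.
move=> [f1 f2] [g1 g2]; split.
  by under eq_fun do rewrite ReD; rewrite ReD; exact: cvgD.
by under eq_fun do rewrite ImD; rewrite ImD; exact: cvgD.
Qed.

Lemma ccvgM f g k l : ccvg F f k -> ccvg F g l -> ccvg F (fun x => f x * g x) (k * l).
Proof.
move=> [f1 f2] [g1 g2]; split.
  under eq_fun do rewrite ReM; rewrite ReM.
  exact: (cvgB (cvgM f1 g1) (cvgM f2 g2)).
under eq_fun do rewrite ImM; rewrite ImM.
exact: (cvgD (cvgM f1 g2) (cvgM f2 g1)).
Qed.

Lemma ccvg_sum (I : Type) (r : seq I) (f : I -> T -> R[i]) (l : I -> R[i]) :
  (forall i, ccvg F (f i) (l i)) ->
  ccvg F (fun x => \sum_(i <- r) f i x) (\sum_(i <- r) l i).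
Proof.
move=> fl; elim: r => [|i r IH].
  by under eq_fun do rewrite big_nil; rewrite big_nil; exact: ccvg_cst.
by under eq_fun do rewrite big_cons; rewrite big_cons; exact: ccvgD.
Qed.

Lemma ccvg_prod (I : Type) (r : seq I) (f : I -> T -> R[i]) (l : I -> R[i]) :
  (forall i, ccvg F (f i) (l i)) ->
  ccvg F (fun x => \prod_(i <- r) f i x) (\prod_(i <- r) l i).
Proof.
move=> fl; elim: r => [|i r IH].
  by under eq_fun do rewrite big_nil; rewrite big_nil; exact: ccvg_cst.
by under eq_fun do rewrite big_cons; rewrite big_cons; exact: ccvgM.
Qed.

Definition mcvg m n (f : T -> 'M[R[i]]_(m, n)) (M : 'M[R[i]]_(m, n)) : Prop :=
  forall i j, ccvg F (fun x => f x i j) (M i j).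

Lemma mcvg_cst m n (M : 'M[R[i]]_(m, n)) : mcvg (fun=> M) M.
Proof. by move=> i j; exact: ccvg_cst. Qed.

Lemma mcvgM m n p (f : T -> 'M[R[i]]_(m, n)) (g : T -> 'M[R[i]]_(n, p)) A B :
  mcvg f A -> mcvg g B -> mcvg (fun x => f x *m g x) (A *m B).
Proof.
move=> fA gB i j; under eq_fun do rewrite mxE; rewrite mxE.
by apply: ccvg_sum => k; apply: ccvgM; [exact: fA | exact: gB].
Qed.

Lemma mcvg_det d (f : T -> 'M[R[i]]_d) A :
  mcvg f A -> ccvg F (fun x => \det (f x)) (\det A).
Proof.
move=> fA; rewrite /determinant; apply: ccvg_sum => p.
by apply: ccvgM; [exact: ccvg_cst | apply: ccvg_prod => i; exact: fA].
Qed.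

End Limits.

Definition ccont (f : R -> R[i]) (t : R) : Prop := ccvg (nbhs t) f (f t).

Lemma ccont_cst (c : R[i]) t : ccont (fun=> c) t.
Proof. exact: ccvg_cst. Qed.

(** The integral starts at -1, so the fundamental theorem of calculus covers a neighbourhood of 0;
    this is where the rays [-1 < x] below come from. *)
Lemma antiderivative (f : R -> R) : continuous f ->
  exists G : R -> R, forall x : R, -1 < x -> is_derive x 1 G (f x).
Proof.
move=> cf; pose G x := (\int[lebesgue_measure]_(t in `[-1, x]) f t)%R.
exists G => x x1.
have xx : x < x + 1 by rewrite ltrDl.
have fi : lebesgue_measure.-integrable `[-1, x + 1] (EFin \o f).
  apply: continuous_compact_integrable; first exact: segment_compact.
  exact: continuous_subspaceT.
have [dG GE] := continuous_FTC1_closed xx fi x1 (cf x).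
by apply: DeriveDef; [exact: dG | rewrite -derive1E; exact: GE].
Qed.

Lemma derive0_cst_ray (f : R -> R) (a : R) :
  (forall x : R, a < x -> is_derive x 1 f 0) ->
  forall s t, a < s -> a < t -> f s = f t.
Proof.
move=> df s t; wlog st : s t / s <= t.
  by move=> H; case: (leP s t) => [/H|/ltW/H h ? ?]; [exact | rewrite h].
move=> as_ at_; apply/esym/eqP; rewrite -subr_eq0; apply/eqP.
have [| |c _ ->] := @MVT_segment R f (fun=> 0) s t st.
- move=> x; rewrite in_itv/= => /andP[sx _]; apply: df; exact: lt_trans sx.
- apply: derivable_within_continuous => x; rewrite in_itv/= => /andP[sx _].
  by have [] := df x (lt_le_trans as_ sx).
by rewrite mul0r.
Qed.

Lemma mantiderivative m n (F : R -> 'M[R[i]]_(m, n)) :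
  (forall i j t, ccont (fun s => F s i j) t) ->
  exists G, forall x : R, -1 < x -> mderiv G x (F x).
Proof.
move=> cF.
have /choice[g gP] (k : 'I_m * 'I_n) : exists g : R -> R[i], forall x : R, -1 < x ->
    cderiv g x (F x k.1 k.2).
  have [u uP] := antiderivative (fun t => (cF k.1 k.2 t).1).
  have [v vP] := antiderivative (fun t => (cF k.1 k.2 t).2).
  by exists (fun x => u x +i* v x) => x x1; split; [exact: uP | exact: vP].
exists (fun x => \matrix_(i, j) g (i, j) x) => x x1 i j.
under eq_fun do rewrite mxE; exact: (gP (i, j)).
Qed.

Lemma mderiv0_cst_ray m n (F : R -> 'M[R[i]]_(m, n)) (a : R) :
  (forall x, a < x -> mderiv F x 0) ->
  forall s t, a < s -> a < t -> F s = F t.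
Proof.
move=> dF s t sa ta; apply/matrixP=> i j.
have D x : a < x -> cderiv (fun s => F s i j) x 0.
  by move=> ax; have := dF x ax i j; rewrite mxE.
have := derive0_cst_ray (fun x ax => (D x ax).1) sa ta.
have := derive0_cst_ray (fun x ax => (D x ax).2) sa ta.
by case: (F s i j) (F t i j) => [p q] [u v] /= -> ->.
Qed.

Lemma derive_quotient_cont (f : R -> R) (l : R) : is_derive (0 : R) 1 f l ->
  continuous_at (0 : R) (fun s : R => if s == 0 then l else s^-1 * (f s - f 0)).
Proof.
move=> [df fl]; apply/continuous_withinNx.
rewrite eqxx -fl /derive.
apply: cvg_trans df; apply: near_eq_cvg; near=> h.
rewrite ifF; first by rewrite /GRing.scale/= mulr1 addr0.
by apply/negbTE; near: h; exact: nbhs_dnbhs_neq.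
Unshelve. all: by end_near. Qed.

(** The quotients (G s - G 0) / s tend to 1, hence so do their determinants, which are nonzero for
    small s. The bound on s + s leaves room to shift by s inside the ray. *)
Lemma mderiv_unit_increment d (G : R -> 'M[R[i]]_d) :
  mderiv G 0 1%:M -> exists2 s, -1 < s + s & G s - G 0 \in unitmx.
Proof.
move=> dG.
pose Q (s : R) : 'M[R[i]]_d := if s == 0 then 1%:M else s^-1%:C *: (G s - G 0).
have cQ i j : ccont (fun s => Q s i j) 0.
  have [d1 d2] := dG i j; split.
    have := derive_quotient_cont d1; congr continuous_at.
    apply: funext => s; rewrite /Q; case: ifP => // _.
    by rewrite !mxE ReM /= mul0r subr0; case: (G s i j) (G 0 i j) => [? ?] [].
  have := derive_quotient_cont d2; congr continuous_at.
  apply: funext => s; rewrite /Q; case: ifP => // _.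
  by rewrite !mxE ImM /= mul0r addr0; case: (G s i j) (G 0 i j) => [? ?] [].
have [cD _] := mcvg_det cQ.
have D0 : 0 < complex.Re (\det (Q 0)) by rewrite /Q eqxx det1 ltr01.
have := @cvgr_gt R _ _ _ _ _ cD _ D0 => nQ.
have /(@filter_ex _ _ (Proper_dnbhs_numFieldType (0 : R)))[s []] : \forall s \near (0 : R)^',
    0 < complex.Re (\det (Q s)) /\ (s != 0 /\ -1 < s + s).
  near=> s; split; first by near: s; apply: nbhs_dnbhs; exact: nQ.
  split; first by near: s; exact: nbhs_dnbhs_neq.
  have : - s < 1/2 by near: s; apply: nbhs_dnbhs; apply: Nlt_nbhsl; lra.
  lra.
rewrite /Q => + [s0 s1]; rewrite (negbTE s0) => Dpos; exists s => //.
rewrite unitmxE unitfE; apply: contraTneq Dpos => D.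
by rewrite detZ D mulr0 ltxx.
Unshelve. all: by end_near. Qed.

(* If G is an antiderivative of F then F t (G s - G 0) = G (t + s) - G t, and
   G s - G 0 is invertible for some small s, so F inherits the
   differentiability of G. *)
Lemma one_parameter_group_derivable d (F : R -> 'M[R[i]]_d) :
  (forall i j t, ccont (fun s => F s i j) t) -> F 0 = 1%:M ->
  (forall s t, F (s + t) = F s *m F t) ->
  exists X, forall t, mderiv F t (X *m F t).
Proof.
move=> cF F0 FD; have [G dG] := mantiderivative cF.
have half0 : -1 < 0 :> R by lra.
have dsh (a x : R) : is_derive x 1 (fun s => a + s) 1.
  by have := is_deriveD (is_derive_cst a x (1 : R)) (is_derive_id x (1 : R)); rewrite add0r.
(* As functions of s the two sides agree at 0, and their derivatives F t F s and F (t + s) coincide.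
   The bounds -1/2 keep s, t and t + s above -1. *)
have key s t : -(1/2) < s -> -(1/2) < t -> F t *m (G s - G 0) = G (t + s) - G t.
  move=> s1 t1.
  have C x : -(1/2) < x -> mderiv (fun s => G (t + s) - F t *m G s) x 0.
    move=> x1; have tx : -1 < t + x by lra.
    have d1 := mderiv_comp (dG (t + x) tx) (dsh t x).
    have x2 : -1 < x by lra.
    have d2 := mderivMl (- F t) (dG x x2).
    have := mderivD d1 d2; rewrite scale1r FD mulNmx subrr.
    by under eq_fun do rewrite mulNmx.
  have h0 : -(1/2) < 0 :> R by lra.
  have := mderiv0_cst_ray C s1 h0; rewrite addr0 => e.
  apply: (addIr (G t)); rewrite subrK mulmxBr -[G (t + s)](subrK (F t *m G s)) e.
  by rewrite [RHS]addrC [RHS]addrA [RHS]addrAC.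
have [s s1 sU] : exists2 s, -1 < s + s & G s - G 0 \in unitmx.
  by apply: mderiv_unit_increment; have := dG 0 half0; rewrite F0.
have s2 : -(1/2) < s by lra.
have s3 : -1 < s + 0 by lra.
(* By [key], F t = (G (s + t) - G t) (G s - G 0)^-1 for t near 0; X is the derivative of the right
   side at t = 0. *)
pose X := (F s - 1%:M) *m invmx (G s - G 0).
have d0 : mderiv F 0 X.
  apply: (@mderiv_near _ _ _ (fun t => (G (s + t) - G t) *m invmx (G s - G 0))).
    near=> t; rewrite [s + t]addrC -key ?mulmxK //.
    by rewrite ltrNl; near: t; apply: Nlt_nbhsl; lra.
  apply: mderivMr; rewrite -F0.
  have d1 := mderiv_comp (dG (s + 0) s3) (dsh s 0).
  have d2 := mderivMl (- 1%:M) (dG 0 half0).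
  have := mderivD d1 d2; rewrite scale1r mulNmx mul1mx addr0.
  by under eq_fun do rewrite mulNmx mul1mx.
exists X => t.
apply: (@mderiv_near _ _ _ (fun u => F (- t + u) *m F t)).
  by near=> u; rewrite -FD addrAC addNr add0r.
apply: mderivMr; have := @mderiv_comp _ _ _ F (fun u => - t + u) t X 1.
by rewrite addNr scale1r; apply.
Unshelve. all: by end_near. Qed.

End OneParameterGroups.

(** * Quaternions and rotations of R^4 *)

Section Quaternions.
Variable R : realType.
Implicit Types w x y z : R.

(** Left multiplication by w + xi + yj + zk in the basis 1, i, j, k. *)
Definition lquat w x y z : 'M[R]_4 :=
  \matrix_(i < 4, j < 4) nth 0 (nth [::]
    [:: [:: w; - x; - y; - z];
        [:: x; w; - z; y];
        [:: y; z; w; - x];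
        [:: z; - y; x; w]] i) j.

Definition flip4 : 'M[R]_4 :=
  \matrix_(i < 4, j < 4) nth 0 (nth [::]
    [:: [:: 1; 0; 0; 0]; [:: 0; 1; 0; 0]; [:: 0; 0; 1; 0]; [:: 0; 0; 0; -1]] i) j.

(** The flip k -> -k is an anti-automorphism of the quaternions, so this is right multiplication by
    w + xi + yj - zk. The sign of z makes [rquat] multiply in the same order as [lquat]. *)
Definition rquat w x y z : 'M[R]_4 := flip4 *m lquat w x y z *m flip4.

Lemma ord4P (P : 'I_4 -> Prop) :
  P 0 -> P (lift 0 0) -> P (lift 0 (lift 0 0)) -> P (lift 0 (lift 0 (lift 0 0))) ->
  forall i, P i.
Proof.
move=> p0 p1 p2 p3 [[|[|[|[|//]]]] lti].
- by rewrite (_ : Ordinal lti = 0) //; apply: val_inj.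
- by rewrite (_ : Ordinal lti = lift 0 0) //; apply: val_inj.
- by rewrite (_ : Ordinal lti = lift 0 (lift 0 0)) //; apply: val_inj.
- by rewrite (_ : Ordinal lti = lift 0 (lift 0 (lift 0 0))) //; apply: val_inj.
Qed.

Ltac mx4 := apply/matrixP; apply: ord4P; apply: ord4P;
  rewrite ?mxE ?big_ord_recl ?big_ord0 ?mxE ?big_ord_recl ?big_ord0 ?mxE /=; try ring.

Lemma lquatM w x y z w' x' y' z' :
  lquat w x y z *m lquat w' x' y' z' =
  lquat (w * w' - x * x' - y * y' - z * z') (w * x' + x * w' + y * z' - z * y')
        (w * y' - x * z' + y * w' + z * x') (w * z' + x * y' - y * x' + z * w').
Proof. by mx4. Qed.

Lemma lquat1 : lquat 1 0 0 0 = 1%:M.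
Proof. by mx4. Qed.

Lemma lquat_tr w x y z : (lquat w x y z)^T = lquat w (- x) (- y) (- z).
Proof. by mx4. Qed.

Lemma flip4K : flip4 *m flip4 = 1%:M.
Proof. by mx4. Qed.

Lemma flip4_tr : flip4^T = flip4.
Proof. by mx4. Qed.

Lemma rquatE w x y z : rquat w x y z =
  \matrix_(i < 4, j < 4) nth 0 (nth [::]
    [:: [:: w; - x; - y; z];
        [:: x; w; - z; - y];
        [:: y; z; w; x];
        [:: - z; y; - x; w]] i) j.
Proof. by rewrite /rquat; mx4. Qed.

Lemma lquat_rquat_comm w x y z w' x' y' z' :
  lquat w x y z *m rquat w' x' y' z' = rquat w' x' y' z' *m lquat w x y z.
Proof. by rewrite rquatE; mx4. Qed.

Lemma det_flip4 : \det flip4 = -1.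
Proof.
rewrite det_trig; first by rewrite !big_ord_recl big_ord0 !mxE /=; ring.
by apply/is_trig_mxP; apply: ord4P; apply: ord4P; rewrite // !mxE.
Qed.

Lemma det_lquat w x y z : \det (lquat w x y z) = (w ^+ 2 + x ^+ 2 + y ^+ 2 + z ^+ 2) ^+ 2.
Proof.
rewrite (expand_det_row _ 0) !big_ord_recl big_ord0 /cofactor.
rewrite !(expand_det_row _ (0 : 'I_3)) !big_ord_recl !big_ord0 /cofactor.
rewrite !(expand_det_row _ (0 : 'I_2)) !big_ord_recl !big_ord0 /cofactor.
by rewrite !det_mx11 !mxE /=; ring.
Qed.

Lemma SO_lquat w x y z : w ^+ 2 + x ^+ 2 + y ^+ 2 + z ^+ 2 = 1 ->
  SOgroup R 4 (lquat w x y z).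
Proof.
move=> q1; split; last by rewrite det_lquat q1 expr1n.
rewrite /Ogroup /= lquat_tr lquatM -lquat1; congr lquat; rewrite -?q1; ring.
Qed.

End Quaternions.

(** * Representations of the unit quaternions *)

Section QuaternionRepresentations.
Variable R : realType.

(** A unitary representation of the unit quaternions. Continuity is recorded along the circles
    through i, j and k, where the infinitesimal generators are taken. *)
Record quat_rep d (P : R -> R -> R -> R -> 'M[R[i]]_d) : Prop := QuatRep {
  quat_rep1 : P 1 0 0 0 = 1%:M;
  quat_repM : forall w x y z w' x' y' z',
    w ^+ 2 + x ^+ 2 + y ^+ 2 + z ^+ 2 = 1 ->
    w' ^+ 2 + x' ^+ 2 + y' ^+ 2 + z' ^+ 2 = 1 ->
    P w x y z *m P w' x' y' z' =
    P (w * w' - x * x' - y * y' - z * z') (w * x' + x * w' + y * z' - z * y')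
      (w * y' - x * z' + y * w' + z * x') (w * z' + x * y' - y * x' + z * w');
  quat_rep_unitary : forall w x y z, w ^+ 2 + x ^+ 2 + y ^+ 2 + z ^+ 2 = 1 ->
    P w x y z \is unitarymx;
  quat_rep_cont1 : forall i j t, ccont (fun t => P (cos t) (sin t) 0 0 i j) t;
  quat_rep_cont2 : forall i j t, ccont (fun t => P (cos t) 0 (sin t) 0 i j) t;
  quat_rep_cont3 : forall i j t, ccont (fun t => P (cos t) 0 0 (sin t) i j) t }.

(** The rotation i -> j -> k -> i is an automorphism, so results about one circle or one bracket
    carry over to the other two. *)
Lemma quat_rep_cycle d (P : R -> R -> R -> R -> 'M[R[i]]_d) :
  quat_rep P -> quat_rep (fun w x y z => P w z x y).
Proof.
case=> P1 PM PU c1 c2 c3; split; [exact: P1 | | | exact: c2 | exact: c3 | exact: c1].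
- move=> w x y z w' x' y' z' q1 q1'; rewrite PM; first by congr P; ring.
    by rewrite -q1; ring.
  by rewrite -q1'; ring.
- by move=> w x y z q1; apply: PU; rewrite -q1; ring.
Qed.

Definition qnorm (w x y z : R) := Num.sqrt (w ^+ 2 + x ^+ 2 + y ^+ 2 + z ^+ 2).

(** Extends [P] to nonzero quaternions by normalization. Circles may then be parametrized by 1 + xi,
    which turns trigonometric identities into rational ones. *)
Definition nquat d (P : R -> R -> R -> R -> 'M[R[i]]_d) w x y z :=
  P (w / qnorm w x y z) (x / qnorm w x y z) (y / qnorm w x y z) (z / qnorm w x y z).

Lemma qnormZ (c w x y z : R) : 0 < c ->
  qnorm (c * w) (c * x) (c * y) (c * z) = c * qnorm w x y z.
Proof.
move=> c0; have E : (c * w) ^+ 2 + (c * x) ^+ 2 + (c * y) ^+ 2 + (c * z) ^+ 2 =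
  c ^+ 2 * (w ^+ 2 + x ^+ 2 + y ^+ 2 + z ^+ 2) by ring.
by rewrite /qnorm E sqrtrM ?sqr_ge0 // sqrtr_sqr gtr0_norm.
Qed.

Lemma nquatZ d (P : R -> R -> R -> R -> 'M[R[i]]_d) (c w x y z : R) : 0 < c ->
  nquat P (c * w) (c * x) (c * y) (c * z) = nquat P w x y z.
Proof.
move=> c0; rewrite /nquat qnormZ //.
have e (v n : R) : c * v / (c * n) = v / n by rewrite -mulf_div divff ?mul1r ?gt_eqF.
by rewrite !e.
Qed.

Lemma qnorm_gt0 (w x y z : R) : w != 0 -> 0 < qnorm w x y z.
Proof.
move=> w0; rewrite sqrtr_gt0 -!addrA ltr_pwDl ?exprn_even_gt0 //.
by rewrite !addr_ge0 ?sqr_ge0.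
Qed.

Lemma qnorm_unit (w x y z : R) : 0 < qnorm w x y z ->
  (w / qnorm w x y z) ^+ 2 + (x / qnorm w x y z) ^+ 2 + (y / qnorm w x y z) ^+ 2
  + (z / qnorm w x y z) ^+ 2 = 1.
Proof.
move=> n0; rewrite !expr_div_n -!mulrDl.
have S : w ^+ 2 + x ^+ 2 + y ^+ 2 + z ^+ 2 = qnorm w x y z ^+ 2.
  by rewrite sqr_sqrtr // !addr_ge0 ?sqr_ge0.
by rewrite S divff // expf_neq0 // gt_eqF.
Qed.

Lemma nquatM d (P : R -> R -> R -> R -> 'M[R[i]]_d) (w x y z w' x' y' z' : R) :
  quat_rep P -> 0 < qnorm w x y z -> 0 < qnorm w' x' y' z' ->
  nquat P w x y z *m nquat P w' x' y' z' =
  nquat P (w * w' - x * x' - y * y' - z * z') (w * x' + x * w' + y * z' - z * y')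
          (w * y' - x * z' + y * w' + z * x') (w * z' + x * y' - y * x' + z * w').
Proof.
move=> qP n0 n0'; rewrite /nquat (quat_repM qP) ?qnorm_unit //.
set n := qnorm w x y z in n0 *; set n' := qnorm w' x' y' z' in n0' *.
have -> : qnorm (w * w' - x * x' - y * y' - z * z') (w * x' + x * w' + y * z' - z * y')
  (w * y' - x * z' + y * w' + z * x') (w * z' + x * y' - y * x' + z * w') = n * n'.
  rewrite /n /n' /qnorm -sqrtrM; first by congr Num.sqrt; ring.
  by rewrite !addr_ge0 ?sqr_ge0.
by congr P; field; rewrite !gt_eqF.
Qed.

Lemma nquat_atan d (P : R -> R -> R -> R -> 'M[R[i]]_d) (x : R) :
  nquat P 1 x 0 0 = P (cos (atan x)) (sin (atan x)) 0 0.
Proof.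
rewrite /nquat; have -> : qnorm 1 x 0 0 = (cos (atan x))^-1.
  by rewrite cos_atan invrK /qnorm; congr Num.sqrt; ring.
have c0 : cos (atan x) != 0.
  by rewrite cos_atan invr_neq0 // gt_eqF // sqrtr_gt0 ltr_pwDl ?sqr_ge0.
have e : x * cos (atan x) = sin (atan x) by rewrite -{1}[x]atanK /tan divfK.
by rewrite !mul0r invrK mul1r e.
Qed.

Lemma nquat_derive d (P : R -> R -> R -> R -> 'M[R[i]]_d) X :
  P 1 0 0 0 = 1%:M ->
  (forall t, mderiv (fun t => P (cos t) (sin t) 0 0) t (X *m P (cos t) (sin t) 0 0)) ->
  mderiv (fun x => nquat P 1 x 0 0) 0 X.
Proof.
move=> P1 dP.
have a0 : atan 0 = 0 :> R := atan0 R.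
have := mderiv_comp (dP (atan 0)) (is_derive1_atan 0).
rewrite a0 cos0 sin0 P1 mulmx1 expr0n addr0 invr1 scale1r.
by under eq_fun do rewrite -nquat_atan.
Qed.

Lemma norm_lt1_near0 : \forall x \near (0 : R), `|x| < 1.
Proof. by exists 1 => //= x; rewrite /ball_ /= sub0r normrN. Qed.

Lemma is_derive_mobius (a e : R) :
  is_derive (0 : R) (1 : R) (fun x : R => a * (x * (1 + e * (x * x))^-1)) a.
Proof.
pose f (x : R) := 1 + e * (x * x).
have df : is_derive (0 : R) (1 : R) f 0.
  have := is_deriveD (is_derive_cst (1 : R) (0 : R) (1 : R))
   (is_deriveM (is_derive_cst e (0 : R) (1 : R))
     (is_deriveM (is_derive_id (0 : R) (1 : R)) (is_derive_id (0 : R) (1 : R)))).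
  by move=> /is_derive_eq; apply; rewrite /GRing.scale/= !(mul0r, mulr0, addr0).
have f0 : f 0 = 1 by rewrite /f mul0r mulr0 addr0.
have fn0 : f 0 != 0 by rewrite f0 oner_eq0.
have := is_deriveM (is_derive_cst a (0 : R) (1 : R))
  (is_deriveM (is_derive_id (0 : R) (1 : R)) (is_deriveV fn0 df)).
move=> /is_derive_eq; apply; rewrite f0 /GRing.scale/=.
by rewrite !(mul0r, mulr0, addr0, add0r, invr1, mulr1).
Qed.

(** Conjugation by 1 + is rotates the plane of j and k. Writing a conjugated point of the j-circle
    as a product of points of the j- and k-circles, differentiating in that point and then in s,
    gives the bracket. *)
Lemma quat_rep_bracket d (P : R -> R -> R -> R -> 'M[R[i]]_d) X1 X2 X3 :
  quat_rep P ->
  (forall t, mderiv (fun t => P (cos t) (sin t) 0 0) t (X1 *m P (cos t) (sin t) 0 0)) ->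
  (forall t, mderiv (fun t => P (cos t) 0 (sin t) 0) t (X2 *m P (cos t) 0 (sin t) 0)) ->
  (forall t, mderiv (fun t => P (cos t) 0 0 (sin t)) t (X3 *m P (cos t) 0 0 (sin t))) ->
  X1 *m X2 - X2 *m X1 = 2 *: X3.
Proof.
move=> qP g1 g2 g3.
have P1 := quat_rep1 qP.
have d1 : mderiv (fun x => nquat P 1 x 0 0) 0 X1 := nquat_derive P1 g1.
have d2 : mderiv (fun x => nquat P 1 0 x 0) 0 X2.
  have := @nquat_derive _ (fun w x y z => P w z x y) X2 P1 g2.
  congr (mderiv _ _ _); apply: funext => x; rewrite /nquat.
  by have -> : qnorm 1 x 0 0 = qnorm 1 0 x 0 by rewrite /qnorm; congr Num.sqrt; ring.
have d3 : mderiv (fun x => nquat P 1 0 0 x) 0 X3.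
  have := @nquat_derive _ (fun w x y z => P w y z x) X3 P1 g3.
  congr (mderiv _ _ _); apply: funext => x; rewrite /nquat.
  by have -> : qnorm 1 x 0 0 = qnorm 1 0 0 x by rewrite /qnorm; congr Num.sqrt; ring.
have G0 : nquat P 1 0 0 0 = 1%:M.
  by rewrite /nquat /qnorm !expr0n expr1n !addr0 sqrtr1 !mul0r divr1.
have main (s : R) : `|s| < 1 ->
    (1 + s ^+ 2)%:C *: (nquat P 1 s 0 0 *m X2 *m nquat P 1 (- s) 0 0) =
    (1 - s ^+ 2)%:C *: X2 + (2 * s)%:C *: X3.
  move=> s1; have s2 : s ^+ 2 < 1 by rewrite -[s ^+ 2]ger0_norm ?sqr_ge0 // normrX exprn_ilt1.
  have s3 : 0 < 1 - s ^+ 2 by rewrite subr_gt0.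
  have s4 : 0 < 1 + s ^+ 2 by rewrite ltr_pwDl ?sqr_ge0.
  (* With s = tan theta, [c] is cos (2 theta) and [nu] is tan (2 theta): conjugation by 1 + is
     rotates by twice the angle. [m] and [y] result from comparing the coefficients of j and k with
     those of 1. *)
  pose c := (1 - s ^+ 2) / (1 + s ^+ 2).
  pose nu := 2 * s / (1 - s ^+ 2).
  pose m (x : R) := (2 / c) * (x * (1 + (-1) * (x * x))^-1).
  pose y (x : R) := 2 * nu * (x * (1 + 1 * (x * x))^-1).
  have dm : is_derive (0 : R) (1 : R) m (2 / c) := is_derive_mobius (2 / c) (-1).
  have dy : is_derive (0 : R) (1 : R) y (2 * nu) := is_derive_mobius (2 * nu) 1.
  have m0 : m 0 = 0 by rewrite /m mul0r mulr0.
  have y0 : y 0 = 0 by rewrite /y mul0r mulr0.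
  (* (1 + i s)(1 + j m)(1 - i s) is positively proportional to
     (1 + j x)(1 + k y)(1 + j x) *)
  have quat_id (x : R) : `|x| < 1 ->
      nquat P 1 s 0 0 *m nquat P 1 0 (m x) 0 *m nquat P 1 (- s) 0 0 =
      nquat P 1 0 x 0 *m nquat P 1 0 0 (y x) *m nquat P 1 0 x 0.
    move=> x1; have x2 : x * x < 1.
      by rewrite -expr2 -[x ^+ 2]ger0_norm ?sqr_ge0 // normrX exprn_ilt1.
    have x3 : 0 < 1 - x * x by rewrite subr_gt0.
    have x4 : 0 < 1 + x * x by rewrite ltr_pwDl // -expr2 sqr_ge0.
    rewrite !nquatM ?qnorm_gt0 ?oner_eq0 //; last 2 first.
    - by rewrite !(mul0r, mulr0, subr0, mul1r, addr0) oner_eq0.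
    - by rewrite !(mul0r, mulr0, subr0, mul1r, addr0) oner_eq0.
    (* The factor between the two products. [nquat] is invariant under positive factors only, hence
       the restriction to |x| < 1. *)
    have l0 : 0 < (1 + s ^+ 2) / (1 - x * x) by rewrite divr_gt0.
    rewrite -[RHS](nquatZ P _ _ _ _ l0); congr nquat; rewrite /m /y /c /nu; field;
      by rewrite ?gt_eqF //= ?gt_eqF.
  have dL : mderiv (fun x => nquat P 1 s 0 0 *m nquat P 1 0 (m x) 0 *m nquat P 1 (- s) 0 0)
      0 (nquat P 1 s 0 0 *m ((2 / c)%:C *: X2) *m nquat P 1 (- s) 0 0).
    apply: mderivMr; apply: mderivMl.
    by apply: (@mderiv_comp _ _ _ (fun x => nquat P 1 0 x 0)) => //; rewrite m0.
  have dR : mderiv (fun x => nquat P 1 0 x 0 *m nquat P 1 0 0 (y x) *m nquat P 1 0 x 0)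
      0 (X2 + (2 * nu)%:C *: X3 + X2).
    have d3y : mderiv (fun x => nquat P 1 0 0 (y x)) 0 ((2 * nu)%:C *: X3).
      by apply: (@mderiv_comp _ _ _ (fun x => nquat P 1 0 0 x)) => //; rewrite y0.
    have := mderivM (mderivM d2 d3y) d2.
    by rewrite y0 G0 !mulmx1 !mul1mx.
  have E := mderiv_uniq (mderiv_near _ dL) dR.
  have {E} : nquat P 1 s 0 0 *m ((2 / c)%:C *: X2) *m nquat P 1 (- s) 0 0 =
      X2 + (2 * nu)%:C *: X3 + X2.
    apply: E; near=> x; apply: quat_id.
    by near: x; exact: norm_lt1_near0.
  rewrite -scalemxAr -scalemxAl => E.
  set Y := _ *m _ *m _ in E *.
  have -> : (1 + s ^+ 2)%:C *: Y = ((1 - s ^+ 2) / 2)%:C *: ((2 / c)%:C *: Y).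
    by rewrite scalerA -rmorphM; congr (_%:C *: _); rewrite /c; field; rewrite !gt_eqF.
  rewrite E addrAC !scalerDr scalerA -scalerDl -rmorphM -rmorphD.
  congr (_%:C *: _ + _%:C *: _); first by field.
  by rewrite /nu; field; rewrite gt_eqF.
have sq (a b : R) : is_derive (0 : R) (1 : R) (fun s : R => a + b * (s * s)) 0.
  have := is_deriveD (is_derive_cst a (0 : R) (1 : R))
   (is_deriveM (is_derive_cst b (0 : R) (1 : R))
     (is_deriveM (is_derive_id (0 : R) (1 : R)) (is_derive_id (0 : R) (1 : R)))).
  by move=> /is_derive_eq; apply; rewrite /GRing.scale/= !(mul0r, mulr0, addr0).
have dn : mderiv (fun s => nquat P 1 (- s) 0 0) 0 (- X1).
  have dN := is_deriveN (is_derive_id (0 : R) (1 : R)).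
  have := @mderiv_comp _ _ _ (fun x => nquat P 1 x 0 0) (fun s => - s) 0 X1 (-1).
  by rewrite oppr0 rmorphN1 scaleN1r; apply.
(* Both sides of [main] are now differentiated at s = 0. The coefficients containing s^2 contribute
   nothing, which leaves the commutator on one side and 2 X3 on the other. *)
have dA : mderiv (fun s => (1 + s ^+ 2)%:C *:
    (nquat P 1 s 0 0 *m X2 *m nquat P 1 (- s) 0 0)) 0 (X1 *m X2 - X2 *m X1).
  have := mderivZ (cderiv_real (sq 1 1)) (mderivM (mderivMr X2 d1) dn).
  rewrite !mulr0 addr0 oppr0 G0 scale0r scale1r add0r mulmx1 mul1mx mulmxN.
  congr (mderiv _ _ _); apply: funext => s; congr (_%:C *: _).
  by rewrite mul1r expr2.
have dB : mderiv (fun s => (1 - s ^+ 2)%:C *: X2 + (2 * s)%:C *: X3) 0 (2 *: X3).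
  have dl : is_derive (0 : R) (1 : R) (fun s : R => 2 * s) 2.
    have := is_deriveM (is_derive_cst (2 : R) (0 : R) (1 : R)) (is_derive_id (0 : R) (1 : R)).
    by move=> /is_derive_eq; apply; rewrite /GRing.scale/= mulr0 addr0 mulr1.
  have := mderivD (mderivZ (cderiv_real (sq 1 (-1))) (mderiv_cst X2 0))
    (mderivZ (cderiv_real dl) (mderiv_cst X3 0)).
  rewrite !scaler0 scale0r !addr0 add0r rmorph_nat.
  by under eq_fun do rewrite mulN1r -expr2.
apply: mderiv_uniq dB; apply: mderiv_near dA.
by near=> s; apply: main; near: s; exact: norm_lt1_near0.
Unshelve. all: by end_near. Qed.

End QuaternionRepresentations.

(** * Infinitesimal generators of quaternion representations *)

Section Generators.
Variable R : realType.

Definition one_param d (F : R -> 'M[R[i]]_d) (X : 'M[R[i]]_d) : Prop :=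
  [/\ F 0 = 1%:M, forall s t, F (s + t) = F s *m F t &
      forall t, mderiv F t (X *m F t)].

Lemma one_param0 d (F : R -> 'M[R[i]]_d) X : one_param F X -> mderiv F 0 X.
Proof. by case=> F0 _ dF; have := dF 0; rewrite F0 mulmx1. Qed.

Lemma one_param_comm d (F : R -> 'M[R[i]]_d) X : one_param F X ->
  forall t, X *m F t = F t *m X.
Proof.
move=> FX; have d0 := one_param0 FX; case: FX => F0 FD dF t.
apply: mderiv_uniq (mderivMl (F t) d0).
apply: mderiv_near (mderivMr (F t) d0).
by near=> s; rewrite -!FD addrC.
Unshelve. all: by end_near. Qed.

(** The function G (-s) T F s has zero derivative, so it keeps its value T at s = 0. *)
Lemma one_param_intertwine d e (F : R -> 'M[R[i]]_d) X (G : R -> 'M[R[i]]_e) Y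
    (T : 'M[R[i]]_(e, d)) : one_param F X -> one_param G Y ->
  T *m X = Y *m T -> forall t, T *m F t = G t *m T.
Proof.
move=> FX GY TX t.
have GX := one_param_comm GY.
case: FX GY => F0 FD dF [G0 GD dG].
have dD s : mderiv (fun s => G (- s) *m T *m F s) s 0.
  have dN := is_deriveN (is_derive_id s (1 : R)).
  have d1 := @mderiv_comp _ _ _ G (fun s => - s) s _ (-1) (dG (- s)) dN.
  have := mderivM (mderivMr T d1) (dF s).
  rewrite rmorphN1 scaleN1r GX -!mulmxA !mulNmx -!mulmxA [Y *m (T *m _)]mulmxA.
  by rewrite -TX -!mulmxA addNr.
have := mderiv0_cst dD t 0; rewrite oppr0 F0 G0 mulmx1 mul1mx => E.
by rewrite -[in RHS]E !mulmxA -GD subrr G0 mul1mx.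
Qed.

Lemma one_param_intertwine_generator d e (F : R -> 'M[R[i]]_d) X
    (G : R -> 'M[R[i]]_e) Y (T : 'M[R[i]]_(e, d)) :
  one_param F X -> one_param G Y ->
  (forall t, T *m F t = G t *m T) -> T *m X = Y *m T.
Proof.
move=> FX GY TF; apply: mderiv_uniq (mderivMr T (one_param0 GY)).
apply: mderiv_near (mderivMl T (one_param0 FX)).
by near=> s; rewrite TF.
Unshelve. all: by end_near. Qed.

Lemma one_param_skew d (F : R -> 'M[R[i]]_d) X : one_param F X ->
  (forall t, F t \is unitarymx) -> X^t* = - X.
Proof.
move=> FX FU; have d0 := one_param0 FX; case: FX => F0 FD _.
apply: mderiv_uniq (mderiv_adj d0) _.
apply: (@mderiv_near _ _ _ (fun s => F (- s))).
  near=> s; rewrite -[RHS]mul1mx -F0 -(addNr s) FD -mulmxA.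
  by rewrite (elimT unitarymxP (FU s)) mulmx1.
have dN := is_deriveN (is_derive_id (0 : R) (1 : R)).
have := @mderiv_comp _ _ _ F (fun s => - s) 0 X (-1).
by rewrite oppr0 rmorphN1 scaleN1r; apply.
Unshelve. all: by end_near. Qed.

Record quat_gen d (P : R -> R -> R -> R -> 'M[R[i]]_d) (X1 X2 X3 : 'M[R[i]]_d) : Prop :=
  QuatGen {
    quat_gen1 : one_param (fun t => P (cos t) (sin t) 0 0) X1;
    quat_gen2 : one_param (fun t => P (cos t) 0 (sin t) 0) X2;
    quat_gen3 : one_param (fun t => P (cos t) 0 0 (sin t)) X3 }.

Lemma quat_rep_one_param d (P : R -> R -> R -> R -> 'M[R[i]]_d) :
  quat_rep P -> exists X, one_param (fun t => P (cos t) (sin t) 0 0) X.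
Proof.
move=> qP; pose F t := P (cos t) (sin t) 0 0.
have F0 : F 0 = 1%:M by rewrite /F cos0 sin0 (quat_rep1 qP).
have FD s t : F (s + t) = F s *m F t.
  rewrite /F (quat_repM qP); last 2 first.
  - by rewrite -(cos2Dsin2 s); ring.
  - by rewrite -(cos2Dsin2 t); ring.
  by rewrite cosD sinD; congr P; ring.
by have [X dX] := one_parameter_group_derivable (quat_rep_cont1 qP) F0 FD; exists X.
Qed.

Lemma quat_gen_exists d (P : R -> R -> R -> R -> 'M[R[i]]_d) :
  quat_rep P -> exists X1 X2 X3, quat_gen P X1 X2 X3.
Proof.
move=> qP; have [X1 g1] := quat_rep_one_param qP.
have [X3 g3] := quat_rep_one_param (quat_rep_cycle (quat_rep_cycle qP)).
have [X2 g2] := quat_rep_one_param (quat_rep_cycle qP).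
by exists X1, X2, X3; split.
Qed.

Lemma quat_gen_bracket d (P : R -> R -> R -> R -> 'M[R[i]]_d) X1 X2 X3 :
  quat_rep P -> quat_gen P X1 X2 X3 ->
  [/\ X1 *m X2 - X2 *m X1 = 2 *: X3, X2 *m X3 - X3 *m X2 = 2 *: X1 &
      X3 *m X1 - X1 *m X3 = 2 *: X2].
Proof.
move=> qP [[_ _ g1] [_ _ g2] [_ _ g3]]; split.
- exact: quat_rep_bracket qP g1 g2 g3.
- exact: quat_rep_bracket (quat_rep_cycle qP) g2 g3 g1.
- exact: quat_rep_bracket (quat_rep_cycle (quat_rep_cycle qP)) g3 g1 g2.
Qed.

Lemma quat_gen_skew d (P : R -> R -> R -> R -> 'M[R[i]]_d) X1 X2 X3 :
  quat_rep P -> quat_gen P X1 X2 X3 ->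
  [/\ X1^t* = - X1, X2^t* = - X2 & X3^t* = - X3].
Proof.
move=> qP [g1 g2 g3].
split; [apply: (one_param_skew g1) | apply: (one_param_skew g2) | apply: (one_param_skew g3)];
  by move=> t; apply: (quat_rep_unitary qP); rewrite -(cos2Dsin2 t); ring.
Qed.

Lemma polar (a b : R) : exists t, a = Num.sqrt (a ^+ 2 + b ^+ 2) * cos t /\
  b = Num.sqrt (a ^+ 2 + b ^+ 2) * sin t.
Proof.
have n0 : 0 <= a ^+ 2 + b ^+ 2 by rewrite addr_ge0 ?sqr_ge0.
set r := Num.sqrt _; have r2 : r ^+ 2 = a ^+ 2 + b ^+ 2 by rewrite sqr_sqrtr.
have [r0|rn0] := eqVneq r 0.
  move: r2; rewrite r0 expr0n /= => /esym/eqP.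
  rewrite paddr_eq0 ?sqr_ge0 // !sqrf_eq0 => /andP[/eqP-> /eqP->].
  by exists 0; rewrite !mul0r.
have rp : 0 < r by rewrite lt_neqAle eq_sym rn0 sqrtr_ge0.
have ab1 : (a / r) ^+ 2 + (b / r) ^+ 2 = 1.
  by rewrite !expr_div_n -mulrDl -r2 divff // expf_neq0.
have a1 : -1 <= a / r <= 1.
  rewrite -ler_norml -(@ler_pXn2r _ 2) ?nnegrE // expr1n real_normK ?num_real //.
  by rewrite -ab1 lerDl sqr_ge0.
have ca : cos (acos (a / r)) = a / r by rewrite acosK // inE.
have sa : sin (acos (a / r)) = `|b / r|.
  by rewrite sin_acos // -ab1 addrAC subrr add0r sqrtr_sqr.
have [b0|b0] := leP 0 (b / r).
  exists (acos (a / r)); rewrite ca sa ger0_norm //.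
  by split; rewrite mulrC divfK.
exists (- acos (a / r)); rewrite cosN sinN ca sa ltr0_norm // opprK.
by split; rewrite mulrC divfK.
Qed.

Lemma unit_polar (a b : R) : a ^+ 2 + b ^+ 2 = 1 -> exists t, a = cos t /\ b = sin t.
Proof.
by move=> ab; have [t] := polar a b; rewrite ab sqrtr1 !mul1r; exists t.
Qed.

(* Every unit quaternion is e^(i s) e^(j t) e^(i u). *)
Lemma quat_rep_intertwine d e (P : R -> R -> R -> R -> 'M[R[i]]_d)
    (Q : R -> R -> R -> R -> 'M[R[i]]_e) X1 X2 X3 Y1 Y2 Y3 (T : 'M[R[i]]_(e, d)) :
  quat_rep P -> quat_rep Q -> quat_gen P X1 X2 X3 -> quat_gen Q Y1 Y2 Y3 ->
  T *m X1 = Y1 *m T -> T *m X2 = Y2 *m T ->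
  forall w x y z, w ^+ 2 + x ^+ 2 + y ^+ 2 + z ^+ 2 = 1 ->
  T *m P w x y z = Q w x y z *m T.
Proof.
move=> qP qQ [p1 p2 p3] [q1 q2 q3] T1 T2 w x y z n1.
have I1 := one_param_intertwine p1 q1 T1.
have I2 := one_param_intertwine p2 q2 T2.
have [A [wA xA]] := polar w x; have [B [yB zB]] := polar y z.
set r1 := Num.sqrt _ in wA xA; set r2 := Num.sqrt _ in yB zB.
have [t [r1t r2t]] : exists t, r1 = cos t /\ r2 = sin t.
  apply: unit_polar; rewrite !sqr_sqrtr ?addr_ge0 ?sqr_ge0 //.
  by rewrite -n1; ring.
(* Since e^(is) e^(jt) e^(iu) = cos t e^(i(s+u)) + sin t e^(i(s-u)) j, the arguments of w + xi and y
   + zi must be s + u and s - u. *)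
pose s := (A + B) / 2; pose u := (A - B) / 2.
have AE : A = s + u by rewrite /s /u; field.
have BE : B = s - u by rewrite /s /u; field.
have dec d' (N : R -> R -> R -> R -> 'M[R[i]]_d') : quat_rep N -> N w x y z =
  N (cos s) (sin s) 0 0 *m N (cos t) 0 (sin t) 0 *m N (cos u) (sin u) 0 0.
  move=> qN; rewrite (quat_repM qN); last 2 first.
  - by rewrite -(cos2Dsin2 s); ring.
  - by rewrite -(cos2Dsin2 t); ring.
  rewrite (quat_repM qN); last 2 first.
  - transitivity ((cos s ^+ 2 + sin s ^+ 2) * (cos t ^+ 2 + sin t ^+ 2)); first by ring.
    by rewrite !cos2Dsin2 mulr1.
  - by rewrite -(cos2Dsin2 u); ring.
  rewrite wA xA yB zB r1t r2t AE BE cosD sinD cosB sinB.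
  by congr N; ring.
by rewrite (dec _ _ qP) (dec _ _ qQ) !mulmxA I1 -!mulmxA [T *m (_ *m _)]mulmxA I2 -!mulmxA I1.
Qed.

End Generators.

(** * Generation of SO(4) *)

Section GenerationSO4.
Variable R : realType.

Lemma mx_cvg (T : Type) (F : set_system T) m n (f : T -> 'M[R]_(m, n)) (M : 'M[R]_(m, n)) :
  Filter F -> (forall i j, (fun x => f x i j) @ F --> M i j) -> f @ F --> M.
Proof.
move=> FF cf A [P MP PA]; rewrite /= nbhs_filterE.
have : \forall x \near F, forall i j, P i j (f x i j).
  apply: filter_forall => i; apply: filter_forall => j.
  exact: (cf i j _ (MP i j)).
by apply: filterS => x Px; apply: PA.
Qed.

Lemma mx_cvg_entry (T : Type) (F : set_system T) m n (f : T -> 'M[R]_(m, n)) (M : 'M[R]_(m, n)) :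
  Filter F -> f @ F --> M -> forall i j, (fun x => f x i j) @ F --> M i j.
Proof.
move=> FF cf i j.
exact: (@cvg_comp _ _ _ f (fun N : 'M[R]_(m, n) => N i j) _ _ _ cf
  (@coord_continuous R m n i j M)).
Qed.

Lemma unitary_rep_curve (G : set 'M[R]_4) d (rho : 'M[R]_4 -> 'M[R[i]]_d)
    (c : R -> 'M[R]_4) t :
  unitary_rep G rho -> (forall s, G (c s)) ->
  (forall i j, continuous_at t (fun s => c s i j)) ->
  forall i j, ccont (fun s => rho (c s) i j) t.
Proof.
move=> [cRe cIm _ _ _] Gc cc i j.
have cW : c s @[s --> t] --> within G (nbhs (c t)).
  have ct : c s @[s --> t] --> c t.
    by apply: mx_cvg => k l; exact: cc.
  move=> A /= wA; have := ct _ wA; rewrite !nbhs_filterE /= => H.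
  by apply: filterS H => s; apply; exact: Gc.
have := (subspace_continuousP _ _).1 cRe (c t) (Gc t) => hRe.
have := (subspace_continuousP _ _).1 cIm (c t) (Gc t) => hIm.
have entry (f : R[i] -> R) : (map_mx f (rho g)) @[g --> within G (nbhs (c t))]
    --> map_mx f (rho (c t)) -> continuous_at t (fun s => f (rho (c s) i j)).
  move=> hf; have := @mx_cvg_entry _ (nbhs t) _ _ (fun s => map_mx f (rho (c s)))
    (map_mx f (rho (c t))) _ (cvg_comp _ _ cW hf) i j.
  rewrite /continuous_at mxE; under eq_fun do rewrite mxE.
  by apply.
by split; [exact: (entry _ hRe) | exact: (entry _ hIm)].
Qed.

Lemma Ogroup_mul n (g h : 'M[R]_n) : Ogroup R n g -> Ogroup R n h -> Ogroup R n (g *m h).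
Proof.
rewrite /Ogroup /= => gO hO.
by rewrite trmx_mul mulmxA -[g *m h *m _]mulmxA hO mulmx1.
Qed.

Lemma SOgroup_mul n (g h : 'M[R]_n) : SOgroup R n g -> SOgroup R n h -> SOgroup R n (g *m h).
Proof.
by move=> [gO gd] [hO hd]; split; [exact: Ogroup_mul | rewrite det_mulmx gd hd mulr1].
Qed.

Lemma Ogroup_flip4 : Ogroup R 4 (flip4 R).
Proof. by rewrite /Ogroup /= flip4_tr flip4K. Qed.

Lemma SOgroup_conj_flip4 (g : 'M[R]_4) : SOgroup R 4 g ->
  SOgroup R 4 (flip4 R *m g *m flip4 R).
Proof.
move=> [gO gd]; split; last by rewrite !det_mulmx gd det_flip4 mulr1 mulN1r opprK.
by do !apply: Ogroup_mul => //; exact: Ogroup_flip4.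
Qed.

Lemma SO_rquat (w x y z : R) : w ^+ 2 + x ^+ 2 + y ^+ 2 + z ^+ 2 = 1 ->
  SOgroup R 4 (rquat w x y z).
Proof. by move=> q1; apply: SOgroup_conj_flip4; exact: SO_lquat. Qed.

Lemma rquatM (w x y z w' x' y' z' : R) :
  rquat w x y z *m rquat w' x' y' z' =
  rquat (w * w' - x * x' - y * y' - z * z') (w * x' + x * w' + y * z' - z * y')
        (w * y' - x * z' + y * w' + z * x') (w * z' + x * y' - y * x' + z * w').
Proof.
rewrite /rquat -lquatM !mulmxA; congr (_ *m _); rewrite -!mulmxA; congr (_ *m (_ *m _)).
by rewrite mulmxA flip4K mul1mx.
Qed.

Lemma lquat_circle_cont (t : R) :
  [/\ forall i j, continuous_at t (fun s => lquat (cos s) (sin s) 0 0 i j),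
      forall i j, continuous_at t (fun s => lquat (cos s) 0 (sin s) 0 i j) &
      forall i j, continuous_at t (fun s => lquat (cos s) 0 0 (sin s) i j)].
Proof.
have cs : continuous_at t (@cos R) by exact: continuous_cos.
have sn : continuous_at t (@sin R) by exact: continuous_sin.
have snN : continuous_at t (fun s : R => - sin s) by exact: (continuousN sn).
have c0 : continuous_at t (fun _ : R => 0 : R) by exact: cst_continuous.
have c0N : continuous_at t (fun _ : R => - 0 : R) by exact: cst_continuous.
by split; apply: ord4P; apply: ord4P; under eq_fun do rewrite mxE /=.
Qed.

Lemma rquat_circle_cont (t : R) :
  [/\ forall i j, continuous_at t (fun s => rquat (cos s) (sin s) 0 0 i j),
      forall i j, continuous_at t (fun s => rquat (cos s) 0 (sin s) 0 i j) &
      forall i j, continuous_at t (fun s => rquat (cos s) 0 0 (sin s) i j)].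
Proof.
have cs : continuous_at t (@cos R) by exact: continuous_cos.
have sn : continuous_at t (@sin R) by exact: continuous_sin.
have snN : continuous_at t (fun s : R => - sin s) by exact: (continuousN sn).
have c0 : continuous_at t (fun _ : R => 0 : R) by exact: cst_continuous.
have c0N : continuous_at t (fun _ : R => - 0 : R) by exact: cst_continuous.
by split; apply: ord4P; apply: ord4P; under eq_fun do rewrite rquatE mxE /=.
Qed.

Lemma circle_unit (t : R) :
  [/\ cos t ^+ 2 + sin t ^+ 2 + 0 ^+ 2 + 0 ^+ 2 = 1,
      cos t ^+ 2 + 0 ^+ 2 + sin t ^+ 2 + 0 ^+ 2 = 1 &
      cos t ^+ 2 + 0 ^+ 2 + 0 ^+ 2 + sin t ^+ 2 = 1].
Proof. by split; rewrite -(cos2Dsin2 t); ring. Qed.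

Lemma unitary_rep_lquat d (rho : 'M[R]_4 -> 'M[R[i]]_d) :
  unitary_rep (SOgroup R 4) rho -> quat_rep (fun w x y z => rho (lquat w x y z)).
Proof.
move=> U; have curve := unitary_rep_curve U; case: (U) => _ _ r1 rM rU; split.
- by rewrite lquat1.
- by move=> w x y z w' x' y' z' q1 q1'; rewrite -rM ?lquatM //; exact: SO_lquat.
- by move=> w x y z q1; apply/rU/SO_lquat.
- move=> i j t; apply: (curve (fun s => lquat (cos s) (sin s) 0 0)).
    by move=> s; apply: SO_lquat; case: (circle_unit s).
  by case: (lquat_circle_cont t).
- move=> i j t; apply: (curve (fun s => lquat (cos s) 0 (sin s) 0)).
    by move=> s; apply: SO_lquat; case: (circle_unit s).
  by case: (lquat_circle_cont t).
- move=> i j t; apply: (curve (fun s => lquat (cos s) 0 0 (sin s))).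
    by move=> s; apply: SO_lquat; case: (circle_unit s).
  by case: (lquat_circle_cont t).
Qed.

Lemma unitary_rep_rquat d (rho : 'M[R]_4 -> 'M[R[i]]_d) :
  unitary_rep (SOgroup R 4) rho -> quat_rep (fun w x y z => rho (rquat w x y z)).
Proof.
move=> U; have curve := unitary_rep_curve U; case: (U) => _ _ r1 rM rU; split.
- by rewrite /rquat lquat1 mulmx1 flip4K.
- by move=> w x y z w' x' y' z' q1 q1'; rewrite -rM ?rquatM //; exact: SO_rquat.
- by move=> w x y z q1; apply/rU/SO_rquat.
- move=> i j t; apply: (curve (fun s => rquat (cos s) (sin s) 0 0)).
    by move=> s; apply: SO_rquat; case: (circle_unit s).
  by case: (rquat_circle_cont t).
- move=> i j t; apply: (curve (fun s => rquat (cos s) 0 (sin s) 0)).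
    by move=> s; apply: SO_rquat; case: (circle_unit s).
  by case: (rquat_circle_cont t).
- move=> i j t; apply: (curve (fun s => rquat (cos s) 0 0 (sin s))).
    by move=> s; apply: SO_rquat; case: (circle_unit s).
  by case: (rquat_circle_cont t).
Qed.

(** The image of the double cover of SO(4) by pairs of unit quaternions. *)
Definition spin_image (g : 'M[R]_4) : Prop :=
  exists w x y z w' x' y' z' : R,
    [/\ w ^+ 2 + x ^+ 2 + y ^+ 2 + z ^+ 2 = 1,
        w' ^+ 2 + x' ^+ 2 + y' ^+ 2 + z' ^+ 2 = 1 &
        g = lquat w x y z *m rquat w' x' y' z'].

Lemma spin_image_mul g h : spin_image g -> spin_image h -> spin_image (g *m h).
Proof.
move=> [a [b [c [e [a1 [b1 [c1 [e1 [n1 m1 ->]]]]]]]]].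
move=> [a' [b' [c' [e' [a1' [b1' [c1' [e1' [n1' m1' ->]]]]]]]]].
do 8 eexists; split; last first.
- rewrite mulmxA -[_ *m lquat a' b' c' e']mulmxA -lquat_rquat_comm mulmxA.
  by rewrite lquatM -mulmxA rquatM.
- transitivity ((a1 ^+ 2 + b1 ^+ 2 + c1 ^+ 2 + e1 ^+ 2) *
    (a1' ^+ 2 + b1' ^+ 2 + c1' ^+ 2 + e1' ^+ 2)); first by ring.
  by rewrite m1 m1' mulr1.
- transitivity ((a ^+ 2 + b ^+ 2 + c ^+ 2 + e ^+ 2) *
    (a' ^+ 2 + b' ^+ 2 + c' ^+ 2 + e' ^+ 2)); first by ring.
  by rewrite n1 n1' mulr1.
Qed.

Lemma spin_image_flip4 g : spin_image g -> spin_image (flip4 R *m g *m flip4 R).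
Proof.
move=> [a [b [c [e [a1 [b1 [c1 [e1 [n1 m1 ->]]]]]]]]].
exists a1, b1, c1, e1, a, b, c, e; split => //.
by rewrite [RHS]lquat_rquat_comm /rquat -!mulmxA flip4K mulmx1.
Qed.

Definition reflection (n : 'cV[R]_4) : 'M[R]_4 := 1%:M - 2 *: (n *m n^T).

(* In quaternions the reflection along a unit vector n is x |-> - n x^* n, and
   flip4 is the reflection along k. *)
Lemma reflection_spin (n : 'cV[R]_4) : n^T *m n = 1%:M ->
  spin_image (reflection n *m flip4 R).
Proof.
move=> /matrixP/(_ 0 0); rewrite !mxE !big_ord_recl big_ord0 !mxE /= => n1.
pose w := n 0 0; pose x := n (lift 0 0) 0; pose y := n (lift 0 (lift 0 0)) 0.
pose z := n (lift 0 (lift 0 (lift 0 0))) 0.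
have {}n1 : w ^+ 2 + x ^+ 2 + y ^+ 2 + z ^+ 2 = 1 by apply: etrans n1; rewrite /w /x /y /z; ring.
have n1' : w ^+ 2 = 1 - x ^+ 2 - y ^+ 2 - z ^+ 2 by rewrite -n1; ring.
(* Composing the reflections along k and n gives p -> (nk) p (kn). The first four numbers are nk;
   the last four are kn with its k-coordinate negated, as [rquat] expects. *)
exists (- z), y, (- x), w, (- z), (- y), x, (- w); split.
- by rewrite -n1; ring.
- by rewrite -n1; ring.
rewrite /reflection rquatE; apply/matrixP; apply: ord4P; apply: ord4P;
  rewrite ?mxE !big_ord_recl !big_ord0 ?mxE ?big_ord_recl ?big_ord0 ?mxE /=
    -/w -/x -/y -/z; ring: n1'.
Qed.

Lemma reflection_mul (n v : 'cV[R]_4) :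
  reflection n *m v = v - (2 * (n^T *m v) 0 0) *: n.
Proof.
rewrite /reflection mulmxBl mul1mx -scalemxAl -mulmxA [n^T *m v in LHS]mx11_scalar.
by rewrite mul_mx_scalar scalerA.
Qed.

Lemma reflectionK (n : 'cV[R]_4) : n^T *m n = 1%:M -> reflection n *m reflection n = 1%:M.
Proof.
move=> n1; have rn : reflection n *m n = - n.
  by rewrite reflection_mul n1 !mxE eqxx mulr1 scaler_nat mulr2n opprD addrA subrr sub0r.
rewrite {2}/reflection mulmxBr mulmx1 -scalemxAr mulmxA rn mulNmx scalerN opprK.
by rewrite /reflection subrK.
Qed.

Lemma reflection_tr (n : 'cV[R]_4) : (reflection n)^T = reflection n.
Proof. by rewrite /reflection !(linearB, linearZ) /= trmx1 trmx_mul trmxK. Qed.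

(** Factorization into reflections, by induction on the number of basis vectors not yet known to be
    fixed. The disjunction records the parity of the number of reflections. *)
Lemma orthogonal_spin (g : 'M[R]_4) : Ogroup R 4 g ->
  spin_image g \/ spin_image (g *m flip4 R).
Proof.
suff H k : (k <= 4)%N -> forall g, Ogroup R 4 g ->
    (forall j : 'I_4, (j < 4 - k)%N -> col j g = col j 1%:M) ->
    spin_image g \/ spin_image (g *m flip4 R).
  by move=> gO; apply: (H 4%N).
elim: k => [_ {}g _ gf|k IH k4 {}g gO gf].
  left; have -> : g = 1%:M.
    by apply/matrixP => i j; have /colP/(_ i) := gf j (ltn_ord j); rewrite !mxE.
  exists 1, 0, 0, 0, 1, 0, 0, 0.
  split; [by ring | by ring |].
  by rewrite /rquat lquat1 mulmx1 flip4K mulmx1.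
have ik : (3 - k < 4)%N by rewrite ltnS leq_subr.
pose i := Ordinal ik.
have gTg : g^T *m g = 1%:M by apply: mulmx1C.
have dotg j l : ((col j g)^T *m col l g) 0 0 = (j == l)%:R.
  have /matrixP/(_ j l) := gTg; rewrite !mxE => <-.
  by apply: eq_bigr => m _; rewrite !mxE.
have dot1 j l : ((col j (1%:M : 'M[R]_4))^T *m col l g) 0 0 = g j l.
  rewrite !mxE (bigD1 j) //= !mxE eqxx mul1r big1 ?addr0 // => m mj.
  by rewrite !mxE (negbTE mj) mul0r.
have fixi (j : 'I_4) : (j < 4 - k)%N -> (j < 4 - k.+1)%N \/ j = i.
  rewrite subSn // ltnS leq_eqVlt => /orP[/eqP ji|]; last by left.
  by right; apply: val_inj.
have [e|ne] := eqVneq (col i g) (col i 1%:M).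
  apply: IH => //; first exact: ltnW.
  by move=> j /fixi[/gf//|->].
(* The reflection along u sends column i of g to e_i. It fixes the earlier basis vectors, because u
   is orthogonal to them. The squared length of u is 2 (1 - g_ii). *)
pose u := col i g - col i 1%:M.
have uT : u^T = (col i g)^T - (col i 1%:M)^T by rewrite /u linearB.
pose a := 1 - g i i.
have uu : (u^T *m u) 0 0 = 2 * a.
  rewrite uT /u mulmxBl !mulmxBr !mxE.
  have /matrixP/(_ i i) := gTg; rewrite !mxE eqxx => gii.
  transitivity (\sum_j (g^T i j * g j i) - g i i - (g i i - 1)); last first.
    by rewrite gii /a /=; ring.
  congr (_ - _ - (_ - _)).
  - by apply: eq_bigr => j _; rewrite !mxE.
  - by rewrite (bigD1 i) //= !mxE eqxx mulr1 big1 ?addr0 // => j ji;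
      rewrite !mxE (negbTE ji) mulr0.
  - by have := dot1 i i; rewrite !mxE.
  - rewrite (bigD1 i) //= !mxE eqxx mulr1 big1 ?addr0 // => j ji.
    by rewrite !mxE (negbTE ji) mulr0.
have a0 : 0 < a.
  have u0 : 0 <= (u^T *m u) 0 0.
    by rewrite mxE; apply: sumr_ge0 => j _; rewrite !mxE -expr2 sqr_ge0.
  rewrite lt_neqAle; apply/andP; split; last by move: u0; rewrite uu pmulr_rge0 ?ltr0n.
  apply: contraNneq ne => a0; move: uu; rewrite -a0 mulr0 mxE => /eqP.
  rewrite psumr_eq0; last by move=> j _; rewrite !mxE -expr2 sqr_ge0.
  move=> /allP u00; rewrite -subr_eq0; apply/eqP/colP => j.
  have := u00 j (mem_index_enum j); rewrite [u^T _ _]mxE -expr2 sqrf_eq0 => /eqP ->.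
  by rewrite mxE.
pose r := Num.sqrt (2 * a).
have r2 : r ^+ 2 = 2 * a by rewrite sqr_sqrtr // ltW // mulr_gt0.
have rn0 : r != 0 by rewrite gt_eqF // sqrtr_gt0 mulr_gt0.
pose n := r^-1 *: u.
have nT : n^T = r^-1 *: u^T by rewrite /n linearZ.
have n1 : n^T *m n = 1%:M.
  rewrite nT /n -scalemxAl -scalemxAr scalerA [u^T *m u]mx11_scalar uu -r2.
  by rewrite scale_scalar_mx -expr2 exprVn mulVf // expf_neq0.
have sK := reflectionK n1.
have refl v : reflection n *m v = v - (a^-1 * (u^T *m v) 0 0) *: u.
  rewrite reflection_mul; congr (_ - _).
  have -> : (n^T *m v) 0 0 = r^-1 * (u^T *m v) 0 0 by rewrite nT -scalemxAl mxE.
  rewrite /n scalerA; congr (_ *: _).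
  have -> : a = r ^+ 2 / 2 by rewrite r2; field.
  by field.
have subE (A B : 'M[R]_1) : (A - B) 0 0 = A 0 0 - B 0 0 by rewrite !mxE.
have sO : Ogroup R 4 (reflection n *m g).
  by apply: Ogroup_mul => //; rewrite /Ogroup /= reflection_tr.
have sf (j : 'I_4) : (j < 4 - k)%N -> col j (reflection n *m g) = col j 1%:M.
  have cm : col j (reflection n *m g) = reflection n *m col j g.
    by apply/colP => l; rewrite !mxE; apply: eq_bigr => m _; rewrite !mxE.
  move=> /fixi; rewrite cm refl uT mulmxBl => -[jk|->].
    have ji : j != i by apply: contraTneq jk => ->; rewrite /= subSS ltnn.
    have gij : g i j = 0.
      by have /colP/(_ i) := gf j jk; rewrite !mxE eq_sym (negbTE ji).
    have := dotg i j; have := dot1 i j; rewrite gij eq_sym (negbTE ji) => d1 d2.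
    by rewrite subE d1 d2 subrr mulr0 scale0r subr0 gf.
  have := dotg i i; have := dot1 i i; rewrite eqxx => d1 d2.
  rewrite subE d1 d2 -/a mulVf ?gt_eqF // scale1r /u.
  by rewrite opprB addrC subrK.
have sS := reflection_spin n1.
have gE : g = reflection n *m (reflection n *m g) by rewrite mulmxA sK mul1mx.
(* One more reflection exchanges the two alternatives. A flip is inserted next to the reflection,
   and the other factor is conjugated by the flip, which preserves [spin_image]. *)
have [h1|h1] := IH (ltnW k4) _ sO sf.
  right; rewrite gE.
  rewrite (_ : _ *m flip4 R = (reflection n *m flip4 R) *m
    (flip4 R *m (reflection n *m g) *m flip4 R)).
    by apply: spin_image_mul => //; exact: spin_image_flip4.
  by rewrite -!mulmxA [flip4 R *m (flip4 R *m _)]mulmxA flip4K mul1mx.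
left; rewrite gE.
rewrite (_ : reflection n *m _ = (reflection n *m flip4 R) *m
  (flip4 R *m (reflection n *m g *m flip4 R) *m flip4 R)).
  by apply: spin_image_mul => //; exact: spin_image_flip4.
by rewrite -!mulmxA flip4K mulmx1 [flip4 R *m (flip4 R *m _)]mulmxA flip4K mul1mx.
Qed.

Lemma SO4_spin (g : 'M[R]_4) : SOgroup R 4 g -> spin_image g.
Proof.
move=> [gO gd]; case: (orthogonal_spin gO) => // -[a [b [c [e [a1 [b1 [c1 [e1 [n1 m1 gE]]]]]]]]].
have := congr1 determinant gE.
rewrite [LHS]det_mulmx [RHS]det_mulmx gd det_flip4 (SO_lquat n1).2 (SO_rquat m1).2 !mul1r => /eqP.
by rewrite eq_sym -subr_eq0 opprK paddr_eq0 ?ler01 // oner_eq0.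
Qed.

Lemma SO4_intertwine d e (rho : 'M[R]_4 -> 'M[R[i]]_d) (rho' : 'M[R]_4 -> 'M[R[i]]_e)
    (T : 'M[R[i]]_(e, d)) :
  unitary_rep (SOgroup R 4) rho -> unitary_rep (SOgroup R 4) rho' ->
  (forall w x y z : R, w ^+ 2 + x ^+ 2 + y ^+ 2 + z ^+ 2 = 1 ->
     T *m rho (lquat w x y z) = rho' (lquat w x y z) *m T) ->
  (forall w x y z : R, w ^+ 2 + x ^+ 2 + y ^+ 2 + z ^+ 2 = 1 ->
     T *m rho (rquat w x y z) = rho' (rquat w x y z) *m T) ->
  forall g, SOgroup R 4 g -> T *m rho g = rho' g *m T.
Proof.
move=> [_ _ _ rM _] [_ _ _ rM' _] hl hr g.
move=> /SO4_spin[a [b [c [f [a1 [b1 [c1 [f1 [n1 m1 ->]]]]]]]]].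
have s1 := SO_lquat n1; have s2 := SO_rquat m1.
by rewrite rM // rM' // mulmxA hl // -mulmxA hr // mulmxA.
Qed.

End GenerationSO4.

(** * Representations of sl2 *)

Section Sl2.
Variable C : numClosedFieldType.

Lemma mulmx_adj m n p (A : 'M[C]_(m, n)) (B : 'M[C]_(n, p)) :
  (A *m B)^t* = B^t* *m A^t*.
Proof. by rewrite trmx_mul map_mxM. Qed.

Lemma adjD m n (A B : 'M[C]_(m, n)) : (A + B)^t* = A^t* + B^t*.
Proof. by rewrite linearD /= map_mxD. Qed.

Lemma adjN m n (A : 'M[C]_(m, n)) : (- A)^t* = - A^t*.
Proof. by rewrite linearN /= map_mxN. Qed.

Lemma adjB m n (A B : 'M[C]_(m, n)) : (A - B)^t* = A^t* - B^t*.
Proof. by rewrite adjD adjN. Qed.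

Lemma adjZ m n (a : C) (A : 'M[C]_(m, n)) : (a *: A)^t* = a^* *: A^t*.
Proof. by rewrite linearZ /= map_mxZ. Qed.

Lemma adj0 m n : (0 : 'M[C]_(m, n))^t* = 0.
Proof. by rewrite trmx0 map_mx0. Qed.

Lemma adj_scalar n (a : C) : (a%:M : 'M[C]_n)^t* = (a^*)%:M.
Proof. by rewrite tr_scalar_mx map_scalar_mx. Qed.

Lemma mulmx_adj_eq0 m n (A : 'M[C]_(m, n)) : A *m A^t* = 0 -> A = 0.
Proof.
move=> /matrixP A0; apply/matrixP => i j; rewrite mxE.
have := A0 i i; rewrite !mxE => /eqP.
under eq_bigr do rewrite !mxE -normCK.
rewrite psumr_eq0; last by move=> k _; rewrite exprn_ge0.
move=> /allP/(_ j (mem_index_enum j)) /=.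
by rewrite expf_eq0 /= normr_eq0 => /eqP.
Qed.

Lemma adj_mulmx_eq0 m n (A : 'M[C]_(m, n)) : A^t* *m A = 0 -> A = 0.
Proof.
move=> A0; rewrite -[A]trmxCK (@mulmx_adj_eq0 _ _ (A^t*)) ?adj0 //.
by rewrite trmxCK.
Qed.

(** The adjointness field carries the unitarity of the representation; through it the ends of weight
    strings are found by computing norms. *)
Record sl2_triple d (H E F : 'M[C]_d) : Prop := Sl2Triple {
  sl2_EF : E *m F = F *m E + H;
  sl2_HE : H *m E = E *m H + 2 *: E;
  sl2_adj : E^t* = F }.

Section Triple.
Variables (d : nat) (H E F : 'M[C]_d).
Hypothesis HEF : sl2_triple H E F.

Lemma sl2_adjF : F^t* = E.
Proof. by rewrite -(sl2_adj HEF) trmxCK. Qed.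

Lemma sl2_adjH : H^t* = H.
Proof.
have e : H = E *m F - F *m E by rewrite (sl2_EF HEF) addrAC subrr add0r.
by rewrite {1}e adjB !mulmx_adj sl2_adjF (sl2_adj HEF) -e.
Qed.

Lemma sl2_HF : H *m F = F *m H - 2 *: F.
Proof.
have := congr1 (fun A => A^t*) (sl2_HE HEF).
rewrite adjD adjZ !mulmx_adj sl2_adjH (sl2_adj HEF) rmorph_nat => ->.
by rewrite addrK.
Qed.

(** The factor in E F^(i+1) v = (i+1)(a-i) F^i v for a highest weight vector v of weight a. *)
Definition sl2_coef (a i : nat) : C := i.+1%:R * (a%:R - i%:R).

Definition lower m (i : nat) (T : 'M[C]_(d, m)) := iter i (mulmx F) T.

Lemma lowerM m p i (T : 'M[C]_(d, m)) (B : 'M[C]_(m, p)) : lower i T *m B = lower i (T *m B).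
Proof. by elim: i => // i IH; rewrite /lower !iterS -mulmxA IH. Qed.

Lemma lower0 m i : lower i (0 : 'M[C]_(d, m)) = 0.
Proof. by elim: i => // i IH; rewrite /lower iterS -/(lower _ _) IH mulmx0. Qed.

Lemma lowerZ m i c (T : 'M[C]_(d, m)) : lower i (c *: T) = c *: lower i T.
Proof. by elim: i => // i IH; rewrite /lower !iterS -!/(lower _ _) IH scalemxAr. Qed.

Lemma lower_comm m i (A : 'M[C]_d) (T : 'M[C]_(d, m)) : A *m F = F *m A ->
  A *m lower i T = lower i (A *m T).
Proof.
by move=> AF; elim: i => // i IH; rewrite /lower !iterS mulmxA AF -mulmxA IH.
Qed.

Variables (m a : nat) (T : 'M[C]_(d, m)).
Hypotheses (ET : E *m T = 0) (HT : H *m T = a%:R *: T).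

Lemma lower_weight i : H *m lower i T = (a%:R - (2 * i)%:R) *: lower i T.
Proof.
elim: i => [|i IH]; first by rewrite muln0 subr0.
rewrite /lower iterS -/(lower i T) mulmxA sl2_HF mulmxBl -mulmxA IH.
rewrite -scalemxAr -scalemxAl -scalerBl; congr (_ *: _).
by rewrite mulnS natrD; ring.
Qed.

Lemma raise_lower i : E *m lower i.+1 T = sl2_coef a i *: lower i T.
Proof.
elim: i => [|i IH].
  rewrite /lower /= mulmxA (sl2_EF HEF) mulmxDl -mulmxA ET mulmx0 add0r HT.
  by rewrite /sl2_coef subr0 mul1r.
rewrite {1}/lower iterS -/(lower i.+1 T) mulmxA (sl2_EF HEF) mulmxDl -mulmxA IH.
rewrite -scalemxAr -[F *m _]/(lower i.+1 T) lower_weight -scalerDl.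
by congr (_ *: _); rewrite /sl2_coef natrM -!natr1; ring.
Qed.

(** The Gram matrix of F^(a+1) T contains the factor [sl2_coef a a] = 0, and a matrix with zero Gram
    matrix vanishes. *)
Lemma lower_top : lower a.+1 T = 0.
Proof.
apply: adj_mulmx_eq0.
rewrite {1}/lower iterS -/(lower a T) mulmx_adj sl2_adjF -mulmxA.
by rewrite raise_lower /sl2_coef subrr mulr0 scale0r mulmx0.
Qed.

End Triple.

Definition raise_right d m (E : 'M[C]_d) i (T : 'M[C]_(m, d)) := iter i (mulmx^~ E) T.

Lemma raise_rightE d m (H E F : 'M[C]_d) i (T : 'M[C]_(m, d)) : sl2_triple H E F ->
  raise_right E i T = (lower F i (T^t*))^t*.
Proof.
move=> HEF; elim: i => [|i IH]; first by rewrite /= trmxCK.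
by rewrite /raise_right /lower !iterS -/(raise_right E i T) IH mulmx_adj (sl2_adjF HEF).
Qed.

Lemma raise_right_comm d m i (A E : 'M[C]_d) (T : 'M[C]_(m, d)) :
  A *m E = E *m A -> raise_right E i T *m A = raise_right E i (T *m A).
Proof.
by move=> AE; elim: i => // i IH; rewrite /raise_right !iterS -mulmxA -AE mulmxA IH.
Qed.

Lemma mul_raise_right d m p i (E : 'M[C]_d) (B : 'M[C]_(p, m)) (T : 'M[C]_(m, d)) :
  B *m raise_right E i T = raise_right E i (B *m T).
Proof. by elim: i => // i IH; rewrite /raise_right !iterS mulmxA IH. Qed.

Section RaiseRight.
Variables (d : nat) (H E F : 'M[C]_d) (m a : nat) (T : 'M[C]_(m, d)).
Hypotheses (HEF : sl2_triple H E F) (TF : T *m F = 0) (TH : T *m H = a%:R *: T).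

Let ET : E *m T^t* = 0.
Proof. by rewrite -(sl2_adjF HEF) -mulmx_adj TF adj0. Qed.
Let HT : H *m T^t* = a%:R *: T^t*.
Proof. by rewrite -{1}(sl2_adjH HEF) -mulmx_adj TH adjZ rmorph_nat. Qed.

Lemma raise_right_lower i :
  raise_right E i.+1 T *m F = sl2_coef a i *: raise_right E i T.
Proof.
rewrite !(raise_rightE _ _ HEF) -[X in _ *m X](sl2_adj HEF) -mulmx_adj (raise_lower HEF ET HT) adjZ.
by congr (_ *: _); rewrite /sl2_coef rmorphM rmorphB !rmorph_nat.
Qed.

Lemma raise_right_top : raise_right E a.+1 T = 0.
Proof. by rewrite (raise_rightE _ _ HEF) (lower_top HEF ET HT) adj0. Qed.

End RaiseRight.

(** The scalar by which E^i F^i acts on a highest weight vector v of weight a, which is also the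
    squared norm of F^i v when v is a unit vector. *)
Definition sl2_norm (a i : nat) : C := \prod_(k < i) sl2_coef a k.

Lemma sl2_coef_neq0 a i : (i < a)%N -> sl2_coef a i != 0.
Proof.
by move=> ia; rewrite mulf_neq0 ?pnatr_eq0 // subr_eq0 eqr_nat gt_eqF.
Qed.

Lemma sl2_norm_neq0 a i : (i <= a)%N -> sl2_norm a i != 0.
Proof.
move=> ia; apply/prodf_neq0 => k _.
by apply: sl2_coef_neq0; exact: leq_trans (ltn_ord k) ia.
Qed.

Lemma sl2_normS a i : sl2_norm a i.+1 = sl2_norm a i * sl2_coef a i.
Proof. by rewrite /sl2_norm big_ord_recr. Qed.

(* The operator that carries E-strings of the source to those of the target,
   starting from T on the highest weight spaces. *)
Definition string_map d e (a : nat) (E : 'M[C]_d) (F : 'M[C]_e) (T : 'M[C]_(e, d)) :=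
  \sum_(i < a.+1) (sl2_norm a i)^-1 *: lower F i (raise_right E i T).

Section StringMap.
Variables (d e a : nat) (H E F : 'M[C]_d) (H' E' F' : 'M[C]_e) (T : 'M[C]_(e, d)).
Hypotheses (HEF : sl2_triple H E F) (HEF' : sl2_triple H' E' F').
Hypotheses (TF : T *m F = 0) (TH : T *m H = a%:R *: T).
Hypotheses (ET : E' *m T = 0) (HT : H' *m T = a%:R *: T).

Let Z i := lower F' i (raise_right E i T).
Let ETr i : E' *m raise_right E i T = 0.
Proof.
by rewrite mul_raise_right ET; elim: i => // i; rewrite /raise_right iterS => ->; rewrite mul0mx.
Qed.
Let HTr i : H' *m raise_right E i T = a%:R *: raise_right E i T.
Proof.
rewrite mul_raise_right HT; elim: i => // i IH.
by rewrite /raise_right !iterS -!/(raise_right _ _ _) IH scalemxAl.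
Qed.

(** The two sums agree after a shift of index: E' Z_(i+1) is a multiple of Z_i E, and the quotient
    of consecutive [sl2_norm] cancels the multiple. The unmatched terms E' Z_0 and Z_a E vanish. *)
Lemma string_map_E : E' *m string_map a E F' T = string_map a E F' T *m E.
Proof.
have Z0 : E' *m Z 0 = 0 by exact: ET.
have Za : Z a *m E = 0.
  rewrite /Z lowerM -[raise_right E a T *m E]/(raise_right E a.+1 T).
  by rewrite (raise_right_top HEF TF TH) lower0.
have ZE i : E' *m Z i.+1 = sl2_coef a i *: (Z i *m E).
  by rewrite /Z (raise_lower HEF' (ETr _) (HTr _)) lowerM.
rewrite (_ : string_map _ _ _ _ = \sum_(i < a.+1) (sl2_norm a i)^-1 *: Z i) //; move: (Z) Z0 Za ZE => Y Z0 Za ZE.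
rewrite mulmx_sumr mulmx_suml big_ord_recl [RHS]big_ord_recr /=.
rewrite -scalemxAr Z0 scaler0 add0r -[X in _ = _ + X]scalemxAl Za scaler0 addr0.
apply: eq_bigr => i _; rewrite /bump leq0n add1n -scalemxAr -scalemxAl ZE.
by rewrite scalerA sl2_normS invfM mulfVK ?sl2_coef_neq0.
Qed.

Lemma string_map_F : F' *m string_map a E F' T = string_map a E F' T *m F.
Proof.
have Z0 : Z 0 *m F = 0 by exact: TF.
have Za : F' *m Z a = 0.
  rewrite -[F' *m _]/(lower F' a.+1 (raise_right E a T)).
  by rewrite (lower_top HEF' (ETr _) (HTr _)).
have ZF i : Z i.+1 *m F = sl2_coef a i *: (F' *m Z i).
  by rewrite /Z lowerM (raise_right_lower HEF TF TH) lowerZ.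
rewrite (_ : string_map _ _ _ _ = \sum_(i < a.+1) (sl2_norm a i)^-1 *: Z i) //; move: (Z) Z0 Za ZF => Y Z0 Za ZF.
rewrite mulmx_sumr mulmx_suml big_ord_recr [RHS]big_ord_recl /=.
rewrite -[X in _ = X + _]scalemxAl Z0 scaler0 add0r.
rewrite -[X in _ + X = _]scalemxAr Za scaler0 addr0.
apply: eq_bigr => i _; rewrite /bump leq0n add1n -scalemxAr -scalemxAl ZF.
by rewrite scalerA sl2_normS invfM mulfVK ?sl2_coef_neq0.
Qed.

(** Used for operators of the other sl2 factor: a relation that holds on the highest weight spaces
    spreads along the strings. *)
Lemma string_map_comm (A' : 'M[C]_e) (A : 'M[C]_d) :
  A' *m F' = F' *m A' -> A *m E = E *m A -> A' *m T = T *m A ->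
  A' *m string_map a E F' T = string_map a E F' T *m A.
Proof.
move=> AF AE AT; rewrite /string_map mulmx_sumr mulmx_suml; apply: eq_bigr => i _.
rewrite -scalemxAr -scalemxAl lower_comm // mul_raise_right AT lowerM.
by rewrite raise_right_comm.
Qed.

Lemma string_map_top m (v : 'M[C]_(d, m)) : E *m v = 0 ->
  string_map a E F' T *m v = T *m v.
Proof.
move=> Ev; rewrite /string_map mulmx_suml big_ord_recl big1 ?addr0 => [|i _].
  by rewrite /sl2_norm big_ord0 invr1 scale1r.
rewrite lift0 -scalemxAl lowerM /raise_right iterS -mulmxA Ev mulmx0.
by rewrite lower0 scaler0.
Qed.

End StringMap.

(** Each of the a + 1 terms has trace tr T: moving one F cyclically to the right costs one
    [sl2_coef], and [sl2_norm] divides all of these out. *)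
Lemma string_map_trace d a (H E F T : 'M[C]_d) : sl2_triple H E F ->
  T *m F = 0 -> T *m H = a%:R *: T ->
  \tr (string_map a E F T) = a.+1%:R * \tr T.
Proof.
move=> HEF TF TH; rewrite /string_map raddf_sum /=.
transitivity (\sum_(i < a.+1) \tr T); last first.
  by rewrite sumr_const card_ord mulr_natl.
apply: eq_bigr => -[i /= ia] _; rewrite mxtraceZ.
have -> : \tr (lower F i (raise_right E i T)) = sl2_norm a i * \tr T.
  elim: i ia => [|i IH] ia; first by rewrite /sl2_norm big_ord0 mul1r.
  rewrite {1}/lower iterS -/(lower F i _) mxtrace_mulC lowerM.
  rewrite (raise_right_lower HEF TF TH) lowerZ mxtraceZ IH; last exact: ltnW.
  by rewrite sl2_normS mulrCA mulrA.
by rewrite mulrA mulVf ?mul1r // sl2_norm_neq0.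
Qed.

End Sl2.

(** * The two commuting sl2 of a representation of SO(4) *)

Section Su2.
Variable C : numClosedFieldType.

Lemma Ci_sqr : ('i : C) * 'i = -1.
Proof. by rewrite -expr2 sqrCi. Qed.

Lemma addmxE m n (A B : 'M[C]_(m, n)) i j : (A + B) i j = A i j + B i j.
Proof. by rewrite mxE. Qed.

Lemma oppmxE m n (A : 'M[C]_(m, n)) i j : (- A) i j = - A i j.
Proof. by rewrite mxE. Qed.

Lemma scalemxE m n a (A : 'M[C]_(m, n)) i j : (a *: A) i j = a * A i j.
Proof. by rewrite mxE. Qed.

Definition mx_linE := (addmxE, oppmxE, scalemxE).

(** The constants solve X1 = iH, X2 = E - F, X3 = i(E + F). Skew-adjointness of X2 and X3 becomes
    the relation between E and its adjoint F. *)
Lemma su2_sl2 d (X1 X2 X3 : 'M[C]_d) :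
  X1 *m X2 - X2 *m X1 = 2 *: X3 -> X2 *m X3 - X3 *m X2 = 2 *: X1 ->
  X3 *m X1 - X1 *m X3 = 2 *: X2 ->
  X2^t* = - X2 -> X3^t* = - X3 ->
  sl2_triple (- 'i *: X1) (2^-1 *: (X2 - 'i *: X3)) (- 2^-1 *: (X2 + 'i *: X3)).
Proof.
move=> b3 b1 b2 s2 s3; split.
- have {}b1 : X1 = 2^-1 *: (X2 *m X3 - X3 *m X2).
    by rewrite b1 scalerA mulVf ?scale1r // pnatr_eq0.
  rewrite b1; do 3 rewrite ?(mulmxDl, mulmxDr, mulmxBl, mulmxBr, mulNmx, mulmxN) -?scalemxAl -?scalemxAr.
  move: (X2 *m X3) (X3 *m X2) (X2 *m X2) (X3 *m X3) => P Q S T.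
  have hh (x : C) : 2^-1 * x = (2^-1 * 2^-1 + 2^-1 * 2^-1) * x by field.
  apply/matrixP => k l; rewrite !mx_linE [2^-1 * (P k l - Q k l)]hh.
  by move: (2^-1 : C) ('i : C) => h w; ring.
- have e2 : X1 *m X2 = X2 *m X1 + 2 *: X3 by rewrite -b3 addrC subrK.
  have e3 : X1 *m X3 = X3 *m X1 - 2 *: X2 by rewrite -b2 opprB addrC subrK.
  do 3 rewrite ?(mulmxDl, mulmxDr, mulmxBl, mulmxBr, mulNmx, mulmxN) -?scalemxAl -?scalemxAr.
  rewrite e2 e3.
  move: (X2 *m X1) (X3 *m X1) => P Q.
  apply/matrixP => k l; rewrite !mx_linE.
  have i2 := Ci_sqr; move: ('i : C) i2 => w i2.
  by ring: i2.
- rewrite adjZ adjB adjZ s2 s3 conjCi fmorphV rmorph_nat.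
  by apply/matrixP => k l; rewrite !mx_linE; field.
Qed.

Lemma su2_recover d (X1 X2 X3 : 'M[C]_d) :
  [/\ 'i *: (- 'i *: X1) = X1,
      2^-1 *: (X2 - 'i *: X3) - (- 2^-1 *: (X2 + 'i *: X3)) = X2 &
      'i *: (2^-1 *: (X2 - 'i *: X3) + (- 2^-1 *: (X2 + 'i *: X3))) = X3].
Proof.
have i2 := Ci_sqr; move: ('i : C) i2 => w i2.
split; apply/matrixP => k l; rewrite !mx_linE.
- by ring: i2.
- by field.
- by transitivity (- (w * w) * X3 k l); [field | rewrite i2; ring].
Qed.

Lemma comm_linear_comb d (A B A' B' : 'M[C]_d) (a b a' b' : C) :
  A *m A' = A' *m A -> A *m B' = B' *m A -> B *m A' = A' *m B -> B *m B' = B' *m B ->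
  (a *: (A + b *: B)) *m (a' *: (A' + b' *: B')) =
  (a' *: (A' + b' *: B')) *m (a *: (A + b *: B)).
Proof.
move=> h1 h2 h3 h4.
rewrite -!scalemxAl -!scalemxAr !(mulmxDl, mulmxDr) -!scalemxAl -!scalemxAr h1 h2 h3 h4.
move: (A' *m A) (B' *m A) (A' *m B) (B' *m B) => P Q S T.
by apply/matrixP => k l; rewrite !mx_linE; ring.
Qed.

End Su2.

Section BiSl2.
Variable R : realType.
Local Notation C := R[i].

Record bi_sl2 d (rho : 'M[R]_4 -> 'M[C]_d) (HL EL FL HR ER FR : 'M[C]_d) : Prop := BiSl2 {
  bi_sl2L : sl2_triple HL EL FL;
  bi_sl2R : sl2_triple HR ER FR;
  bi_sl2_EE : EL *m ER = ER *m EL;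
  bi_sl2_EF : EL *m FR = FR *m EL;
  bi_sl2_FE : FL *m ER = ER *m FL;
  bi_sl2_FF : FL *m FR = FR *m FL;
  bi_sl2_genL : quat_gen (fun w x y z => rho (lquat w x y z))
    ('i *: HL) (EL - FL) ('i *: (EL + FL));
  bi_sl2_genR : quat_gen (fun w x y z => rho (rquat w x y z))
    ('i *: HR) (ER - FR) ('i *: (ER + FR)) }.

Lemma unitary_rep_bi_sl2 d (rho : 'M[R]_4 -> 'M[C]_d) :
  unitary_rep (SOgroup R 4) rho ->
  exists HL EL FL HR ER FR, bi_sl2 rho HL EL FL HR ER FR.
Proof.
move=> U; have qL := unitary_rep_lquat U; have qR := unitary_rep_rquat U.
have [X1 [X2 [X3 gL]]] := quat_gen_exists qL.
have [Y1 [Y2 [Y3 gR]]] := quat_gen_exists qR.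
have [b3 b1 b2] := quat_gen_bracket qL gL.
have [c3 c1 c2] := quat_gen_bracket qR gR.
have [_ s2 s3] := quat_gen_skew qL gL.
have [_ t2 t3] := quat_gen_skew qR gR.
have comm w x y z w' x' y' z' : w ^+ 2 + x ^+ 2 + y ^+ 2 + z ^+ 2 = 1 ->
    w' ^+ 2 + x' ^+ 2 + y' ^+ 2 + z' ^+ 2 = 1 ->
    rho (lquat w x y z) *m rho (rquat w' x' y' z') =
    rho (rquat w' x' y' z') *m rho (lquat w x y z).
  move=> n1 n1'; case: U => _ _ _ rM _.
  by rewrite -!rM ?lquat_rquat_comm //; do ?[exact: SO_lquat | exact: SO_rquat].
(* Left and right multiplications commute. Differentiating first the left factor and then the right
   one makes the generators commute. *)
have [x2 x3] : (forall w x y z, w ^+ 2 + x ^+ 2 + y ^+ 2 + z ^+ 2 = 1 ->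
      rho (rquat w x y z) *m X2 = X2 *m rho (rquat w x y z)) /\
    (forall w x y z, w ^+ 2 + x ^+ 2 + y ^+ 2 + z ^+ 2 = 1 ->
      rho (rquat w x y z) *m X3 = X3 *m rho (rquat w x y z)).
  case: gL => _ g2 g3; split=> w x y z n1.
    apply: (one_param_intertwine_generator g2 g2) => t.
    by rewrite comm //; case: (circle_unit t).
  apply: (one_param_intertwine_generator g3 g3) => t.
  by rewrite comm //; case: (circle_unit t).
have XY (X : 'M[C]_d) : (forall w x y z, w ^+ 2 + x ^+ 2 + y ^+ 2 + z ^+ 2 = 1 ->
      rho (rquat w x y z) *m X = X *m rho (rquat w x y z)) ->
    X *m Y2 = Y2 *m X /\ X *m Y3 = Y3 *m X.
  case: gR => _ g2 g3 hX; split.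
    apply: (one_param_intertwine_generator g2 g2) => t.
    by rewrite hX //; case: (circle_unit t).
  apply: (one_param_intertwine_generator g3 g3) => t.
  by rewrite hX //; case: (circle_unit t).
have [x22 x23] := XY _ x2; have [x32 x33] := XY _ x3.
exists (- 'i *: X1), (2^-1 *: (X2 - 'i *: X3)), (- 2^-1 *: (X2 + 'i *: X3)).
exists (- 'i *: Y1), (2^-1 *: (Y2 - 'i *: Y3)), (- 2^-1 *: (Y2 + 'i *: Y3)).
have [r1 r2 r3] := su2_recover X1 X2 X3; have [p1 p2 p3] := su2_recover Y1 Y2 Y3.
split.
- exact: su2_sl2 b3 b1 b2 s2 s3.
- exact: su2_sl2 c3 c1 c2 t2 t3.
- by rewrite -!scaleNr; exact: (comm_linear_comb _ _ _ _ x22 x23 x32 x33).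
- by rewrite -!scaleNr; exact: (comm_linear_comb _ _ _ _ x22 x23 x32 x33).
- by rewrite -!scaleNr; exact: (comm_linear_comb _ _ _ _ x22 x23 x32 x33).
- exact: (comm_linear_comb _ _ _ _ x22 x23 x32 x33).
- by rewrite r1 r2 r3.
- by rewrite p1 p2 p3.
Qed.

Lemma bi_sl2_HL_comm d (rho : 'M[R]_4 -> 'M[C]_d) HL EL FL HR ER FR :
  bi_sl2 rho HL EL FL HR ER FR -> HL *m ER = ER *m HL /\ HL *m FR = FR *m HL.
Proof.
move=> B; have -> : HL = EL *m FL - FL *m EL.
  by rewrite (sl2_EF (bi_sl2L B)) addrAC subrr add0r.
split; rewrite mulmxBl mulmxBr -!mulmxA.
  rewrite (bi_sl2_FE B) (bi_sl2_EE B) !mulmxA.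
  by rewrite (bi_sl2_FE B) (bi_sl2_EE B).
rewrite (bi_sl2_FF B) (bi_sl2_EF B) !mulmxA.
by rewrite (bi_sl2_FF B) (bi_sl2_EF B).
Qed.

Section Intertwine.
Variables (d e : nat) (rho : 'M[R]_4 -> 'M[C]_d) (rho' : 'M[R]_4 -> 'M[C]_e).
Variables (HL EL FL HR ER FR : 'M[C]_d) (HL' EL' FL' HR' ER' FR' : 'M[C]_e).
Hypotheses (U : unitary_rep (SOgroup R 4) rho) (U' : unitary_rep (SOgroup R 4) rho').
Hypotheses (B : bi_sl2 rho HL EL FL HR ER FR) (B' : bi_sl2 rho' HL' EL' FL' HR' ER' FR').

Lemma bi_sl2_intertwine (T : 'M[C]_(e, d)) :
  EL' *m T = T *m EL -> FL' *m T = T *m FL ->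
  ER' *m T = T *m ER -> FR' *m T = T *m FR ->
  forall g, SOgroup R 4 g -> T *m rho g = rho' g *m T.
Proof.
move=> tEL tFL tER tFR.
have tH (E F H : 'M[C]_d) (E' F' H' : 'M[C]_e) : sl2_triple H E F -> sl2_triple H' E' F' ->
    E' *m T = T *m E -> F' *m T = T *m F -> T *m ('i *: H) = ('i *: H') *m T.
  move=> s s' tE tF; rewrite -scalemxAr -scalemxAl; congr (_ *: _).
  have -> : H = E *m F - F *m E by rewrite (sl2_EF s) addrAC subrr add0r.
  have -> : H' = E' *m F' - F' *m E' by rewrite (sl2_EF s') addrAC subrr add0r.
  by rewrite mulmxBl mulmxBr -!mulmxA tE tF !mulmxA tE tF.
apply: SO4_intertwine => //.
  apply: (quat_rep_intertwine (unitary_rep_lquat U) (unitary_rep_lquat U')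
    (bi_sl2_genL B) (bi_sl2_genL B')).
    exact: (tH _ _ _ _ _ _ (bi_sl2L B) (bi_sl2L B')).
  by rewrite mulmxBr mulmxBl tEL tFL.
apply: (quat_rep_intertwine (unitary_rep_rquat U) (unitary_rep_rquat U')
  (bi_sl2_genR B) (bi_sl2_genR B')).
  exact: (tH _ _ _ _ _ _ (bi_sl2R B) (bi_sl2R B')).
by rewrite mulmxBr mulmxBl tER tFR.
Qed.

End Intertwine.

(** An eigenspace of T is invariant and nonzero, hence everything. The transpose appears because
    [eigenvalueP] speaks of row vectors. *)
Lemma schur d (rho : 'M[R]_4 -> 'M[C]_d) (T : 'M[C]_d) :
  irreducible_rep (SOgroup R 4) rho ->
  (forall g, SOgroup R 4 g -> T *m rho g = rho g *m T) -> exists c, T = c%:M.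
Proof.
move=> [d0 irr] TC.
have [c /eigenvalueP[u uT u0]] := eigenvalue_closed (T^T) d0.
have Tu : T *m u^T = c *: u^T by rewrite -[T]trmxK -trmx_mul uT linearZ.
exists c.
pose f : 'cV[C]_d -> 'cV[C]_d := mulmx (T - c%:M).
pose K := lker (linfun f).
have memK v : (v \in K) = (T *m v == c *: v).
  by rewrite memv_ker lfunE /= /f mulmxBl mul_scalar_mx subr_eq0.
have [|K0|KT] := irr K.
- move=> g v Gg; rewrite !memK => /eqP Tv.
  by rewrite mulmxA TC // -mulmxA Tv scalemxAr.
- have : u^T \in K by rewrite memK Tu.
  by rewrite K0 memv0 trmx_eq0 (negbTE u0).
apply/eqP; rewrite -subr_eq0; apply/eqP/matrixP => i j.
have : delta_mx j 0 \in K by rewrite KT memvf.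
rewrite memK -subr_eq0 -mul_scalar_mx -mulmxBl => /eqP/matrixP/(_ i 0).
by rewrite -colE !mxE.
Qed.

End BiSl2.

(** * Weights and highest weight vectors *)

Lemma unit_vector (C : numClosedFieldType) d (w : 'cV[C]_d) : w != 0 ->
  exists2 c : C, c != 0 & (c *: w)^t* *m (c *: w) = 1%:M.
Proof.
move=> w0; pose c := (w^t* *m w) 0 0.
have cE : c = \sum_j `|w j 0| ^+ 2.
  by rewrite /c mxE; apply: eq_bigr => j _; rewrite !mxE mulrC normCK.
have c0 : 0 < c.
  rewrite lt_neqAle eq_sym cE sumr_ge0 ?andbT => [|j _]; last by rewrite exprn_ge0.
  apply: contraNneq w0 => /eqP; rewrite psumr_eq0; last by move=> j _; rewrite exprn_ge0.
  move=> /allP z; apply/eqP/colP => j; have := z j (mem_index_enum j).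
  by rewrite /= expf_eq0 /= normr_eq0 mxE => /eqP.
pose r := sqrtC c; have r0 : r != 0 by rewrite sqrtC_eq0 gt_eqF.
have rr : Num.conj r = r by apply: conj_Creal; rewrite ger0_real // sqrtC_ge0 ltW.
exists r^-1; first by rewrite invr_eq0.
rewrite adjZ -scalemxAl -scalemxAr scalerA [_ *m _]mx11_scalar -/c scale_scalar_mx.
by rewrite fmorphV /= rr -invfM -expr2 sqrtCK mulVf // gt_eqF.
Qed.

Section Weights.
Variable R : realType.
Local Notation C := R[i].

Definition cexp (t : R) : C := cos t +i* sin t.

Lemma cexpD s t : cexp (s + t) = cexp s * cexp t.
Proof.
by rewrite /cexp cosD sinD; apply/eqP; rewrite eq_complex /= eqxx addrC eqxx.
Qed.

Lemma cexp0 : cexp 0 = 1.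
Proof. by rewrite /cexp cos0 sin0. Qed.

Lemma cexp_neq0 t : cexp t != 0.
Proof.
apply/eqP => t0; have := cexpD t (- t).
by rewrite subrr cexp0 t0 mul0r => /eqP; rewrite oner_eq0.
Qed.

Lemma cexpN t : cexp (- t) = (cexp t)^-1.
Proof.
by apply: (mulfI (cexp_neq0 t)); rewrite -cexpD subrr cexp0 divff // cexp_neq0.
Qed.

Lemma cexp_surj (z : C) : `|z| = 1 -> exists t, z = cexp t.
Proof.
move=> z1; have := add_Re2_Im2 z; rewrite z1 expr1n => /(@complexI _ _ 1).
by move=> /unit_polar[t [zc zs]]; exists t; rewrite /cexp -zc -zs; case: (z).
Qed.

Lemma cexp_derive t : cderiv cexp t ('i * cexp t).
Proof.
rewrite -complexiE; split; rewrite /cexp /= ?(mul0r, mul1r, sub0r, add0r).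
  exact: is_derive_cos.
exact: is_derive_sin.
Qed.

Lemma cexpX_derive k t : cderiv (fun t => cexp t ^+ k) t ('i * k%:R * cexp t ^+ k).
Proof.
elim: k => [|k IH].
  rewrite mulr0 mul0r; under eq_fun do rewrite expr0; exact: cderiv_cst.
under eq_fun do rewrite exprS.
have := cderivM (cexp_derive t) IH.
by congr cderiv; rewrite exprS -natr1; ring.
Qed.

(** As a one-dimensional representation the character makes a weight vector u an intertwiner from C,
    so passing between weights and eigenvalues is a case of [one_param_intertwine]. *)
Lemma one_param_char k : one_param (fun t => (cexp t ^+ k)%:M : 'M[C]_1) ('i * k%:R)%:M.
Proof.
split.
- by rewrite cexp0 expr1n.
- by move=> s t; rewrite cexpD exprMn scalar_mxM.
- move=> t; rewrite -scalar_mxM => i j; rewrite (ord1 i) (ord1 j).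
  by under eq_fun do rewrite mxE /= mulr1n; rewrite mxE /= mulr1n; exact: cexpX_derive.
Qed.

Lemma one_param_weight d (F : R -> 'M[C]_d) X k (u : 'cV[C]_d) :
  one_param F X -> X *m u = ('i * k%:R) *: u -> forall t, F t *m u = cexp t ^+ k *: u.
Proof.
move=> FX Xu t; have := one_param_intertwine (T := u) (one_param_char k) FX.
by rewrite mul_mx_scalar Xu => /(_ erefl t); rewrite mul_mx_scalar.
Qed.

Lemma one_param_weight_generator d (F : R -> 'M[C]_d) X k (u : 'cV[C]_d) :
  one_param F X -> (forall t, F t *m u = cexp t ^+ k *: u) -> X *m u = ('i * k%:R) *: u.
Proof.
move=> FX Fu; have := one_param_intertwine_generator (T := u) (one_param_char k) FX.
by rewrite mul_mx_scalar => <- // t; rewrite mul_mx_scalar Fu.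
Qed.

(** The four indices in the form in which entries of nested block matrices reduce. *)
Lemma ord22P (P : 'I_(2 + 2) -> Prop) :
  P (lshift 2 (lshift 1 (0 : 'I_1))) -> P (lshift 2 (rshift 1 (0 : 'I_1))) ->
  P (rshift 2 (lshift 1 (0 : 'I_1))) -> P (rshift 2 (rshift 1 (0 : 'I_1))) -> forall i, P i.
Proof.
move=> p0 p1 p2 p3 [[|[|[|[|//]]]] lti].
- by rewrite (_ : Ordinal lti = lshift 2 (lshift 1 (0 : 'I_1))) //; apply: val_inj.
- by rewrite (_ : Ordinal lti = lshift 2 (rshift 1 (0 : 'I_1))) //; apply: val_inj.
- by rewrite (_ : Ordinal lti = rshift 2 (lshift 1 (0 : 'I_1))) //; apply: val_inj.
- by rewrite (_ : Ordinal lti = rshift 2 (rshift 1 (0 : 'I_1))) //; apply: val_inj.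
Qed.

Lemma torusE (z1 z2 : C) :
  (forall i j : 'I_2, torus z1 z2 (lshift 2 i) (lshift 2 j) = Defs.rot z1 i j) *
  (forall i j : 'I_2, torus z1 z2 (lshift 2 i) (rshift 2 j) = 0) *
  (forall i j : 'I_2, torus z1 z2 (rshift 2 i) (lshift 2 j) = 0) *
  (forall i j : 'I_2, torus z1 z2 (rshift 2 i) (rshift 2 j) = Defs.rot z2 i j).
Proof.
(split; [split; [split|]|]) => i j; rewrite /torus.
- exact: block_mxEul.
- by apply: (etrans (block_mxEur _ _ _ _ i j)); rewrite mxE.
- by apply: (etrans (block_mxEdl _ _ _ _ i j)); rewrite mxE.
- exact: block_mxEdr.
Qed.

Lemma rotE (z : C) :
  (forall i j : 'I_1, Defs.rot z (lshift 1 i) (lshift 1 j) = complex.Re z) *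
  (forall i j : 'I_1, Defs.rot z (lshift 1 i) (rshift 1 j) = - complex.Im z) *
  (forall i j : 'I_1, Defs.rot z (rshift 1 i) (lshift 1 j) = complex.Im z) *
  (forall i j : 'I_1, Defs.rot z (rshift 1 i) (rshift 1 j) = complex.Re z).
Proof.
(split; [split; [split|]|]) => i j; rewrite /Defs.rot.
- by apply: (etrans (block_mxEul _ _ _ _ i j)); rewrite (ord1 i) (ord1 j) !mxE.
- by apply: (etrans (block_mxEur _ _ _ _ i j)); rewrite (ord1 i) (ord1 j) !mxE.
- by apply: (etrans (block_mxEdl _ _ _ _ i j)); rewrite (ord1 i) (ord1 j) !mxE.
- by apply: (etrans (block_mxEdr _ _ _ _ i j)); rewrite (ord1 i) (ord1 j) !mxE.
Qed.

(** On the plane of 1 and i the left and right angles add, while on that of j and k they subtract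
    because j e^(iu) = e^(-iu) j. Hence weight (l1, l2) means left weight l1 + l2 and right weight
    l1 - l2. *)
Lemma torus_quat (s u : R) : torus (cexp (s + u)) (cexp (s - u)) =
  lquat (cos s) (sin s) 0 0 *m rquat (cos u) (sin u) 0 0.
Proof.
have E w x y z w' x' y' z' : lquat w x y z *m rquat w' x' y' z' =
    \matrix_(i < 4, j < 4) \sum_(k < 4) lquat w x y z i k * rquat w' x' y' z' k j.
  by apply/matrixP => i j; rewrite !mxE.
rewrite E rquatE; apply/matrixP; apply: ord22P; apply: ord22P;
  rewrite torusE ?rotE ![in RHS]mxE
    !big_ord_recl big_ord0 !mxE /= ?mulr1n ?cosD ?sinD ?cosN ?sinN; ring.
Qed.

Lemma mulrACA_eq (K : comRingType) (a b a' b' p q : K) :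
  a * a' = p -> b * b' = q -> q * p = a * b * (a' * b').
Proof. by move=> <- <-; rewrite [RHS]mulrACA mulrC. Qed.

Lemma bi_sl2_weight d (rho : 'M[R]_4 -> 'M[C]_d) HL EL FL HR ER FR (k l : nat)
    (k1 k2 : int) (u : 'cV[C]_d) :
  unitary_rep (SOgroup R 4) rho -> bi_sl2 rho HL EL FL HR ER FR ->
  HL *m u = k%:R *: u -> HR *m u = l%:R *: u -> u != 0 ->
  k1 + k2 = k%:Z -> k1 - k2 = l%:Z -> is_weight rho k1 k2.
Proof.
move=> U B Lu Ru u0 kE lE; exists u => // z1 z2 /cexp_surj[a ->] /cexp_surj[b ->].
pose s := (a + b) / 2; pose t := (a - b) / 2.
have -> : a = s + t by rewrite /s /t; field.
have -> : b = s - t by rewrite /s /t; field.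
have nL := circle_unit s; have nR := circle_unit t.
rewrite torus_quat (unitary_repM U); last 2 first.
- by apply: SO_lquat; case: nL.
- by apply: SO_rquat; case: nR.
have gl := quat_gen1 (bi_sl2_genL B); have gr := quat_gen1 (bi_sl2_genR B).
have wl : ('i *: HL) *m u = ('i * k%:R) *: u by rewrite -scalemxAl Lu scalerA.
have wr : ('i *: HR) *m u = ('i * l%:R) *: u by rewrite -scalemxAl Ru scalerA.
rewrite -mulmxA (one_param_weight gr wr t) -scalemxAr (one_param_weight gl wl s) scalerA.
congr (_ *: _); rewrite !cexpD cexpN.
have us := cexp_neq0 s; have ut := cexp_neq0 t.
rewrite !exprzMl ?unitfE ?invr_neq0 // exprz_inv.
have Es : cexp s ^ k1 * cexp s ^ k2 = cexp s ^+ k by rewrite -expfzDr // kE.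
have Et : cexp t ^ k1 * cexp t ^ (- k2) = cexp t ^+ l by rewrite -expfzDr // lE.
exact: mulrACA_eq Es Et.
Qed.

Lemma irrep_highest_vector (l1 l2 : int) (V : irrep R l1 l2) HL EL FL HR ER FR (a b : nat) :
  bi_sl2 V HL EL FL HR ER FR -> l1 + l2 = a%:Z -> l1 - l2 = b%:Z ->
  exists v : 'cV[C]_(irrep_dim V),
    [/\ v^t* *m v = 1%:M, EL *m v = 0, HL *m v = a%:R *: v, ER *m v = 0 &
        HR *m v = b%:R *: v].
Proof.
move=> B aE bE; have [[w w0 ww] hw] := irrep_highest_weight V.
have U := irrep_unitary V.
have gl := quat_gen1 (bi_sl2_genL B); have gr := quat_gen1 (bi_sl2_genR B).
have norm1 t : `|cexp t| = 1.
  by rewrite normc_def /= cos2Dsin2 sqrtr1.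
have iN0 : ('i : C) != 0 by exact: neq0Ci.
have Lw : HL *m w = a%:R *: w.
  have := one_param_weight_generator (k := a) (u := w) gl.
  rewrite -scalemxAl -scalerA => E; apply: (scalerI iN0); apply: E => t.
  have := torus_quat t 0; rewrite cos0 sin0 /rquat lquat1 mulmx1 flip4K mulmx1.
  rewrite addr0 subr0 => <-; rewrite ww ?norm1 // -expfzDr ?cexp_neq0 //.
  by rewrite aE.
have Rw : HR *m w = b%:R *: w.
  have := one_param_weight_generator (k := b) (u := w) gr.
  rewrite -scalemxAl -scalerA => E; apply: (scalerI iN0); apply: E => t.
  have := torus_quat 0 t; rewrite cos0 sin0 lquat1 mul1mx.
  rewrite add0r sub0r => <-; rewrite ww ?norm1 // cexpN exprz_inv.
  by rewrite -expfzDr ?cexp_neq0 // bE.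
have [L2 R2] := (sl2_HE (bi_sl2L B), sl2_HE (bi_sl2R B)).
(* Both raising operators add 1 to the first weight coordinate, which [highest_weight] bounds by l1;
   so E_L w and E_R w must vanish. *)
have too_high (k1 k2 : int) : l1 < k1 -> ~ is_weight V k1 k2.
  move=> lk /hw[m [n [e _]]]; have : l1 - k1 < 0 by rewrite subr_lt0.
  by rewrite e ltNge addr_ge0.
have [HLR _] := bi_sl2_HL_comm B.
have HRL : HR *m EL = EL *m HR.
  have -> : HR = ER *m FR - FR *m ER by rewrite (sl2_EF (bi_sl2R B)) addrAC subrr add0r.
  rewrite mulmxBl mulmxBr -!mulmxA -(bi_sl2_EF B) -(bi_sl2_EE B) !mulmxA.
  by rewrite -(bi_sl2_EF B) -(bi_sl2_EE B).
have ELw : EL *m w = 0.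
  apply/eqP; apply: contraT => Ew; exfalso.
  apply: (@too_high (l1 + 1) (l2 + 1)); first by rewrite ltrDl.
  apply: (bi_sl2_weight (k := a + 2) (l := b) U B _ _ Ew).
  - by rewrite mulmxA L2 mulmxDl -mulmxA Lw -scalemxAr -scalemxAl -scalerDl natrD.
  - by rewrite mulmxA HRL -mulmxA Rw scalemxAr.
  - by rewrite PoszD -aE; ring.
  - by rewrite -bE; ring.
have ERw : ER *m w = 0.
  apply/eqP; apply: contraT => Ew; exfalso.
  apply: (@too_high (l1 + 1) (l2 - 1)); first by rewrite ltrDl.
  apply: (bi_sl2_weight (k := a) (l := b + 2) U B _ _ Ew).
  - by rewrite mulmxA HLR -mulmxA Lw scalemxAr.
  - by rewrite mulmxA R2 mulmxDl -mulmxA Rw -scalemxAr -scalemxAl -scalerDl natrD.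
  - by rewrite -aE; ring.
  - by rewrite PoszD -bE; ring.
have [c _ c1] := unit_vector w0.
have sc (X : 'M[C]_(irrep_dim V)) k : X *m w = k *: w -> X *m (c *: w) = k *: (c *: w).
  by move=> Xw; rewrite -scalemxAr Xw !scalerA mulrC.
by exists (c *: w); split; [exact: c1 | rewrite -scalemxAr ELw scaler0 | exact: sc |
  rewrite -scalemxAr ERw scaler0 | exact: sc].
Qed.

End Weights.

(** * Uniqueness of irreducible representations *)

Lemma isometry_square (C : numClosedFieldType) m n (A : 'M[C]_(m, n)) : m = n ->
  A^t* *m A = 1%:M -> A *m A^t* = 1%:M.
Proof. by move=> e; case: _ / e in A * => /mulmx1C. Qed.

Section Uniqueness.
Variable R : realType.
Local Notation C := R[i].

Lemma unitary_rep_adj_intertwine (G : set 'M[R]_4) d e (rho : 'M[R]_4 -> 'M[C]_d)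
    (rho' : 'M[R]_4 -> 'M[C]_e) (T : 'M[C]_(e, d)) g :
  unitary_rep G rho -> unitary_rep G rho' -> G g ->
  T *m rho g = rho' g *m T -> T^t* *m rho' g = rho g *m T^t*.
Proof.
move=> U U' Gg Tg.
have := elimT unitarymxP (unitary_rep_unitary U Gg) => r1.
have r2 := mulmx1C (elimT unitarymxP (unitary_rep_unitary U' Gg)).
have := congr1 (fun A => rho g *m A^t* *m rho' g) Tg.
rewrite !mulmx_adj mulmxA r1 mul1mx => ->.
by rewrite -!mulmxA r2 mulmx1.
Qed.

Record highest_data d (rho : 'M[R]_4 -> 'M[C]_d) (a b : nat)
    (HL EL FL HR ER FR : 'M[C]_d) (v : 'cV[C]_d) : Prop := HighestData {
  highest_bi : bi_sl2 rho HL EL FL HR ER FR;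
  highest_unit : v^t* *m v = 1%:M;
  highest_EL : EL *m v = 0;
  highest_HL : HL *m v = a%:R *: v;
  highest_ER : ER *m v = 0;
  highest_HR : HR *m v = b%:R *: v }.

Lemma irrep_highest_data (l1 l2 : int) (V : irrep R l1 l2) (a b : nat) :
  l1 + l2 = a%:Z -> l1 - l2 = b%:Z ->
  exists HL EL FL HR ER FR v, highest_data V a b HL EL FL HR ER FR v.
Proof.
move=> aE bE; have [HL [EL [FL [HR [ER [FR B]]]]]] := unitary_rep_bi_sl2 (irrep_unitary V).
have [v [v1 v2 v3 v4 v5]] := irrep_highest_vector B aE bE.
by exists HL, EL, FL, HR, ER, FR, v; split.
Qed.

Section Intertwiner.
Variables (d e a b : nat) (rho : 'M[R]_4 -> 'M[C]_d) (rho' : 'M[R]_4 -> 'M[C]_e).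
Variables (HL EL FL HR ER FR : 'M[C]_d) (HL' EL' FL' HR' ER' FR' : 'M[C]_e).
Variables (v : 'cV[C]_d) (v' : 'cV[C]_e).
Hypotheses (D : highest_data rho a b HL EL FL HR ER FR v).
Hypotheses (D' : highest_data rho' a b HL' EL' FL' HR' ER' FR' v').

(** The rank one map v -> v' extended along the right strings; [highest_map] then extends the result
    along the left strings. *)
Definition highest_map0 := string_map b ER FR' (v' *m v^t*).
Definition highest_map := string_map a EL FL' highest_map0.

Let B := highest_bi D.
Let B' := highest_bi D'.

Let FLv : v^t* *m FL = 0.
Proof. by rewrite -(sl2_adj (bi_sl2L B)) -mulmx_adj (highest_EL D) adj0. Qed.
Let FRv : v^t* *m FR = 0.
Proof. by rewrite -(sl2_adj (bi_sl2R B)) -mulmx_adj (highest_ER D) adj0. Qed.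
Let HLv : v^t* *m HL = a%:R *: v^t*.
Proof.
by rewrite -{1}(sl2_adjH (bi_sl2L B)) -mulmx_adj (highest_HL D) adjZ rmorph_nat.
Qed.
Let HRv : v^t* *m HR = b%:R *: v^t*.
Proof.
by rewrite -{1}(sl2_adjH (bi_sl2R B)) -mulmx_adj (highest_HR D) adjZ rmorph_nat.
Qed.

Let TFR : v' *m v^t* *m FR = 0. Proof. by rewrite -mulmxA FRv mulmx0. Qed.
Let THR : v' *m v^t* *m HR = b%:R *: (v' *m v^t*).
Proof. by rewrite -mulmxA HRv scalemxAr. Qed.
Let ERT : ER' *m (v' *m v^t*) = 0. Proof. by rewrite mulmxA (highest_ER D') mul0mx. Qed.
Let HRT : HR' *m (v' *m v^t*) = b%:R *: (v' *m v^t*).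
Proof. by rewrite mulmxA (highest_HR D') scalemxAl. Qed.

Lemma highest_map0_ER : ER' *m highest_map0 = highest_map0 *m ER.
Proof. exact: string_map_E (bi_sl2R B) (bi_sl2R B') TFR THR ERT HRT. Qed.

Lemma highest_map0_FR : FR' *m highest_map0 = highest_map0 *m FR.
Proof. exact: string_map_F (bi_sl2R B) (bi_sl2R B') TFR THR ERT HRT. Qed.

(** Annihilation is treated as commutation with 0 on the other side, and a weight, below, as
    commutation with a scalar matrix, so that [string_map_comm] covers both. *)
Lemma highest_map0_EL : EL' *m highest_map0 = 0.
Proof.
rewrite /highest_map0 (string_map_comm b (A := 0) (bi_sl2_EF B')).
- by rewrite mulmx0.
- by rewrite mulmx0 mul0mx.
- by rewrite mulmx0 mulmxA (highest_EL D') mul0mx.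
Qed.

Lemma highest_map0_HL : HL' *m highest_map0 = a%:R *: highest_map0.
Proof.
have [_ hF] := bi_sl2_HL_comm B'.
rewrite /highest_map0 (string_map_comm b (A := a%:R%:M) hF).
- by rewrite mul_mx_scalar.
- by rewrite mul_mx_scalar mul_scalar_mx.
- by rewrite mul_mx_scalar mulmxA (highest_HL D') scalemxAl.
Qed.

Lemma highest_map0_FL : highest_map0 *m FL = 0.
Proof.
rewrite /highest_map0 -(string_map_comm b (A' := 0) _ (bi_sl2_FE B)).
- by rewrite mul0mx.
- by rewrite mulmx0 mul0mx.
- by rewrite mul0mx -mulmxA FLv mulmx0.
Qed.

Lemma highest_map0_HLr : highest_map0 *m HL = a%:R *: highest_map0.
Proof.
have [hE _] := bi_sl2_HL_comm B.
rewrite /highest_map0 -(string_map_comm b (A' := a%:R%:M) _ hE).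
- by rewrite mul_scalar_mx.
- by rewrite mul_mx_scalar mul_scalar_mx.
- by rewrite mul_scalar_mx -mulmxA HLv scalemxAr.
Qed.

Lemma highest_map_intertwine :
  unitary_rep (SOgroup R 4) rho -> unitary_rep (SOgroup R 4) rho' ->
  forall g, SOgroup R 4 g -> highest_map *m rho g = rho' g *m highest_map.
Proof.
move=> U U'; apply: (bi_sl2_intertwine U U' B B').
- exact: string_map_E (bi_sl2L B) (bi_sl2L B') highest_map0_FL highest_map0_HLr
    highest_map0_EL highest_map0_HL.
- exact: string_map_F (bi_sl2L B) (bi_sl2L B') highest_map0_FL highest_map0_HLr
    highest_map0_EL highest_map0_HL.
- apply: string_map_comm; [exact: (esym (bi_sl2_FE B')) | exact: (esym (bi_sl2_EE B)) |].
  exact: highest_map0_ER.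
- apply: string_map_comm; [exact: (esym (bi_sl2_FF B')) | exact: (esym (bi_sl2_EF B)) |].
  exact: highest_map0_FR.
Qed.

Lemma highest_map_vec : highest_map *m v = v'.
Proof.
rewrite /highest_map string_map_top ?(highest_EL D) //.
rewrite /highest_map0 string_map_top ?(highest_ER D) //.
by rewrite -mulmxA (highest_unit D) mulmx1.
Qed.

End Intertwiner.

Lemma vec_unit_neq0 d (v : 'cV[C]_d) : v^t* *m v = 1%:M -> v != 0.
Proof.
move=> v1; apply/eqP => v0; move: v1; rewrite v0 mulmx0 => /matrixP/(_ 0 0)/eqP.
by rewrite !mxE eq_sym oner_eq0.
Qed.

(** Schur's lemma makes the map a scalar, and it fixes v. This expresses the identity through weight
    strings. *)
Lemma irreducible_highest_map1 d (rho : 'M[R]_4 -> 'M[C]_d) a b HL EL FL HR ER FR v :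
  unitary_rep (SOgroup R 4) rho -> irreducible_rep (SOgroup R 4) rho ->
  highest_data rho a b HL EL FL HR ER FR v -> highest_map a b EL ER FL FR v v = 1%:M.
Proof.
move=> U irr D; have [c cE] := schur irr (highest_map_intertwine D D U U).
rewrite cE; have := highest_map_vec FL FR v D; rewrite cE mul_scalar_mx => /eqP.
rewrite -subr_eq0 -[X in _ - X]scale1r -scalerBl scaler_eq0 subr_eq0.
by rewrite (negbTE (vec_unit_neq0 (highest_unit D))) orbF => /eqP ->.
Qed.

(** The dimension is the trace of the identity written as [highest_map]: the left and right strings
    contribute a + 1 and b + 1, and the rank one projection v v^t* has trace 1. *)
Lemma irrep_dimE (l1 l2 : int) (V : irrep R l1 l2) (a b : nat) :
  l1 + l2 = a%:Z -> l1 - l2 = b%:Z -> irrep_dim V = (a.+1 * b.+1)%N.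
Proof.
move=> aE bE; have [HL [EL [FL [HR [ER [FR [v D]]]]]]] := irrep_highest_data V aE bE.
have T1 := irreducible_highest_map1 (irrep_unitary V) (irrep_irreducible V) D.
have B := highest_bi D.
have := congr1 mxtrace T1; rewrite mxtrace1.
rewrite (string_map_trace (bi_sl2L B) (highest_map0_FL FR v D) (highest_map0_HLr FR v D)).
have FRv : v *m v^t* *m FR = 0.
  by rewrite -mulmxA -(sl2_adj (bi_sl2R B)) -mulmx_adj (highest_ER D) adj0 mulmx0.
have HRv : v *m v^t* *m HR = b%:R *: (v *m v^t*).
  rewrite -mulmxA -{1}(sl2_adjH (bi_sl2R B)) -mulmx_adj (highest_HR D) adjZ rmorph_nat.
  by rewrite scalemxAr.
rewrite (string_map_trace (bi_sl2R B) FRv HRv) mxtrace_mulC (highest_unit D) mxtrace1.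
by rewrite mulr1 -natrM => /eqP; rewrite eqr_nat => /eqP ->.
Qed.

(** Labels are compared through their sum and difference, so a twisted representation, whose second
    label is a double negation, can be used without transport between types. *)
Lemma irrep_unique (l1 l2 k1 k2 : int) (V : irrep R l1 l2) (V' : irrep R k1 k2) (a b : nat) :
  l1 + l2 = a%:Z -> l1 - l2 = b%:Z -> k1 + k2 = a%:Z -> k1 - k2 = b%:Z ->
  exists T : 'M[C]_(irrep_dim V', irrep_dim V),
    [/\ T *m T^t* = 1%:M, T^t* *m T = 1%:M &
        forall g, SOgroup R 4 g -> T *m V g = V' g *m T].
Proof.
move=> aE bE aE' bE'.
have [HL [EL [FL [HR [ER [FR [v D]]]]]]] := irrep_highest_data V aE bE.
have [HL' [EL' [FL' [HR' [ER' [FR' [v' D']]]]]]] := irrep_highest_data V' aE' bE'.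
have U := irrep_unitary V; have U' := irrep_unitary V'.
pose T := highest_map a b EL ER FL' FR' v v'; exists T.
have TI : forall g, SOgroup R 4 g -> T *m V g = V' g *m T := highest_map_intertwine D D' U U'.
have Tv : T *m v = v' := highest_map_vec FL' FR' v' D.
have TT : T^t* *m T = 1%:M.
  have [|c cE] := schur (T := T^t* *m T) (irrep_irreducible V).
    move=> g Gg; rewrite -mulmxA TI // mulmxA.
    by rewrite (unitary_rep_adj_intertwine U U' Gg (TI g Gg)) mulmxA.
  have := highest_unit D'; rewrite -Tv mulmx_adj mulmxA -[_ *m T^t* *m T]mulmxA cE.
  rewrite mul_mx_scalar -scalemxAl (highest_unit D) scalemx1 => /matrixP/(_ 0 0).
  by rewrite !mxE !mulr1n => ->.
split => //; apply: isometry_square TT.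
by rewrite (irrep_dimE V aE bE) (irrep_dimE V' aE' bE').
Qed.

Lemma quat_rep_trivial d : quat_rep (fun _ _ _ _ : R => 1%:M : 'M[C]_d).
Proof.
split.
- by [].
- by move=> *; rewrite mulmx1.
- by move=> *; apply/unitarymxP; rewrite adj_scalar conjC1 mulmx1.
- by move=> i j t; exact: ccont_cst.
- by move=> i j t; exact: ccont_cst.
- by move=> i j t; exact: ccont_cst.
Qed.

Lemma one_param_trivial d : one_param (fun _ : R => 1%:M : 'M[C]_d) 0.
Proof.
split.
- by [].
- by move=> s t; rewrite mulmx1.
- by move=> t; rewrite mul0mx; exact: mderiv_cst.
Qed.

Lemma irrep_right_trivial (l1 l2 : int) (V : irrep R l1 l2) (a : nat) :
  l1 + l2 = a%:Z -> l1 - l2 = 0%:Z ->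
  forall w x y z, w ^+ 2 + x ^+ 2 + y ^+ 2 + z ^+ 2 = 1 -> V (rquat w x y z) = 1%:M.
Proof.
move=> aE bE; have [HL [EL [FL [HR [ER [FR [v D]]]]]]] := irrep_highest_data V aE bE.
have U := irrep_unitary V.
have T1 := irreducible_highest_map1 U (irrep_irreducible V) D.
have B := highest_bi D.
(* Write the identity as [highest_map] and move ER past the left lowering operators. For b = 0 the
   right string has the single term v v^t*, and ER v = 0. *)
have ER0 : ER = 0.
  rewrite -[ER]mulmx1 -T1.
  rewrite (string_map_comm a (A := 0) (esym (bi_sl2_FE B))) ?mulmx0 ?mul0mx //.
  rewrite /highest_map0 /string_map big_ord_recl big_ord0 addr0 -scalemxAr /=.
  by rewrite mulmxA (highest_ER D) mul0mx scaler0.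
have FR0 : FR = 0 by rewrite -(sl2_adj (bi_sl2R B)) ER0 adj0.
have HR0 : HR = 0.
  by have := sl2_EF (bi_sl2R B); rewrite ER0 mul0mx mulmx0 add0r.
move=> w x y z n1.
have tg : quat_gen (fun _ _ _ _ : R => 1%:M : 'M[C]_(irrep_dim V)) 0 0 0.
  by split; exact: one_param_trivial.
have := @quat_rep_intertwine _ _ _ _ _ _ _ _ _ _ _ 1%:M (unitary_rep_rquat U)
  (quat_rep_trivial _) (bi_sl2_genR B) tg.
rewrite HR0 ER0 FR0 scaler0 subr0 mulmx0 mul0mx => /(_ erefl erefl _ _ _ _ n1).
by rewrite mul1mx mulmx1.
Qed.

(** Both T^t* T and T T^t* are scalars with equal traces. If T is nonzero the scalars coincide, and
    unequal dimensions then force them to be 0. *)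
Lemma schur_dim_neq (l1 l2 k1 k2 : int) (V : irrep R l1 l2) (V' : irrep R k1 k2)
    (T : 'M[C]_(irrep_dim V', irrep_dim V)) :
  irrep_dim V != irrep_dim V' ->
  (forall g, SOgroup R 4 g -> T *m V g = V' g *m T) -> T = 0.
Proof.
move=> dne TI; have U := irrep_unitary V; have U' := irrep_unitary V'.
have TI' g : SOgroup R 4 g -> T^t* *m V' g = V g *m T^t*.
  by move=> Gg; exact: unitary_rep_adj_intertwine U U' Gg (TI g Gg).
have [|c cE] := schur (T := T^t* *m T) (irrep_irreducible V).
  by move=> g Gg; rewrite -mulmxA TI // mulmxA TI' // mulmxA.
have [|c' cE'] := schur (T := T *m T^t*) (irrep_irreducible V').
  by move=> g Gg; rewrite -mulmxA TI' // mulmxA TI // mulmxA.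
have cT : c *: T = c' *: T.
  by rewrite -mul_mx_scalar -cE mulmxA cE' mul_scalar_mx.
have [//|T0] := eqVneq T 0.
have cc : c = c'.
  move/eqP: cT; rewrite -subr_eq0 -scalerBl scaler_eq0 (negbTE T0) orbF subr_eq0.
  by move/eqP.
apply: mulmx_adj_eq0; rewrite cE'.
have [->|c0] := eqVneq c' 0; first by rewrite -scalemx1 scale0r.
have := mxtrace_mulC T (T^t*); rewrite cE cE' !mxtrace_scalar cc.
rewrite -[LHS]mulr_natr -[RHS]mulr_natr => /(mulfI c0)/eqP; rewrite eqr_nat eq_sym.
by rewrite (negbTE dne).
Qed.

End Uniqueness.

(** * Gradient symbols *)

(** The rescaled adjoints form a right inverse of the stacked matrix of A0 and A2, which is square,
    so they are also a left inverse. *)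
Lemma complementary_frames (C : numClosedFieldType) m0 m2 n
    (A0 : 'M[C]_(m0, n)) (A2 : 'M[C]_(m2, n)) (c0 c2 : C) :
  n = (m0 + m2)%N -> c0 != 0 -> c2 != 0 ->
  A0 *m A0^t* = c0%:M -> A2 *m A2^t* = c2%:M -> A0 *m A2^t* = 0 ->
  c0^-1 *: (A0^t* *m A0) + c2^-1 *: (A2^t* *m A2) = 1%:M.
Proof.
move=> e n0 n2 h0 h2 h02.
have h20 : A2 *m A0^t* = 0 by rewrite -[A2 *m _]trmxCK mulmx_adj trmxCK h02 adj0.
have sq k (Q : 'M[C]_(k, n)) (K : 'M[C]_(n, k)) : n = k -> Q *m K = 1%:M -> K *m Q = 1%:M.
  by move=> nk; case: _ / nk in Q K * => /mulmx1C.
have := sq _ (col_mx A0 A2) (row_mx (c0^-1 *: A0^t*) (c2^-1 *: A2^t*)) e.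
rewrite mul_col_row mul_row_col -!scalemxAr -!scalemxAl h0 h2 h02 h20 !scaler0.
by rewrite !scale_scalar_mx !mulVf // -scalar_mx_block; apply.
Qed.

Section GradientSymbols.
Variable R : realType.
Local Notation C := R[i].

Lemma mulmx_colP m n (A B : 'M[C]_(m, n)) : (forall v : 'cV[C]_n, A *m v = B *m v) -> A = B.
Proof.
by move=> AB; apply/matrixP => i j; have /colP/(_ i) := AB (delta_mx j 0); rewrite -!colE !mxE.
Qed.

Lemma complexifyM m n p (A : 'M[R]_(m, n)) (B : 'M[R]_(n, p)) :
  complexify (A *m B) = complexify A *m complexify B.
Proof. exact: map_mxM. Qed.

Lemma gradient_symbol_intertwine n d k d' k' (g : 'M[R]_n) (T : 'M[C]_(d', d))
    (S : 'M[C]_(k', k)) (p : 'M[C]_(k, n * d)) (p' : 'M[C]_(k', n * d')) :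
  S *m p = p' *m (complexify g *t T) ->
  forall zeta, S *m gradient_symbol p zeta = gradient_symbol p' (g *m zeta) *m T.
Proof.
move=> Sp zeta; apply: mulmx_colP => v.
by rewrite -!mulmxA !gradient_symbolE mulmxA Sp complexifyM -tensmx_mul mulmxA.
Qed.

Lemma gradient_symbol_inj n d k (p p' : 'M[C]_(k, n * d)) :
  (forall zeta, gradient_symbol p zeta = gradient_symbol p' zeta) -> p = p'.
Proof.
move=> pp'; apply/matrixP => i l; case: (mxtens_indexP l) => a b.
have := congr1 (fun A => (A *m (delta_mx b 0 : 'cV[C]_d)) i 0) (pp' (delta_mx a 0)).
have E (q : 'M[C]_(k, n * d)) : (gradient_symbol q (delta_mx a 0) *m (delta_mx b 0 : 'cV[C]_d)) i 0 =
    q i (mxtens_index (a, b)).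
  rewrite gradient_symbolE mxE (bigD1 (mxtens_index (a, b))) //= big1 ?addr0.
    by rewrite !mxE mxtens_indexK /= !ord1 !eqxx /= rmorph1 !mulr1.
  move=> m; case: (mxtens_indexP m) => a' b' ne.
  rewrite !mxE mxtens_indexK /= !ord1 !eqxx !andbT.
  have [ea|_] := eqVneq a' a; last by rewrite rmorph0 mul0r mulr0.
  have [eb|_] := eqVneq b' b; last by rewrite !mulr0.
  by rewrite ea eb eqxx in ne.
by rewrite !E.
Qed.

Lemma gradient_symbol_linear n d k (p : 'M[C]_(k, n * d)) (a : R) (x y : 'cV[R]_n) :
  gradient_symbol p (a *: x + y) = a%:C *: gradient_symbol p x + gradient_symbol p y.
Proof.
apply: mulmx_colP => v; rewrite mulmxDl -scalemxAl !gradient_symbolE scalemxAr -mulmxDr.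
congr (_ *m _); apply/matrixP => i j; rewrite !mxE.
by rewrite rmorphD rmorphM mulrDl mulrA.
Qed.

Lemma gradient_symbolZ n d k (p : 'M[C]_(k, n * d)) (a : R) (x : 'cV[R]_n) :
  gradient_symbol p (a *: x) = a%:C *: gradient_symbol p x.
Proof.
have g0 : gradient_symbol p 0 = 0.
  have := gradient_symbol_linear p 1 0 0; rewrite scale1r addr0 rmorph1 scale1r.
  by rewrite -[X in X = _]addr0 => /addrI.
by rewrite -[a *: x]addr0 gradient_symbol_linear g0 addr0.
Qed.

(** The quaternion 1; its orbit under left multiplication by unit quaternions is the whole
    sphere. *)
Definition e1 : 'cV[R]_4 := delta_mx 0 0.

Lemma quat_transitive (zeta : 'cV[R]_4) : exists r w x y z : R,
  [/\ w ^+ 2 + x ^+ 2 + y ^+ 2 + z ^+ 2 = 1, zeta = r *: (lquat w x y z *m e1) &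
      (zeta != 0 -> r != 0)].
Proof.
have [->|z0] := eqVneq zeta 0.
  exists 0, 1, 0, 0, 0; split; [by ring | by rewrite scale0r | by []].
pose w := zeta 0 0; pose x := zeta (lift 0 0) 0; pose y := zeta (lift 0 (lift 0 0)) 0.
pose z := zeta (lift 0 (lift 0 (lift 0 0))) 0.
have n0 : 0 < qnorm w x y z.
  rewrite sqrtr_gt0 lt_neqAle eq_sym; apply/andP; split; last by rewrite !addr_ge0 ?sqr_ge0.
  apply: contraNneq z0 => /eqP; rewrite !paddr_eq0 ?addr_ge0 ?sqr_ge0 // !sqrf_eq0.
  move=> /andP[/andP[/andP[/eqP w0 /eqP x0] /eqP y0] /eqP z0].
  by apply/eqP/colP; apply: ord4P; rewrite mxE.
exists (qnorm w x y z), (w / qnorm w x y z), (x / qnorm w x y z), (y / qnorm w x y z),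
  (z / qnorm w x y z); split; first exact: qnorm_unit.
  rewrite -colE; apply/colP; apply: ord4P; rewrite !mxE /= mulrC divfK ?gt_eqF //.
by move=> _; rewrite gt_eqF.
Qed.

(** By the sign convention of [rquat], this is conjugation p -> q p q^-1, which fixes 1. *)
Lemma quat_stabilizer (w x y z : R) : w ^+ 2 + x ^+ 2 + y ^+ 2 + z ^+ 2 = 1 ->
  lquat w x y z *m rquat w (- x) (- y) z *m e1 = e1.
Proof.
move=> n1; rewrite -mulmxA /e1 -[rquat _ _ _ _ *m _]colE rquatE.
have n1' : w ^+ 2 = 1 - x ^+ 2 - y ^+ 2 - z ^+ 2 by rewrite -n1; ring.
by apply/colP; apply: ord4P; rewrite !mxE !big_ord_recl big_ord0 !mxE /=; ring: n1'.
Qed.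

Section Projections.
Variables (l1 l2 : int) (V : irrep R l1 l2).

Lemma projection_symbol_equivariant (k1 k2 : int) (U : irrep R k1 k2)
    (q : summand_projection V U) g zeta : SOgroup R 4 g ->
  U g *m gradient_symbol q zeta = gradient_symbol q (g *m zeta) *m V g.
Proof.
by move=> Gg; apply: gradient_symbol_intertwine; rewrite (projection_equivariant q Gg).
Qed.

(** Equivariance under the stabilizer of e_1 is upgraded to all of SO(4): the conjugation by q acts
    on both targets as left multiplication by q alone. Schur's lemma for SO(4) therefore applies
    directly. *)
Lemma symbol_e1_intertwine (k1 k2 k1' k2' : int) (U : irrep R k1 k2) (U' : irrep R k1' k2')
    (a a' : nat) (q : summand_projection V U) (q' : summand_projection V U') :
  k1 + k2 = a%:Z -> k1 - k2 = 0%:Z -> k1' + k2' = a'%:Z -> k1' - k2' = 0%:Z ->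
  forall g, SOgroup R 4 g ->
  (gradient_symbol q e1 *m (gradient_symbol q' e1)^t*) *m U' g =
  U g *m (gradient_symbol q e1 *m (gradient_symbol q' e1)^t*).
Proof.
move=> aE bE aE' bE'.
have tU := irrep_right_trivial U aE bE; have tU' := irrep_right_trivial U' aE' bE'.
have uV := irrep_unitary V; have uU := irrep_unitary U; have uU' := irrep_unitary U'.
apply: (SO4_intertwine uU' uU) => w x y z n1; last first.
  by rewrite tU // tU' // mulmx1 mul1mx.
have m1 : w ^+ 2 + (- x) ^+ 2 + (- y) ^+ 2 + z ^+ 2 = 1 by rewrite -n1; ring.
pose h := lquat w x y z *m rquat w (- x) (- y) z.
have sl := SO_lquat n1; have sr := SO_rquat m1.
have Gh : SOgroup R 4 h := SOgroup_mul sl sr.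
have hU : U h = U (lquat w x y z) by rewrite (unitary_repM uU) // tU // mulmx1.
have hU' : U' h = U' (lquat w x y z) by rewrite (unitary_repM uU') // tU' // mulmx1.
have := projection_symbol_equivariant q e1 Gh; rewrite quat_stabilizer // => E.
have := projection_symbol_equivariant q' e1 Gh; rewrite quat_stabilizer // => E'.
rewrite -hU -hU' -mulmxA (unitary_rep_adj_intertwine uV uU' Gh (esym E')).
by rewrite mulmxA -E -mulmxA.
Qed.

(** Transitivity on the sphere determines an equivariant map by its symbol at e_1. [p] is any
    equivariant matrix, so that differences of projections are covered too. *)
Lemma symbol_e1_eq0 (k1 k2 : int) (U : irrep R k1 k2)
    (p : 'M[C]_(irrep_dim U, 4 * irrep_dim V)) :
  (forall g, SOgroup R 4 g -> p *m (complexify g *t V g) = U g *m p) ->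
  gradient_symbol p e1 = 0 -> p = 0.
Proof.
move=> pE p0; apply: gradient_symbol_inj => zeta.
have -> : gradient_symbol (0 : 'M[C]_(irrep_dim U, 4 * irrep_dim V)) zeta = 0.
  by apply: mulmx_colP => v; rewrite gradient_symbolE !mul0mx.
have [r [w [x [y [z [n1 -> _]]]]]] := quat_transitive zeta.
rewrite gradient_symbolZ; have sl := SO_lquat n1.
have := gradient_symbol_intertwine (esym (pE _ sl)) e1; rewrite p0 mulmx0 => E.
have Vu := unitary_rep_unitary (irrep_unitary V) sl.
have := congr1 (fun A => A *m (V (lquat w x y z))^t*) E.
by rewrite mul0mx -mulmxA (elimT unitarymxP Vu) mulmx1 => <-; rewrite scaler0.
Qed.

End Projections.
End GradientSymbols.

(** * Two targets that together exhaust the source: multiplicity one and injectivity *)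

Section ComplementaryProjections.
Variable R : realType.
Local Notation C := R[i].
Variables (l1 l2 k1 k2 m1 m2 : int).
Variables (V : irrep R l1 l2) (U0 : irrep R k1 k2) (U2 : irrep R m1 m2).
Variables (a b : nat).
Hypotheses (aE : k1 + k2 = a%:Z) (a'E : k1 - k2 = 0%:Z).
Hypotheses (bE : m1 + m2 = b%:Z) (b'E : m1 - m2 = 0%:Z).
Hypotheses (ab : a != b) (dimV : irrep_dim V = (irrep_dim U0 + irrep_dim U2)%N).

Lemma symbol_e1_frame (k k' : int) (U : irrep R k k') (c : nat)
    (q : summand_projection V U) : k + k' = c%:Z -> k - k' = 0%:Z ->
  exists2 x : C, x != 0 & gradient_symbol q (e1 R) *m (gradient_symbol q (e1 R))^t* = x%:M.
Proof.
move=> cE c'E; have I := symbol_e1_intertwine q q cE c'E cE c'E.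
have [x xE] := schur (irrep_irreducible U) I; exists x => //.
apply/eqP => x0; move: xE; rewrite x0 raddf0 => /mulmx_adj_eq0 q0.
have qq := elimT unitarymxP (projection_unitary q).
have := symbol_e1_eq0 (projection_equivariant q) q0 => q00.
have [d0 _] := irrep_irreducible U.
move: qq; rewrite q00 mul0mx => /matrixP/(_ (Ordinal d0) (Ordinal d0)).
by rewrite !mxE eqxx => /eqP; rewrite eq_sym oner_eq0.
Qed.

Lemma symbol_e1_orthogonal (q0 : summand_projection V U0) (q2 : summand_projection V U2) :
  gradient_symbol q0 (e1 R) *m (gradient_symbol q2 (e1 R))^t* = 0.
Proof.
apply: schur_dim_neq (symbol_e1_intertwine q0 q2 aE a'E bE b'E).
by rewrite (irrep_dimE U2 bE b'E) (irrep_dimE U0 aE a'E) !muln1 eqSS eq_sym.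
Qed.

(** Expand p' at e_1 in the frame formed by p and q2: the q2 part vanishes by orthogonality, and the
    p part is a scalar multiple of p. The scalar is a phase because both projections are
    normalized. *)
Lemma projection_multiplicity_one (p p' : summand_projection V U0)
    (q2 : summand_projection V U2) :
  exists2 c : C, c * c^* = 1 & projection_mx p' = c *: projection_mx p.
Proof.
have [x x0 xE] := symbol_e1_frame p aE a'E.
have [y y0 yE] := symbol_e1_frame q2 bE b'E.
have [z zE] := schur (irrep_irreducible U0) (symbol_e1_intertwine p' p aE a'E aE a'E).
have F := complementary_frames dimV x0 y0 xE yE (symbol_e1_orthogonal p q2).
pose c := x^-1 * z.
have G : gradient_symbol p' (e1 R) = c *: gradient_symbol p (e1 R).
  rewrite -[LHS]mulmx1 -F mulmxDr -!scalemxAr !mulmxA zE (symbol_e1_orthogonal p' q2).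
  by rewrite mul0mx scaler0 addr0 mul_scalar_mx scalerA.
have E : projection_mx p' = c *: projection_mx p.
  apply/eqP; rewrite -subr_eq0; apply/eqP; apply: symbol_e1_eq0.
    move=> g Gg; rewrite mulmxBl mulmxBr -scalemxAl -scalemxAr.
    by rewrite !projection_equivariant.
  apply: mulmx_colP => v; rewrite gradient_symbolE mulmxBl -scalemxAl.
  by rewrite -!gradient_symbolE G -scalemxAl subrr mul0mx.
exists c => //.
have := elimT unitarymxP (projection_unitary p').
rewrite E adjZ -scalemxAl -scalemxAr (elimT unitarymxP (projection_unitary p)).
have [d0 _] := irrep_irreducible U0.
rewrite scalerA => /matrixP/(_ (Ordinal d0) (Ordinal d0)).
by rewrite !mxE eqxx mulr1.
Qed.

Lemma symbol_transport (k k' : int) (U : irrep R k k') (q : summand_projection V U)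
    (r w x y z : R) : w ^+ 2 + x ^+ 2 + y ^+ 2 + z ^+ 2 = 1 ->
  gradient_symbol q (r *: (lquat w x y z *m e1 R)) =
  r%:C *: (U (lquat w x y z) *m gradient_symbol q (e1 R) *m (V (lquat w x y z))^t*).
Proof.
move=> n1; have sl := SO_lquat n1; rewrite gradient_symbolZ.
rewrite (projection_symbol_equivariant q (e1 R) sl) -mulmxA.
by rewrite (elimT unitarymxP (unitary_rep_unitary (irrep_unitary V) sl)) mulmx1.
Qed.

Lemma unitary_mul_eq0 d (A : 'M[C]_d) (v : 'cV[C]_d) : A \is unitarymx -> A *m v = 0 -> v = 0.
Proof.
move=> /unitarymxP/mulmx1C AA Av.
by rewrite -[v]mul1mx -AA -mulmxA Av mulmx0.
Qed.

Variables (q0 : summand_projection V U0) (q2 : summand_projection V U2).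
Variables (zeta : 'cV[R]_4).
Hypothesis zeta0 : zeta != 0.

Lemma symbol_pair_injective (v : 'cV[C]_(irrep_dim V)) :
  gradient_symbol q0 zeta *m v = 0 -> gradient_symbol q2 zeta *m v = 0 -> v = 0.
Proof.
have [x x0 xE] := symbol_e1_frame q0 aE a'E.
have [y y0 yE] := symbol_e1_frame q2 bE b'E.
have F := complementary_frames dimV x0 y0 xE yE (symbol_e1_orthogonal q0 q2).
have [r [w [s [t [u [n1 zE rz]]]]]] := quat_transitive zeta.
have sl := SO_lquat n1; have {rz}r0 := rz zeta0.
have rC0 : r%:C != 0 :> C by rewrite fmorph_eq0.
rewrite zE !symbol_transport //.
have uV := unitary_rep_unitary (irrep_unitary V) sl.
have uU0 := unitary_rep_unitary (irrep_unitary U0) sl.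
have uU2 := unitary_rep_unitary (irrep_unitary U2) sl.
rewrite -!scalemxAl -!mulmxA => /eqP; rewrite scaler_eq0 (negbTE rC0) /= => /eqP h0.
move=> /eqP; rewrite scaler_eq0 (negbTE rC0) /= => /eqP h2.
have {}h0 := unitary_mul_eq0 uU0 h0; have {}h2 := unitary_mul_eq0 uU2 h2.
have : (V (lquat w s t u))^t* *m v = 0.
  rewrite -[LHS]mul1mx -F mulmxDl -!scalemxAl -!mulmxA h0 h2 !mulmx0.
  by rewrite !scaler0 addr0.
by apply: unitary_mul_eq0; rewrite trmxC_unitary.
Qed.

(** At e_1, applying either symbol to the equation isolates one unknown, by the orthogonality of the
    two images; left multiplication carries this to any nonzero covector. *)
Lemma symbol_pair_adj_injective (v : 'cV[C]_(irrep_dim U0)) (v' : 'cV[C]_(irrep_dim U2)) :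
  (gradient_symbol q0 zeta)^t* *m v + (gradient_symbol q2 zeta)^t* *m v' = 0 ->
  v = 0 /\ v' = 0.
Proof.
have [x x0 xE] := symbol_e1_frame q0 aE a'E.
have [y y0 yE] := symbol_e1_frame q2 bE b'E.
have o02 := symbol_e1_orthogonal q0 q2.
have o20 : gradient_symbol q2 (e1 R) *m (gradient_symbol q0 (e1 R))^t* = 0.
  by rewrite -[LHS]trmxCK mulmx_adj trmxCK o02 adj0.
have [r [w [s [t [u [n1 zE rz]]]]]] := quat_transitive zeta.
have sl := SO_lquat n1; have {rz}r0 := rz zeta0.
have rC0 : (r%:C)^* != 0 :> C by rewrite conjC_eq0 fmorph_eq0.
rewrite zE !symbol_transport //.
have uV := unitary_rep_unitary (irrep_unitary V) sl.
have uU0 := unitary_rep_unitary (irrep_unitary U0) sl.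
have uU2 := unitary_rep_unitary (irrep_unitary U2) sl.
rewrite !adjZ !mulmx_adj !trmxCK -!scalemxAl -!mulmxA -scalerDr -mulmxDr => /eqP.
rewrite scaler_eq0 (negbTE rC0) /= => /eqP/(unitary_mul_eq0 uV) h.
have h0 := congr1 (mulmx (gradient_symbol q0 (e1 R))) h.
have h2 := congr1 (mulmx (gradient_symbol q2 (e1 R))) h.
move: h0 h2; rewrite !mulmxDr !mulmx0.
rewrite ![gradient_symbol q0 (e1 R) *m (_ *m _)]mulmxA.
rewrite ![gradient_symbol q2 (e1 R) *m (_ *m _)]mulmxA xE yE o02 o20 !mul0mx.
rewrite addr0 add0r !mul_scalar_mx => /eqP; rewrite scaler_eq0 (negbTE x0) /= => /eqP h0.
move=> /eqP; rewrite scaler_eq0 (negbTE y0) /= => /eqP h2.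
by split; [apply: unitary_mul_eq0 h0 | apply: unitary_mul_eq0 h2]; rewrite trmxC_unitary.
Qed.

End ComplementaryProjections.

(** * Twisting by the flip and extension to O(4) *)

Section Extension.
Variable R : realType.
Local Notation C := R[i].
Local Notation tau := (flip4 R).

Lemma flip4_diag : tau = diag_mx (\row_j tau j j).
Proof.
apply/matrixP; apply: ord4P; apply: ord4P; rewrite [RHS]mxE [X in _ = X *+ _]mxE;
  by rewrite ?mulr1n ?mulr0n // mxE.
Qed.

Lemma flip4_mulE m (g : 'M[R]_(4, m)) i j : (tau *m g) i j = tau i i * g i j.
Proof. by rewrite {1}flip4_diag mul_diag_mx !mxE. Qed.

Lemma mul_flip4E m (g : 'M[R]_(m, 4)) i j : (g *m tau) i j = g i j * tau j j.
Proof. by rewrite {1}flip4_diag mul_mx_diag !mxE. Qed.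

Lemma flip4_mul_cvg (g : 'M[R]_4) : (fun h => tau *m h) @ nbhs g --> tau *m g.
Proof.
apply: mx_cvg => i j; rewrite flip4_mulE.
under eq_fun do rewrite flip4_mulE.
by apply: cvgM; [exact: cvg_cst | exact: coord_continuous].
Qed.

Lemma flip4_conj_cvg (g : 'M[R]_4) : (fun h => tau *m h *m tau) @ nbhs g --> tau *m g *m tau.
Proof.
apply: mx_cvg => i j; rewrite mul_flip4E flip4_mulE.
under eq_fun do rewrite mul_flip4E flip4_mulE.
by apply: cvgM; [apply: cvgM; [exact: cvg_cst | exact: coord_continuous] | exact: cvg_cst].
Qed.

Lemma within_map (G H : set 'M[R]_4) (phi : 'M[R]_4 -> 'M[R]_4) g :
  (\forall h \near g, G h -> H (phi h)) -> phi @ nbhs g --> phi g ->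
  phi @ within G (nbhs g) --> within H (nbhs (phi g)).
Proof.
move=> GH cphi A /= wA; have := cphi _ wA; rewrite !nbhs_filterE /= => near_g.
by apply: filterS2 GH near_g => h GHh Ah Gh; exact/Ah/GHh.
Qed.

Lemma mcvg_comp (T T' : Type) (F : set_system T) (F' : set_system T') (phi : T -> T') m n
    (f : T' -> 'M[C]_(m, n)) A :
  phi @ F --> F' -> mcvg F' f A -> mcvg F (f \o phi) A.
Proof.
move=> Fphi fA i j; have [fr fi] := fA i j.
by split; [exact: cvg_comp Fphi fr | exact: cvg_comp Fphi fi].
Qed.

Lemma unitary_rep_mcvg (G : set 'M[R]_4) d (rho : 'M[R]_4 -> 'M[C]_d) g :
  unitary_rep G rho -> G g -> mcvg (within G (nbhs g)) rho (rho g).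
Proof.
move=> [cRe cIm _ _ _] Gg i j.
have hRe := (subspace_continuousP _ _).1 cRe g Gg.
have hIm := (subspace_continuousP _ _).1 cIm g Gg.
have entry (f : C -> R) : (map_mx f (rho h)) @[h --> within G (nbhs g)]
    --> map_mx f (rho g) -> (fun h => f (rho h i j)) @ within G (nbhs g) --> f (rho g i j).
  move=> hf; have := @mx_cvg_entry _ _ (within G (nbhs g)) _ _ (fun h => map_mx f (rho h))
    (map_mx f (rho g)) _ hf i j.
  by rewrite mxE; under eq_fun do rewrite mxE; apply.
by split; [exact: (entry _ hRe) | exact: (entry _ hIm)].
Qed.

Lemma mcvg_within_continuous (G : set 'M[R]_4) d (rho : 'M[R]_4 -> 'M[C]_d) :
  (forall g, G g -> mcvg (within G (nbhs g)) rho (rho g)) ->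
  {within G, continuous (fun g => map_mx (@complex.Re R) (rho g))} /\
  {within G, continuous (fun g => map_mx (@complex.Im R) (rho g))}.
Proof.
move=> crho; split; apply/subspace_continuousP => g Gg; apply: mx_cvg => i j.
  have [+ _] := crho g Gg i j; rewrite mxE.
  by under [in X in _ -> X]eq_fun do rewrite mxE.
have [_ +] := crho g Gg i j; rewrite mxE.
by under [in X in _ -> X]eq_fun do rewrite mxE.
Qed.

Definition twist d (rho : 'M[R]_4 -> 'M[C]_d) (g : 'M[R]_4) := rho (tau *m g *m tau).

Lemma conj_flip4K (g : 'M[R]_4) : tau *m (tau *m g *m tau) *m tau = g.
Proof. by rewrite -!mulmxA flip4K mulmx1 mulmxA flip4K mul1mx. Qed.

Lemma conj_flip4M (g h : 'M[R]_4) :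
  tau *m (g *m h) *m tau = (tau *m g *m tau) *m (tau *m h *m tau).
Proof. by rewrite -!mulmxA [tau *m (tau *m _)]mulmxA flip4K mul1mx. Qed.

Lemma twistK d (rho : 'M[R]_4 -> 'M[C]_d) : twist (twist rho) = rho.
Proof. by apply: funext => g; rewrite /twist conj_flip4K. Qed.

Lemma twist_unitary d (rho : 'M[R]_4 -> 'M[C]_d) :
  unitary_rep (SOgroup R 4) rho -> unitary_rep (SOgroup R 4) (twist rho).
Proof.
move=> U; have [cRe cIm] : {within SOgroup R 4, continuous (fun g => map_mx (@complex.Re R) (twist rho g))} /\
    {within SOgroup R 4, continuous (fun g => map_mx (@complex.Im R) (twist rho g))}.
  apply: mcvg_within_continuous => g Gg.
  apply: mcvg_comp (unitary_rep_mcvg U (SOgroup_conj_flip4 Gg)).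
  have conj_SO : \forall h \near g, SOgroup R 4 h -> SOgroup R 4 (tau *m h *m tau).
    by near=> h; exact: SOgroup_conj_flip4.
  exact: (within_map conj_SO (@flip4_conj_cvg g)).
case: U => _ _ r1 rM rU; split; [exact: cRe | exact: cIm | | |].
- by rewrite /twist mulmx1 flip4K.
- by move=> g h Gg Gh; rewrite /twist conj_flip4M rM //; exact: SOgroup_conj_flip4.
- by move=> g Gg; apply: rU; exact: SOgroup_conj_flip4.
Unshelve. all: by end_near. Qed.

Lemma twist_irreducible d (rho : 'M[R]_4 -> 'M[C]_d) :
  irreducible_rep (SOgroup R 4) rho -> irreducible_rep (SOgroup R 4) (twist rho).
Proof.
move=> [d0 irr]; split => // W WI; apply: irr => g v Gg vW.
by rewrite -(twistK rho); apply: WI => //; exact: SOgroup_conj_flip4.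
Qed.

(** Conjugation by the flip inverts the rotation of the second plane; in quaternions it exchanges
    the left and right angles s and u. *)
Lemma twist_weight d (rho : 'M[R]_4 -> 'M[C]_d) (m1 m2 : int) :
  is_weight rho m1 m2 -> is_weight (twist rho) m1 (- m2).
Proof.
move=> [v v0 vw]; exists v => // z1 z2 /cexp_surj[a ->] /cexp_surj[b ->].
pose s := (a + b) / 2; pose u := (a - b) / 2.
have aE : a = s + u by rewrite /s /u; field.
have bE : b = s - u by rewrite /s /u; field.
have -> : twist rho (torus (cexp a) (cexp b)) = rho (torus (cexp a) (cexp (- b))).
  rewrite /twist; congr rho; rewrite {1}aE bE opprB torus_quat conj_flip4M.
  rewrite -/(rquat (cos s) (sin s) 0 0).
  have -> : tau *m rquat (cos u) (sin u) 0 0 *m tau = lquat (cos u) (sin u) 0 0.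
    by rewrite /rquat conj_flip4K.
  by rewrite -lquat_rquat_comm -torus_quat aE [s + u]addrC.
have norm1 t : `|cexp t : C| = 1 by rewrite normc_def /= cos2Dsin2 sqrtr1.
by rewrite vw ?norm1 // cexpN exprz_inv.
Qed.

Lemma twist_highest_weight d (rho : 'M[R]_4 -> 'M[C]_d) (l1 l2 : int) :
  highest_weight rho l1 l2 -> highest_weight (twist rho) l1 (- l2).
Proof.
move=> [w hw]; split; first exact: twist_weight.
move=> m1 m2 /twist_weight; rewrite twistK => /hw[a [b [e1 e2]]].
(* Negating the second coordinate exchanges the two simple roots, and with them their
   coefficients. *)
exists b, a; split; first by rewrite e1 addrC.
by rewrite -[RHS]opprB -e2; ring.
Qed.

Definition twist_irrep (l1 l2 : int) (V : irrep R l1 l2) : irrep R l1 (- l2) :=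
  Irrep (twist_unitary (irrep_unitary V)) (twist_irreducible (irrep_irreducible V))
    (twist_highest_weight (irrep_highest_weight V)).

End Extension.

(** * Extension of a representation from SO(4) to O(4) by an involution *)

Section OrthogonalExtension.
Variable R : realType.
Local Notation C := R[i].
Local Notation tau := (flip4 R).

Lemma mcvg_block (T : Type) (F : set_system T) {FF : Filter F} m1 m2 n1 n2
    (A : T -> 'M[C]_(m1, n1)) (B : T -> 'M[C]_(m1, n2)) (D : T -> 'M[C]_(m2, n1))
    (E : T -> 'M[C]_(m2, n2)) A0 B0 D0 E0 :
  mcvg F A A0 -> mcvg F B B0 -> mcvg F D D0 -> mcvg F E E0 ->
  mcvg F (fun x => block_mx (A x) (B x) (D x) (E x)) (block_mx A0 B0 D0 E0).
Proof.
move=> cA cB cD cE i j.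
case: (split_ordP i) => k ->; case: (split_ordP j) => l ->.
- by under eq_fun do rewrite block_mxEul; rewrite block_mxEul; exact: cA.
- by under eq_fun do rewrite block_mxEur; rewrite block_mxEur; exact: cB.
- by under eq_fun do rewrite block_mxEdl; rewrite block_mxEdl; exact: cD.
- by under eq_fun do rewrite block_mxEdr; rewrite block_mxEdr; exact: cE.
Qed.

Lemma mcvg_near (T : Type) (F : set_system T) {FF : Filter F} m n
    (f g : T -> 'M[C]_(m, n)) A :
  (\forall x \near F, f x = g x) -> mcvg F f A -> mcvg F g A.
Proof.
move=> fg fA i j; have [fr fi] := fA i j.
split; [apply: cvg_trans fr | apply: cvg_trans fi]; apply: near_eq_cvg;
  by apply: filterS fg => x ->.
Qed.

Lemma unitary_rep_block d e (rho : 'M[R]_4 -> 'M[C]_d) (rho' : 'M[R]_4 -> 'M[C]_e) :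
  unitary_rep (SOgroup R 4) rho -> unitary_rep (SOgroup R 4) rho' ->
  unitary_rep (SOgroup R 4) (fun g => block_mx (rho g) 0 0 (rho' g)).
Proof.
move=> U U'; pose W g := block_mx (rho g) 0 0 (rho' g).
have cW g : SOgroup R 4 g -> mcvg (within (SOgroup R 4) (nbhs g)) W (W g).
  move=> Gg; apply: mcvg_block; [exact: unitary_rep_mcvg U Gg | exact: mcvg_cst |
    exact: mcvg_cst | exact: unitary_rep_mcvg U' Gg].
have [cRe cIm] := mcvg_within_continuous cW.
case: U => _ _ r1 rM rU; case: U' => _ _ r1' rM' rU'.
split; [exact: cRe | exact: cIm | | |].
- by rewrite r1 r1' -scalar_mx_block.
- move=> g h Gg Gh; rewrite rM // rM' // mulmx_block.
  by rewrite !mulmx0 !mul0mx !addr0 add0r.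
- move=> g Gg; apply/unitarymxP; rewrite tr_block_mx map_block_mx !adj0 mulmx_block.
  rewrite !mulmx0 !mul0mx !addr0 add0r (elimT unitarymxP (rU g Gg)).
  by rewrite (elimT unitarymxP (rU' g Gg)) -scalar_mx_block.
Qed.

Lemma Ogroup_cases (g : 'M[R]_4) : Ogroup R 4 g ->
  SOgroup R 4 g \/ SOgroup R 4 (tau *m g) /\ \det g = -1.
Proof.
move=> gO; have : (\det g) ^+ 2 = 1.
  by rewrite expr2 -{2}(det_tr g) -det_mulmx gO det1.
move/eqP; rewrite sqrf_eq1 => /orP[/eqP g1|/eqP g1]; first by left.
right; split => //; split; first by apply: Ogroup_mul => //; exact: Ogroup_flip4.
by rewrite det_mulmx det_flip4 g1 mulrNN mulr1.
Qed.

Lemma det_cvg (g : 'M[R]_4) : (fun h : 'M[R]_4 => \det h) @ nbhs g --> \det g.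
Proof.
have cg : mcvg (nbhs g) (fun h : 'M[R]_4 => complexify h) (complexify g).
  move=> i j; rewrite mxE; under eq_fun do rewrite mxE.
  by split => /=; [exact: coord_continuous | exact: cvg_cst].
have [+ _] := mcvg_det cg.
rewrite /complexify det_map_mx /=.
by under [in X in X -> _]eq_fun do rewrite det_map_mx /=.
Qed.

Lemma det_near (g : 'M[R]_4) : \forall h \near g, `|\det g - \det h| < 1.
Proof. by have /cvgrPdist_lt/(_ 1 ltr01) := @det_cvg g. Qed.

Section Extend.
Variables (d : nat) (W : 'M[R]_4 -> 'M[C]_d) (J : 'M[C]_d).
Hypotheses (UW : unitary_rep (SOgroup R 4) W) (JJ : J *m J = 1%:M).
Hypotheses (JU : J \is unitarymx).
Hypothesis JW : forall g, SOgroup R 4 g -> J *m W g = W (tau *m g *m tau) *m J.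

(** O(4) is the semidirect product of SO(4) and the group generated by tau; [J] is the prescribed
    image of tau. *)
Definition extend (g : 'M[R]_4) := if \det g == 1 then W g else J *m W (tau *m g).

Lemma extend_SO g : SOgroup R 4 g -> extend g = W g.
Proof. by move=> [_ g1]; rewrite /extend g1 eqxx. Qed.

Lemma N1_neq1 : (-1 == 1 :> R) = false.
Proof. by apply: lt_eqF; apply: lt_trans ltr01; rewrite ltrN10. Qed.

Lemma extend_flip g : \det g = -1 -> extend g = J *m W (tau *m g).
Proof. by move=> g1; rewrite /extend g1 N1_neq1. Qed.

Lemma extend_mul g h : Ogroup R 4 g -> Ogroup R 4 h ->
  extend (g *m h) = extend g *m extend h.
Proof.
have [_ _ _ WM _] := UW.
move=> /Ogroup_cases[Gg|[Gg g1]] /Ogroup_cases[Gh|[Gh h1]].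
- by rewrite !extend_SO ?WM //; exact: SOgroup_mul.
- have gh1 : \det (g *m h) = -1 by rewrite det_mulmx h1 Gg.2 mul1r.
  rewrite (extend_flip gh1) (extend_flip h1) extend_SO //.
  have Gg' := SOgroup_conj_flip4 Gg.
  have WJ : W g *m J = J *m W (tau *m g *m tau) by rewrite (JW Gg') conj_flip4K.
  rewrite [RHS]mulmxA WJ -[RHS]mulmxA -WM //; congr (_ *m W _).
  by rewrite -!mulmxA [tau *m (tau *m h)]mulmxA flip4K mul1mx.
- have gh1 : \det (g *m h) = -1 by rewrite det_mulmx g1 Gh.2 mulr1.
  by rewrite (extend_flip gh1) (extend_flip g1) (extend_SO Gh) -mulmxA -WM // mulmxA.
- have gh1 : SOgroup R 4 (g *m h).
    have -> : g *m h = (tau *m (tau *m g) *m tau) *m (tau *m h).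
      by rewrite -!mulmxA [tau *m (tau *m h)]mulmxA flip4K mul1mx mulmxA flip4K mul1mx.
    by apply: SOgroup_mul => //; exact: SOgroup_conj_flip4.
  rewrite (extend_flip g1) (extend_flip h1) extend_SO // JW // -mulmxA.
  rewrite [J *m (J *m _)]mulmxA JJ mul1mx -WM //; last exact: SOgroup_conj_flip4.
  congr W; rewrite -!mulmxA [tau *m (tau *m h)]mulmxA flip4K mul1mx.
  by rewrite mulmxA flip4K mul1mx.
Qed.

(** On O(4) the determinant is 1 or -1 and continuous, so all orthogonal matrices near g fall into
    the same branch as g. *)
Lemma extend_mcvg g : Ogroup R 4 g -> mcvg (within (Ogroup R 4) (nbhs g)) extend (extend g).
Proof.
move=> /[dup] gO /Ogroup_cases[Gg|[Gg g1]].
  have near1 : \forall h \near g, Ogroup R 4 h -> SOgroup R 4 h.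
    near=> h => hO; have hg : `|\det g - \det h| < 1 by near: h; exact: det_near.
    case: (Ogroup_cases hO) => // -[_ h1]; move: hg; rewrite h1 Gg.2 opprK ger0_norm //.
    by rewrite gtrDl ltr10.
  have cW : mcvg (within (Ogroup R 4) (nbhs g)) W (W g).
    apply: (mcvg_comp (phi := id) _ (unitary_rep_mcvg UW Gg)).
    exact: (@within_map R _ _ id g near1 (@cvg_id _ _)).
  rewrite extend_SO //; apply: mcvg_near cW; rewrite near_withinE.
  by apply: filterS near1 => h near1 hO; rewrite extend_SO //; exact: near1.
have near1 : \forall h \near g, Ogroup R 4 h -> SOgroup R 4 (tau *m h) /\ \det h = -1.
  near=> h => hO; have hg : `|\det g - \det h| < 1 by near: h; exact: det_near.
  case: (Ogroup_cases hO) => // -[_ h1]; move: hg; rewrite h1 g1 -opprD normrN ger0_norm //.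
  by rewrite gtrDl ltr10.
have cW : mcvg (within (Ogroup R 4) (nbhs g)) (fun h => J *m W (tau *m h)) (J *m W (tau *m g)).
  apply: mcvgM; first exact: mcvg_cst.
  apply: (mcvg_comp _ (unitary_rep_mcvg UW Gg)); apply: within_map.
    by apply: filterS near1 => h near1 /near1[].
  exact: flip4_mul_cvg.
rewrite extend_flip //; apply: mcvg_near cW; rewrite near_withinE.
by apply: filterS near1 => h near1 /near1[_ h1]; rewrite extend_flip.
Unshelve. all: by end_near. Qed.

Lemma extend_unitary_rep : unitary_rep (Ogroup R 4) extend.
Proof.
have [cRe cIm] := mcvg_within_continuous extend_mcvg.
have [_ _ W1 _ WU] := UW.
split; [exact: cRe | exact: cIm | | exact: extend_mul |].
- by rewrite extend_SO //; split; [rewrite /Ogroup /= trmx1 mulmx1 | rewrite det1].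
- move=> g /Ogroup_cases[Gg|[Gg g1]]; first by rewrite (extend_SO Gg); exact: (WU _ Gg).
  by rewrite (extend_flip g1); exact: (mul_unitarymx JU (WU _ Gg)).
Qed.

End Extend.
End OrthogonalExtension.

(** * The higher signature symbol *)

Lemma unitmx_injective (K : fieldType) d (M : 'M[K]_d) :
  (forall v : 'cV[K]_d, M *m v = 0 -> v = 0) -> M \in unitmx.
Proof.
move=> Minj; rewrite -unitmx_tr -row_free_unit -kermx_eq0; apply/eqP/row_matrixP => i.
rewrite row0; apply: trmx_inj; rewrite trmx0; apply: Minj.
by rewrite -{1}[M]trmxK -trmx_mul -row_mul mulmx_ker row0 trmx0.
Qed.

Lemma adj_intertwine_mx (C : numClosedFieldType) d e (A : 'M[C]_d) (B : 'M[C]_e)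
    (X Y : 'M[C]_(d, e)) : A \is unitarymx -> B \is unitarymx ->
  Y *m B = A *m X -> Y^t* *m A = B *m X^t*.
Proof.
move=> /unitarymxP/mulmx1C AA /unitarymxP BB YB.
have -> : Y = A *m X *m B^t* by rewrite -YB -mulmxA BB mulmx1.
by rewrite !mulmx_adj trmxCK -!mulmxA AA mulmx1.
Qed.

Section ChiralBlocks.
Variable R : realType.
Local Notation C := R[i].
Local Notation tau := (flip4 R).
Variables (dp dm : nat) (A : 'M[R]_4 -> 'M[C]_dp) (B : 'M[R]_4 -> 'M[C]_dm).
Variables (S : 'M[C]_(dm, dp)) (X : 'cV[R]_4 -> 'M[C]_(dp, dm)).
Hypotheses (UA : unitary_rep (SOgroup R 4) A) (UB : unitary_rep (SOgroup R 4) B).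
Hypotheses (SS : S *m S^t* = 1%:M) (SS' : S^t* *m S = 1%:M).
Hypothesis SAB : forall g, SOgroup R 4 g -> S *m A g = B (tau *m g *m tau) *m S.
Hypothesis Xlin : forall (a : R) (x y : 'cV[R]_4), X (a *: x + y) = a%:C *: X x + X y.
Hypothesis Xequiv : forall g zeta, SOgroup R 4 g -> X (g *m zeta) *m B g = A g *m X zeta.
Hypothesis Xflip : forall zeta, X (tau *m zeta) *m S = - (S^t* *m (X zeta)^t*).
Hypothesis Xinj : forall (zeta : 'cV[R]_4) (v : 'cV[C]_dm), zeta != 0 -> X zeta *m v = 0 -> v = 0.

Let W g : 'M[C]_(dp + dm) := block_mx (A g) 0 0 (B g).
(** An orientation reversal must exchange the two chiralities. Equivariance of [sigma] under this
    matrix is the condition [Xflip], whose sign is that of the skew lower block. *)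
Let J : 'M[C]_(dp + dm) := block_mx 0 (S^t*) S 0.
Let sigma zeta : 'M[C]_(dp + dm) := block_mx 0 (X zeta) (- (X zeta)^t*) 0.
Let grading : 'M[C]_(dp + dm) := block_mx 1%:M 0 0 (- 1%:M).
(** The alternating map whose value at the identity matrix is the grading. The sign of det tau
    matches the anticommutation of [J] with the grading. *)
Let eps (M : 'M[R]_4) : 'M[C]_(dp + dm) := (\det M)%:C *: grading.

Let blockE := (mulmx_block, mulmx0, mul0mx, addr0, add0r).

Let UW : unitary_rep (SOgroup R 4) W := unitary_rep_block UA UB.

Let JJ : J *m J = 1%:M.
Proof. by rewrite /J !blockE SS SS' -scalar_mx_block. Qed.

Let J_adj : J^t* = J.
Proof. by rewrite /J tr_block_mx map_block_mx !adj0 trmxCK. Qed.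

Let JU : J \is unitarymx.
Proof. by apply/unitarymxP; rewrite J_adj JJ. Qed.

Let SAB_adj g : SOgroup R 4 g -> S^t* *m B g = A (tau *m g *m tau) *m S^t*.
Proof.
move=> Gg; have Gg' := SOgroup_conj_flip4 Gg.
have := SAB Gg'; rewrite conj_flip4K => E.
by rewrite -[LHS]mulmx1 -SS !mulmxA -[_ *m B g *m S]mulmxA -E mulmxA SS' mul1mx.
Qed.

Let JW g : SOgroup R 4 g -> J *m W g = W (tau *m g *m tau) *m J.
Proof. by move=> Gg; rewrite /J /W !blockE SAB // SAB_adj. Qed.

Let rho := extend W J.

Let sigma_lin : real_linear sigma.
Proof.
move=> a x y; rewrite /sigma Xlin scale_block_mx add_block_mx !scaler0 !addr0.
have aJ : Num.conj (a%:C : C) = a%:C by apply: conj_Creal; apply/complex_realP; exists a.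
by rewrite adjD adjZ aJ opprD scalerN.
Qed.

Let sigma_SO g zeta : SOgroup R 4 g -> sigma (g *m zeta) *m W g = W g *m sigma zeta.
Proof.
move=> Gg; rewrite /sigma /W !blockE Xequiv //; congr block_mx.
rewrite mulNmx mulmxN; congr (- _).
exact: (adj_intertwine_mx (unitary_rep_unitary UA Gg) (unitary_rep_unitary UB Gg)
  (Xequiv zeta Gg)).
Qed.

Let Xflip' zeta : (X (tau *m zeta))^t* *m S^t* = - (S *m X zeta).
Proof.
have E : - (X zeta)^t* = S *m X (tau *m zeta) *m S.
  by rewrite -mulmxA Xflip mulmxN mulmxA SS mul1mx.
have := congr1 (fun M => M^t*) E; rewrite adjN trmxCK !mulmx_adj => {}E.
have := congr1 (fun M => S *m M) E; rewrite mulmxN !mulmxA SS mul1mx => ->.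
by [].
Qed.

Let sigma_flip zeta : sigma (tau *m zeta) *m J = J *m sigma zeta.
Proof.
rewrite /sigma /J !blockE Xflip mulmxN; congr block_mx.
by rewrite mulNmx Xflip' opprK.
Qed.

Let rho_unit g : Ogroup R 4 g -> rho g \in unitmx.
Proof. by move=> gO; apply: unitarymx_unit; exact: (unitary_rep_unitary (extend_unitary_rep UW JJ JU JW) gO). Qed.

Let sigma_O g zeta : Ogroup R 4 g -> sigma (g *m zeta) *m rho g = rho g *m sigma zeta.
Proof.
move=> /Ogroup_cases[Gg|[Gg g1]]; first by rewrite /rho extend_SO // sigma_SO.
rewrite /rho extend_flip // -mulmxA -sigma_SO // !mulmxA; congr (_ *m _).
rewrite -{1}[g]mul1mx -(flip4K R) -!mulmxA sigma_flip.
by rewrite !mulmxA.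
Qed.

(** Injectivity of the lower block comes from that of X at the flipped covector, since S X (tau
    zeta) S equals this block. *)
Let sigma_unit (zeta : 'cV[R]_4) : zeta != 0 -> sigma zeta \in unitmx.
Proof.
move=> z0; apply: unitmx_injective => v.
rewrite -[v]vsubmxK /sigma mul_block_col !mul0mx add0r addr0 => /eqP.
rewrite col_mx_eq0 => /andP[/eqP X1 /eqP X2]; rewrite (Xinj z0 X1).
have tz0 : tau *m zeta != 0.
  by apply: contraNneq z0 => tz; rewrite -[zeta]mul1mx -(flip4K R) -mulmxA tz mulmx0.
have E : - (X zeta)^t* = S *m X (tau *m zeta) *m S.
  by rewrite -mulmxA Xflip mulmxN mulmxA SS mul1mx.
have X3 : X (tau *m zeta) *m (S *m usubmx v) = 0.
  rewrite -[LHS]mul1mx -SS' -!mulmxA [X in _ *m X]mulmxA [X in _ *m X]mulmxA -E X2.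
  by rewrite mulmx0.
have := congr1 (mulmx (S^t*)) (Xinj tz0 X3); rewrite mulmxA SS' mul1mx mulmx0 => ->.
by rewrite col_mx0.
Qed.

Let grading_W g : SOgroup R 4 g -> W g *m grading = grading *m W g.
Proof. by move=> _; rewrite /W /grading !blockE !mulmx1 !mul1mx mulmxN mulNmx mulmx1 mul1mx. Qed.

Let grading_J : J *m grading = - (grading *m J).
Proof.
rewrite /J /grading !blockE !mulmx1 !mul1mx mulmxN mulNmx mulmx1 mul1mx.
by rewrite opp_block_mx !oppr0 opprK.
Qed.

Let eps_O g M : Ogroup R 4 g -> eps (g *m M) *m rho g = rho g *m eps M.
Proof.
move=> /Ogroup_cases[Gg|[Gg g1]].
  rewrite /rho extend_SO // /eps det_mulmx Gg.2 mul1r -scalemxAl -scalemxAr.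
  by rewrite grading_W.
rewrite /rho extend_flip // /eps det_mulmx g1 mulN1r rmorphN scaleNr mulNmx.
rewrite -scalemxAl -scalemxAr -scalerN; congr (_ *: _).
by rewrite mulmxA -mulNmx -grading_J -!mulmxA grading_W.
Qed.

Let eps_alt : alternating_multilinear eps.
Proof.
split=> [M N P j b c cj N' P'|M j1 j2 j12 c12].
  rewrite /eps !scalerA -scalerDl -!rmorphM -rmorphD; congr (_%:C *: _).
  rewrite -(det_tr M) -(det_tr N) -(det_tr P).
  apply: (@determinant_multilinear _ _ _ _ _ j).
  - by rewrite -!tr_col cj linearD !linearZ.
  - by rewrite -!tr_col' N'.
  - by rewrite -!tr_col' P'.
rewrite /eps -det_tr (determinant_alternate j12) ?rmorph0 ?scale0r // => i.
by have /colP/(_ i) := c12; rewrite !mxE.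
Qed.

Lemma chiral_of_blocks : exists (r : 'M[R]_4 -> 'M[C]_(dp + dm)) (e : 'M[R]_4 -> 'M[C]_(dp + dm)),
  [/\ forall g, SOgroup R 4 g -> r g = block_mx (A g) 0 0 (B g),
      e 1%:M = block_mx 1%:M 0 0 (- 1%:M) &
      chiral_universal_elliptic_symbol r
        (fun zeta => block_mx 0 (X zeta) (- (X zeta)^t*) 0) e].
Proof.
have eps1 : eps 1%:M = grading by rewrite /eps det1 rmorph1 scale1r.
exists rho, eps; split; [by move=> g Gg; rewrite /rho extend_SO | exact: eps1 | split].
- exact: extend_unitary_rep UW JJ JU JW.
- exact: sigma_lin.
- move=> g zeta gO; rewrite -[X in X *m invmx _](sigma_O zeta gO).
  by rewrite mulmxK // rho_unit.
- exact: sigma_unit.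
- exact: eps_alt.
- move=> g M gO; rewrite -[X in X *m invmx _](eps_O M gO).
  by rewrite mulmxK // rho_unit.
- move=> zeta; rewrite tr_block_mx map_block_mx !adj0 adjN trmxCK.
  by rewrite opp_block_mx !oppr0 opprK.
- rewrite eps1 /grading !blockE !mulmx1 mulmxN mulmx1 opprK -scalar_mx_block //.
- move=> zeta; rewrite eps1 /grading !blockE !mulmx1 !mul1mx !mulmxN !mulNmx !mulmx1 !mul1mx.
  by rewrite opp_block_mx !oppr0 !opprK.
Qed.

End ChiralBlocks.

(** * Transport of projections by the flip and the choice of phases *)

Section MatchedProjections.
Variable R : realType.
Local Notation C := R[i].
Local Notation tau := (flip4 R).

Lemma adj_tens m n p q (A : 'M[C]_(m, n)) (B : 'M[C]_(p, q)) :
  (A *t B)^t* = A^t* *t B^t*.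
Proof. by apply/matrixP => i j; rewrite !mxE rmorphM. Qed.

Lemma tensmx11 m n : (1%:M : 'M[C]_m) *t (1%:M : 'M[C]_n) = 1%:M.
Proof.
apply/matrixP => i j; case: (mxtens_indexP i) => a b; case: (mxtens_indexP j) => c d.
by rewrite tensmxE !mxE (can_eq (@mxtens_indexK m n)) xpair_eqE -natrM mulnb.
Qed.

Lemma complexify_adj m n (A : 'M[R]_(m, n)) : (complexify A)^t* = complexify A^T.
Proof.
apply/matrixP => i j; rewrite !mxE.
by apply: conj_Creal; apply/complex_realP; exists (A j i).
Qed.

Lemma complexify_flip4 : complexify tau *m (complexify tau)^t* = 1%:M.
Proof. by rewrite complexify_adj flip4_tr -complexifyM flip4K /complexify map_mx1. Qed.

Section Flip.
Variables (l1 l2 l1' l2' k1 k2 k1' k2' : int).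
Variables (V : irrep R l1 l2) (V' : irrep R l1' l2') (U : irrep R k1 k2) (U' : irrep R k1' k2').
Variables (T : 'M[C]_(irrep_dim V', irrep_dim V)) (S : 'M[C]_(irrep_dim U', irrep_dim U)).
Hypotheses (TT : T *m T^t* = 1%:M) (SS' : S^t* *m S = 1%:M).
Hypothesis TI : forall g, SOgroup R 4 g -> T *m V g = V' (tau *m g *m tau) *m T.
Hypothesis SI : forall g, SOgroup R 4 g -> S *m U g = U' (tau *m g *m tau) *m S.
Variable r : summand_projection V' U'.

Let M := S^t* *m r *m (complexify tau *t T).

Let M_unitary : M \is unitarymx.
Proof.
apply/unitarymxP; rewrite /M !mulmx_adj trmxCK adj_tens !mulmxA.
rewrite -[_ *m (_ *t T) *m _]mulmxA tensmx_mul complexify_flip4 TT tensmx11 mulmx1.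
rewrite -[_ *m r *m _]mulmxA (elimT unitarymxP (projection_unitary r)) mulmx1.
exact: SS'.
Qed.

Let M_equiv g : SOgroup R 4 g -> M *m (complexify g *t V g) = U g *m M.
Proof.
move=> Gg; have Gg' := SOgroup_conj_flip4 Gg; rewrite /M.
rewrite -[LHS]mulmxA tensmx_mul TI // -complexifyM.
have -> : complexify (tau *m g) = complexify (tau *m g *m tau) *m complexify tau.
  by rewrite -complexifyM -mulmxA flip4K mulmx1.
rewrite -tensmx_mul mulmxA -[_ *m r *m _]mulmxA projection_equivariant //.
have uU := irrep_unitary U; have uU' := twist_unitary (irrep_unitary U').
have E : S^t* *m U' (tau *m g *m tau) = U g *m S^t*.
  exact: (unitary_rep_adj_intertwine uU uU' Gg (SI Gg)).
by rewrite !mulmxA E.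
Qed.

(** The projection r pulled back along tau on covectors, T on the source and S on the target;
    multiplicity one will compare it with q. *)
Definition flip_projection : summand_projection V U := SummandProjection M_unitary M_equiv.

Lemma flip_projectionE : S *m S^t* = 1%:M ->
  S *m projection_mx flip_projection = projection_mx r *m (complexify tau *t T).
Proof. by move=> SS; rewrite /= /M !mulmxA SS mul1mx. Qed.

End Flip.

(* The equivariant isometry S is determined up to a phase, which multiplicity
   one lets us choose so that the flip carries q to r. *)
Lemma matched_isometry (l1 l2 l1' l2' k1 k2 k1' k2' m1 m2 : int)
    (V : irrep R l1 l2) (V' : irrep R l1' l2') (U : irrep R k1 k2) (U' : irrep R k1' k2')
    (U2 : irrep R m1 m2) (T : 'M[C]_(irrep_dim V', irrep_dim V))
    (q : summand_projection V U) (q2 : summand_projection V U2)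
    (r : summand_projection V' U') (a b : nat) :
  k1 + k2 = a%:Z -> k1 - k2 = 0%:Z -> k1' - k2' = a%:Z -> k1' + k2' = 0%:Z ->
  m1 + m2 = b%:Z -> m1 - m2 = 0%:Z -> a != b ->
  irrep_dim V = (irrep_dim U + irrep_dim U2)%N ->
  T *m T^t* = 1%:M ->
  (forall g, SOgroup R 4 g -> T *m V g = V' (tau *m g *m tau) *m T) ->
  exists S : 'M[C]_(irrep_dim U', irrep_dim U),
    [/\ S *m S^t* = 1%:M, S^t* *m S = 1%:M,
        forall g, SOgroup R 4 g -> S *m U g = U' (tau *m g *m tau) *m S &
        forall zeta, S *m gradient_symbol q zeta = gradient_symbol r (tau *m zeta) *m T].
Proof.
move=> aE a'E aE' a'E' bE b'E ab dimV TT TI.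
have [S [SS SS' SI]] : exists S : 'M[C]_(irrep_dim U', irrep_dim U),
    [/\ S *m S^t* = 1%:M, S^t* *m S = 1%:M &
        forall g, SOgroup R 4 g -> S *m U g = U' (tau *m g *m tau) *m S].
  by apply: (irrep_unique U (twist_irrep U') aE a'E aE'); rewrite opprK.
have [c cc E] := projection_multiplicity_one aE a'E bE b'E ab dimV q
  (flip_projection TT SS' TI SI r) q2.
exists (c *: S); split.
- by rewrite adjZ -scalemxAl -scalemxAr scalerA cc scale1r SS.
- by rewrite adjZ -scalemxAl -scalemxAr scalerA mulrC cc scale1r SS'.
- by move=> g Gg; rewrite -scalemxAl SI // scalemxAr.
- apply: gradient_symbol_intertwine.
  by rewrite -scalemxAl scalemxAr -E flip_projectionE.
Qed.

End MatchedProjections.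

(** * Calculus of three-by-three cross-shaped and diagonal block matrices *)

Section Cross.
Variable C : numClosedFieldType.

Lemma cross3_adj a1 a2 a3 b1 b2 b3 (A : 'M[C]_(a1, b2)) (B : 'M[C]_(a2, b1))
    (D : 'M[C]_(a2, b3)) (E : 'M[C]_(a3, b2)) :
  (cross3_mx A B D E)^t* = cross3_mx (B^t*) (A^t*) (E^t*) (D^t*).
Proof.
rewrite /cross3_mx tr_block_mx map_block_mx tr_col_mx tr_row_mx map_row_mx map_col_mx.
by rewrite tr_block_mx map_block_mx !adj0.
Qed.

Lemma cross3_mul a1 a2 a3 b1 b2 b3 c1 c2 c3 (A : 'M[C]_(a1, b2)) (B : 'M[C]_(a2, b1))
    (D : 'M[C]_(a2, b3)) (E : 'M[C]_(a3, b2))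
    (P : 'M[C]_(b1, c1)) (Q : 'M[C]_(b2, c2)) (S : 'M[C]_(b3, c3)) :
  cross3_mx A B D E *m block_mx P 0 0 (block_mx Q 0 0 S) =
  cross3_mx (A *m Q) (B *m P) (D *m S) (E *m Q).
Proof.
rewrite /cross3_mx mulmx_block mul_row_block mul_col_mx mulmx_block.
by rewrite !(mul0mx, mulmx0, addr0, add0r) ?col_mx0.
Qed.

Lemma mul_cross3 a1 a2 a3 b1 b2 b3 c1 c2 c3 (A : 'M[C]_(a1, b2)) (B : 'M[C]_(a2, b1))
    (D : 'M[C]_(a2, b3)) (E : 'M[C]_(a3, b2))
    (P : 'M[C]_(c1, a1)) (Q : 'M[C]_(c2, a2)) (S : 'M[C]_(c3, a3)) :
  block_mx P 0 0 (block_mx Q 0 0 S) *m cross3_mx A B D E =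
  cross3_mx (P *m A) (Q *m B) (Q *m D) (S *m E).
Proof.
rewrite /cross3_mx mulmx_block mul_mx_row mul_block_col mulmx_block.
by rewrite !(mul0mx, mulmx0, addr0, add0r) ?row_mx0.
Qed.

Lemma cross3_opp a1 a2 a3 b1 b2 b3 (A : 'M[C]_(a1, b2)) (B : 'M[C]_(a2, b1))
    (D : 'M[C]_(a2, b3)) (E : 'M[C]_(a3, b2)) :
  - cross3_mx A B D E = cross3_mx (- A) (- B) (- D) (- E).
Proof. by rewrite /cross3_mx !(opp_block_mx, opp_row_mx, opp_col_mx) !oppr0. Qed.

Lemma cross3_linear a1 a2 a3 b1 b2 b3 (c : C) (A A' : 'M[C]_(a1, b2)) (B B' : 'M[C]_(a2, b1))
    (D D' : 'M[C]_(a2, b3)) (E E' : 'M[C]_(a3, b2)) :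
  cross3_mx (c *: A + A') (c *: B + B') (c *: D + D') (c *: E + E') =
  c *: cross3_mx A B D E + cross3_mx A' B' D' E'.
Proof.
rewrite /cross3_mx !(scale_block_mx, scale_row_mx, scale_col_mx, add_block_mx).
by rewrite add_row_mx add_col_mx !scaler0 !addr0.
Qed.

Lemma block3_adj a1 a2 a3 b1 b2 b3 (P : 'M[C]_(a1, b1)) (Q : 'M[C]_(a2, b2))
    (S : 'M[C]_(a3, b3)) :
  (block_mx P 0 0 (block_mx Q 0 0 S))^t* =
  block_mx (P^t*) 0 0 (block_mx (Q^t*) 0 0 (S^t*)).
Proof. by rewrite !tr_block_mx !map_block_mx !adj0. Qed.

Lemma block3_mul a1 a2 a3 b1 b2 b3 c1 c2 c3 (P : 'M[C]_(a1, b1)) (Q : 'M[C]_(a2, b2))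
    (S : 'M[C]_(a3, b3)) (P' : 'M[C]_(b1, c1)) (Q' : 'M[C]_(b2, c2)) (S' : 'M[C]_(b3, c3)) :
  block_mx P 0 0 (block_mx Q 0 0 S) *m block_mx P' 0 0 (block_mx Q' 0 0 S') =
  block_mx (P *m P') 0 0 (block_mx (Q *m Q') 0 0 (S *m S')).
Proof. by rewrite !mulmx_block !(mul0mx, mulmx0, addr0, add0r). Qed.

Lemma block3_1 a1 a2 a3 :
  block_mx 1%:M 0 0 (block_mx 1%:M 0 0 1%:M) = 1%:M :> 'M[C]_(a1 + (a2 + a3)).
Proof. by rewrite -!scalar_mx_block. Qed.

End Cross.

(** * The six summands assembled *)

Theorem mainTheorem5 (R : realType) (mu : nat)
    (V0p : irrep R mu%:Z mu%:Z)
    (V1m : irrep R mu.+1%:Z (- mu%:Z))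
    (V2p : irrep R mu.+1%:Z mu.+1%:Z)
    (V0m : irrep R mu%:Z (- mu%:Z))
    (V1p : irrep R mu.+1%:Z mu%:Z)
    (V2m : irrep R mu.+1%:Z (- mu.+1%:Z))
    (q0 : summand_projection V1p V0p) (q2 : summand_projection V1p V2p)
    (r0 : summand_projection V1m V0m) (r2 : summand_projection V1m V2m) :
  exists (rho : 'M[R]_4 -> 'M[R[i]]_(W_dim V0p V1m V2p V0m V1p V2m))
         (eps : 'M[R]_4 -> 'M[R[i]]_(W_dim V0p V1m V2p V0m V1p V2m)),
    [/\ forall g : 'M[R]_4, SOgroup R 4 g -> rho g = W_act V0p V1m V2p V0m V1p V2m g,
        eps 1%:M = W_grading V0p V1m V2p V0m V1p V2m &
        chiral_universal_elliptic_symbol rho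
          (higher_signature_symbol q0 q2 r0 r2) eps].
Proof.
have a0 : mu%:Z + mu%:Z = (mu + mu)%N%:Z by rewrite PoszD.
have b0 : mu%:Z - mu%:Z = 0%:Z by rewrite subrr.
have a1 : mu.+1%:Z + mu%:Z = (mu.+1 + mu)%N%:Z by rewrite PoszD.
have b1 : mu.+1%:Z - mu%:Z = 1%:Z by rewrite intS addrK.
have a2 : mu.+1%:Z + mu.+1%:Z = (mu.+1 + mu.+1)%N%:Z by rewrite PoszD.
have b2 : mu.+1%:Z - mu.+1%:Z = 0%:Z by rewrite subrr.
have a0' : mu%:Z - - mu%:Z = (mu + mu)%N%:Z by rewrite opprK.
have a2' : mu.+1%:Z - - mu.+1%:Z = (mu.+1 + mu.+1)%N%:Z by rewrite opprK.
have ne : (mu + mu != mu.+1 + mu.+1)%N by rewrite addSn addnS ltn_eqF // ltnW.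
(* By [irrep_dimE] this is 2 (2 mu + 2) = (2 mu + 1) + (2 mu + 3). *)
have dimV : irrep_dim V1p = (irrep_dim V0p + irrep_dim V2p)%N.
  by rewrite (irrep_dimE V1p a1 b1) (irrep_dimE V0p a0 b0) (irrep_dimE V2p a2 b2); ring.
have dimV' : irrep_dim V1p = (irrep_dim V2p + irrep_dim V0p)%N by rewrite addnC.
(* The phase of T is arbitrary; those of S0 and S2 are adjusted to it. *)
have [T [TT T'T TI]] : exists T : 'M[R[i]]_(irrep_dim V1m, irrep_dim V1p),
    [/\ T *m T^t* = 1%:M, T^t* *m T = 1%:M &
        forall g, SOgroup R 4 g -> T *m V1p g = V1m (flip4 R *m g *m flip4 R) *m T].
  by apply: (irrep_unique V1p (twist_irrep V1m) a1 b1); rewrite opprK.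
have [S0 [SS0 S'S0 SI0 E0]] := matched_isometry q0 q2 r0 a0 b0 a0' b0 a2 b2 ne dimV TT TI.
rewrite eq_sym in ne.
have [S2 [SS2 S'S2 SI2 E2]] := matched_isometry q2 q0 r2 a2 b2 a2' b2 a0 b0 ne dimV' TT TI.
rewrite eq_sym in ne.
have TI' g : SOgroup R 4 g -> T^t* *m V1m g = V1p (flip4 R *m g *m flip4 R) *m T^t*.
  move=> Gg; have Gg' := SOgroup_conj_flip4 Gg.
  have := TI _ Gg'; rewrite conj_flip4K => E.
  have [U U'] := (irrep_unitary V1p, irrep_unitary V1m).
  exact: adj_intertwine_mx (unitary_rep_unitary U' Gg) (unitary_rep_unitary U Gg') E.
(* S maps W_mu^+ to W_mu^-. The middle summand goes from V1m to V1p, against the direction of T,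
   hence the adjoint. *)
pose S := block_mx S0 0 0 (block_mx (T^t*) 0 0 S2).
pose X zeta := cross3_mx (gradient_symbol q0 zeta) (adjoint_symbol (gradient_symbol r0) zeta)
  (adjoint_symbol (gradient_symbol r2) zeta) (gradient_symbol q2 zeta).
have U3 d1 d2 d3 (r1 : 'M[R]_4 -> 'M[R[i]]_d1) (r2' : 'M[R]_4 -> 'M[R[i]]_d2)
    (r3 : 'M[R]_4 -> 'M[R[i]]_d3) : unitary_rep (SOgroup R 4) r1 ->
    unitary_rep (SOgroup R 4) r2' -> unitary_rep (SOgroup R 4) r3 ->
    unitary_rep (SOgroup R 4) (fun g => diag3_mx (r1 g) (r2' g) (r3 g)).
  by move=> u1 u2 u3; exact: unitary_rep_block u1 (unitary_rep_block u2 u3).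
(* The formal adjoints already carry a minus sign, so the lower block is minus the adjoint of the
   upper one. *)
have -> : higher_signature_symbol q0 q2 r0 r2 =
    (fun zeta => block_mx 0 (X zeta) (- (X zeta)^t*) 0).
  apply: funext => zeta; rewrite /higher_signature_symbol -/(X zeta) cross3_adj cross3_opp.
  by rewrite /adjoint_symbol !adjN !trmxCK !opprK.
apply: (chiral_of_blocks (U3 _ _ _ _ _ _ (irrep_unitary V0p) (irrep_unitary V1m) (irrep_unitary V2p))
  (U3 _ _ _ _ _ _ (irrep_unitary V0m) (irrep_unitary V1p) (irrep_unitary V2m)) (S := S)).
- by rewrite /S block3_adj block3_mul SS0 trmxCK T'T SS2 block3_1.
- by rewrite /S block3_adj block3_mul S'S0 trmxCK TT S'S2 block3_1.
- by move=> g Gg; rewrite /S /diag3_mx !block3_mul SI0 // TI' // SI2.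
- move=> a x y; rewrite /X -cross3_linear /adjoint_symbol !gradient_symbol_linear.
  have aJ : Num.conj (a%:C : R[i]) = a%:C.
    by apply: conj_Creal; apply/complex_realP; exists a.
  by rewrite !adjD !adjZ aJ !opprD !scalerN.
- move=> g zeta Gg; rewrite /X cross3_mul mul_cross3 /adjoint_symbol.
  rewrite -!projection_symbol_equivariant // !mulNmx !mulmxN.
  have u0 := unitary_rep_unitary (irrep_unitary V0m) Gg.
  have u1 := unitary_rep_unitary (irrep_unitary V1m) Gg.
  have u2 := unitary_rep_unitary (irrep_unitary V2m) Gg.
  rewrite (adj_intertwine_mx u0 u1 (esym (projection_symbol_equivariant r0 zeta Gg))).
  by rewrite (adj_intertwine_mx u2 u1 (esym (projection_symbol_equivariant r2 zeta Gg))).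
- move=> zeta; rewrite /X cross3_mul cross3_adj block3_adj mul_cross3 cross3_opp.
  rewrite /adjoint_symbol !adjN !trmxCK !mulmxN !opprK !mulNmx.
  have inv k m n p (Q : 'M[R[i]]_(k, m)) (G : 'M[R[i]]_(m, n)) (G' : 'M[R[i]]_(k, p))
      (Z : 'M[R[i]]_(p, n)) : Q^t* *m Q = 1%:M -> Z *m Z^t* = 1%:M ->
      Q *m G = G' *m Z -> G *m Z^t* = Q^t* *m G'.
    move=> QQ ZZ QG; rewrite -[G]mul1mx -QQ -!mulmxA [Q *m (_ *m _)]mulmxA QG.
    by rewrite -!mulmxA ZZ mulmx1.
  have flipK : flip4 R *m (flip4 R *m zeta) = zeta by rewrite mulmxA flip4K mul1mx.
  rewrite (inv _ _ _ _ _ _ _ _ S'S0 TT (etrans (E0 _) (congr1 (fun z => gradient_symbol r0 z *m T) flipK))).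
  rewrite (inv _ _ _ _ _ _ _ _ S'S2 TT (etrans (E2 _) (congr1 (fun z => gradient_symbol r2 z *m T) flipK))).
  have adjE k (A : 'M[R[i]]_(k, irrep_dim V1p)) l (Q : 'M[R[i]]_(l, k))
      (G : 'M[R[i]]_(l, irrep_dim V1m)) : Q^t* *m Q = 1%:M ->
      Q *m A = G *m T -> G^t* *m Q = T *m A^t*.
    move=> QQ QA; have := congr1 (fun M => T *m M^t* *m Q) QA.
    by rewrite !mulmx_adj !mulmxA TT mul1mx -!mulmxA QQ mulmx1 => ->.
  by rewrite (adjE _ _ _ _ _ S'S0 (E0 zeta)) (adjE _ _ _ _ _ S'S2 (E2 zeta)).
- move=> zeta v z0.
  have [y0 [x1 [y2 ->]]] : exists y0 x1 y2, v = col_mx y0 (col_mx x1 y2).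
    by exists (usubmx v), (usubmx (dsubmx v)), (dsubmx (dsubmx v)); rewrite !vsubmxK.
  rewrite /X /cross3_mx mul_block_col mul_row_col mul_col_mx mul_block_col.
  rewrite !(mul0mx, mulmx0, addr0, add0r) add_col_mx add0r => /eqP.
  rewrite !col_mx_eq0 => /andP[/eqP h1 /andP[/eqP h2 /eqP h3]].
  (* The outer rows say that both components of the symbol of tilde P_mu^- kill x1. The middle row
     involves r0 and r2; the flip turns it into an equation for the adjoints of q0 and q2 at tau
     zeta. *)
  have -> : x1 = 0 by exact: (symbol_pair_injective a0 b0 a2 b2 ne dimV z0 h1 h3).
  have tz0 : flip4 R *m zeta != 0.
    apply: contraNneq z0 => tz; rewrite -[zeta]mul1mx -(flip4K R) -mulmxA tz.
    by rewrite mulmx0.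
  have flipK : flip4 R *m (flip4 R *m zeta) = zeta by rewrite mulmxA flip4K mul1mx.
  have F0 := E0 (flip4 R *m zeta); have F2 := E2 (flip4 R *m zeta).
  rewrite flipK in F0 F2.
  have h : (gradient_symbol q0 (flip4 R *m zeta))^t* *m (S0^t* *m y0) +
      (gradient_symbol q2 (flip4 R *m zeta))^t* *m (S2^t* *m y2) = 0.
    rewrite !mulmxA -!mulmx_adj F0 F2 !mulmx_adj -!mulmxA -mulmxDr.
    move: h2; rewrite /adjoint_symbol !mulNmx -opprD => /eqP; rewrite oppr_eq0 => /eqP ->.
    by rewrite mulmx0.
  have [g0 g2] := symbol_pair_adj_injective a0 b0 a2 b2 ne tz0 h.
  have -> : y0 = 0 by rewrite -[y0]mul1mx -SS0 -mulmxA g0 mulmx0.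
  have -> : y2 = 0 by rewrite -[y2]mul1mx -SS2 -mulmxA g2 mulmx0.
  by rewrite !col_mx0.
Qed.
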